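(* Let $n\ge1$, $s\in\{1,\dots,1+n\}$ and $\Omega=\mathbb C\setminus(\{1/k:k\in\mathbb N,k\ge1\}\cup\{0\})$. For every $\hbar\in\Omega$, the product $\star_{\mathrm{red},\hbar}$ on $\mathcal P(M_{\mathrm{red}})$ extends to a continuous associative product on $\mathcal A(M_{\mathrm{red}})$. Moreover $\mathcal A(M_{\mathrm{red}})$ becomes a unital Fréchet-$^*$-algebra with this product and pointwise complex conjugation as $^*$-involution in the case that $\hbar\in\Omega\cap\mathbb R$. Finally, for any two fixed elements $f,g\in\mathcal A(M_{\mathrm{red}})$ and $[\rho]\in M_{\mathrm{red}}$, the map $\Omega\to\mathbb C$, $\hbar\mapsto(f\star_{\mathrm{red},\hbar}g)([\rho])$ is holomorphic.
   Context: Let $\nu_k=+1$ for $0\le k\le s-1$ and $\nu_k=-1$ for $s\le k\le n$. On $\mathbb C^{1+n}$ put $J=\sum_{k=0}^n\nu_kz^k\bar z^k$, $Z=J^{-1}(\{1\})$ and $M_{\mathrm{red}}=Z/U(1)$, identified with the open complex submanifold $\{[\rho]:J(\rho)>0\}$ of $\mathbb{CP}^n$. Let $\hat J(\xi,\eta)=\sum_{k=0}^n\nu_k\xi^k\eta^k$ on $\mathbb C^{1+n}\times\mathbb C^{1+n}$, $\hat Z=\hat J^{-1}(\{1\})$ and $\hat M_{\mathrm{red}}=\hat Z/\mathbb C^*$, where $\alpha\in\mathbb C^*$ acts by $(\xi,\eta)\mapsto(\alpha\xi,\alpha^{-1}\eta)$; this is a complex manifold, identified with the open subset $\{([\xi],[\eta]):\hat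 J(\xi,\eta)\neq0\}$ of $\mathbb{CP}^n\times\mathbb{CP}^n$. Let $\Delta_{\mathrm{red}}:M_{\mathrm{red}}\to\hat M_{\mathrm{red}}$, $[\rho]\mapsto[(\rho,\bar\rho)]$ for $\rho\in Z$. Then $\mathcal A(M_{\mathrm{red}})=\{\hat g\circ\Delta_{\mathrm{red}}:\hat g\in\mathcal O(\hat M_{\mathrm{red}})\}$, with the Fréchet topology of locally uniform convergence of the (unique) holomorphic extensions $\hat g$ on $\hat M_{\mathrm{red}}$. For $P,Q\in\mathbb N_0^{1+n}$ with $|P|=|Q|$ let $b_{P,Q;\mathrm{red}}([\rho])=\rho^P\bar\rho^Q$ for $\rho\in Z$; their span is $\mathcal P(M_{\mathrm{red}})\subseteq\mathcal A(M_{\mathrm{red}})$. With $(x)_{\downarrow,m}=\prod_{j=0}^{m-1}(x-j)$ and $\mathrm{sgn}(T)=\prod_{k=0}^n\nu_k^{T_k}$, for $\hbar\in\Omega$ the product $\star_{\mathrm{red},\hbar}$ on $\mathcal P(M_{\mathrm{red}})$ is the (well-defined, associative) bilinear product with $$b_{P,Q;\mathrm{red}}\star_{\mathrm{red},\hbar}b_{R,S;\mathrm{red}}=\sum_{T=0}^{\min\{Q,R\}}\mathrm{sgn}(T)\frac{(1/\hbar)_{\downarrow,|Q+R-T|}}{(1/\hbar)_{\downarrow,|Q|}(1/\hbar)_{\downarrow,|R|}}T!\binom QT\binom RT\,b_{P+R-T,Q+S-T;\mathrm{red}}$$ for $|P|=|Q|$, $|R|=|S|$ (sum over multiindices $0\le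 T\le\min\{Q,R\}$, elementwise). In the last assertion $\star_{\mathrm{red},\hbar}$ denotes the continuous extension to $\mathcal A(M_{\mathrm{red}})$. A Fréchet-$^*$-algebra is an associative algebra with a complete metrizable locally convex topology, continuous multiplication and a continuous $^*$-involution. *)

(* Defs.v *)
From HB Require Import structures.
From mathcomp Require Import all_boot all_order all_algebra.
From mathcomp Require Import complex generic_quotient.
From mathcomp Require Import all_classical all_reals.
From mathcomp Require Import topology normedtype derive convex.
From mathcomp Require Import ring.

Set Implicit Arguments.
Unset Strict Implicit.
Unset Printing Implicit Defensive.

Import Order.TTheory GRing.Theory Num.Theory.
Import numFieldNormedType.Exports.

Local Open Scope classical_set_scope.
Local Open Scope ring_scope.
Local Open Scope quotient_scope.

(* R[i], packed so that the topology and normed-module structure of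
   numFieldNormedType apply to it. *)
Definition Cplx (R : realType) : numClosedFieldType := R[i].

Section ReducedSpaces.
Variables (R : realType) (n s : nat).
Local Notation C := (Cplx R).
Local Notation V := 'rV[C]_n.+1.

Definition nu (k : 'I_n.+1) : C := if (k < s)%N then 1 else -1.

Definition J (z : V) : C := \sum_k nu k * z 0 k * (z 0 k)^*.

Definition Jhat (p : V * V) : C := \sum_k nu k * p.1 0 k * p.2 0 k.

Definition Z : set V := [set z | J z = 1].
Definition Zhat : set (V * V) := [set p | Jhat p = 1].

Definition U1_rel (z w : Z) : bool :=
  `[< exists2 u : C, `|u| = 1 & val w = u *: val z >].

Definition Cstar_rel (p q : Zhat) : bool :=
  `[< exists2 a : C, a != 0 & val q = (a *: (val p).1, a^-1 *: (val p).2) >].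

Fact U1_rel_refl : reflexive U1_rel.
Proof. by move=> z; apply/asboolP; exists 1; rewrite ?normr1 ?scale1r. Qed.

Fact U1_rel_sym : symmetric U1_rel.
Proof.
have H z w : U1_rel z w -> U1_rel w z.
  move=> /asboolP[u u1 e]; have u0 : u != 0 by rewrite -normr_gt0 u1.
  apply/asboolP; exists u^-1; first by rewrite normfV u1 invr1.
  by rewrite e scalerA mulVf ?scale1r.
by move=> z w; apply/idP/idP; apply: H.
Qed.

Fact U1_rel_trans : transitive U1_rel.
Proof.
move=> w z t /asboolP[u u1 e] /asboolP[v v1 f]; apply/asboolP.
by exists (v * u); rewrite ?normrM ?u1 ?v1 ?mulr1// f e scalerA.
Qed.

Canonical U1_equiv := EquivRel U1_rel U1_rel_refl U1_rel_sym U1_rel_trans.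

Fact Cstar_rel_refl : reflexive Cstar_rel.
Proof.
move=> p; apply/asboolP; exists 1; rewrite ?oner_eq0// invr1 !scale1r.
by case: (val p).
Qed.

Fact Cstar_rel_sym : symmetric Cstar_rel.
Proof.
have H p q : Cstar_rel p q -> Cstar_rel q p.
  move=> /asboolP[a a0 e]; apply/asboolP; exists a^-1; rewrite ?invr_eq0//.
  by rewrite e /= invrK !scalerA mulVf// mulfV// !scale1r; case: (val p).
by move=> p q; apply/idP/idP; apply: H.
Qed.

Fact Cstar_rel_trans : transitive Cstar_rel.
Proof.
move=> q p t /asboolP[a a0 e] /asboolP[b b0 f]; apply/asboolP.
exists (b * a); first by rewrite mulf_neq0.
by rewrite f e /= !scalerA invfM.
Qed.

Canonical Cstar_equiv :=
  EquivRel Cstar_rel Cstar_rel_refl Cstar_rel_sym Cstar_rel_trans.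

Definition Mred := {eq_quot U1_equiv}.

(* carries the quotient of the subspace topology of Zhat *)
Definition Mhat := quotient_topology {eq_quot Cstar_equiv}.
HB.instance Definition _ := Topological.on Mhat.
HB.instance Definition _ := Quotient.on Mhat.

(* The affine chart {z_i <> 0} of CP^n has inverse x |-> [affine i x], where
   affine i x has a 1 inserted at position i. *)
Definition affine (i : 'I_n.+1) (x : 'rV[C]_n) : V :=
  \row_k oapp (x 0) 1 (unlift i k).

(* g read in the chart {xi_i <> 0, eta_j <> 0} of CP^n x CP^n. The point
   ([xi], [eta]) with Jhat (xi, eta) <> 0 is the class of
   (Jhat (xi, eta)^-1 *: xi, eta) in Mhat; outside the (open) set where
   Jhat (xi, eta) <> 0 the value is irrelevant and set to 0. *)
Definition in_chart (g : Mhat -> C) (i j : 'I_n.+1) (x : 'rV[C]_n * 'rV[C]_n)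
    : C :=
  let xi := affine i x.1 in let eta := affine j x.2 in
  if insub ((Jhat (xi, eta))^-1 *: xi, eta) is Some p
  then g (\pi_Mhat (p : Zhat)) else 0.

Definition holomorphic (g : Mhat -> C) : Prop :=
  forall (i j : 'I_n.+1) (x : 'rV[C]_n * 'rV[C]_n),
    Jhat (affine i x.1, affine j x.2) != 0 -> differentiable (in_chart g i j) x.

Fact diagonal_in_Zhat (z : Z) :
  (val z, map_mx Num.conj (val z)) \in Zhat.
Proof.
rewrite inE /Zhat /= -[RHS](set_mem (valP z)).
by apply: eq_bigr => k _; rewrite mxE.
Qed.

Definition diagonal (z : Z) : Zhat :=
  exist (fun p => p \in Zhat) _ (diagonal_in_Zhat z).

Definition Delta_red (x : Mred) : Mhat := \pi_Mhat (diagonal (repr x)).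

Lemma Delta_redE (z : Z) :
  Delta_red (\pi z) = \pi_Mhat (diagonal z).
Proof.
apply/eqmodP => /=.
have /eqmodP/asboolP[u u1 e] : repr (\pi_Mred z) = z %[mod Mred].
  by rewrite reprK.
have u0 : u != 0 by rewrite -normr_gt0 u1.
apply/asboolP; exists u => //=; rewrite e map_mxZ; congr (_, _ *: _).
by rewrite invC_norm u1 expr1n invr1 mul1r.
Qed.

Definition analytic (f : Mred -> C) : Prop :=
  exists2 ghat : Mhat -> C, holomorphic ghat & f = ghat \o Delta_red.

Definition analytic_pred : {pred Mred -> C} := fun f => `[< analytic f >].

Fact analytic_submod_closed : submod_closed analytic_pred.
Proof.
split.
  apply/asboolP; exists (cst 0) => // i j x _.
  rewrite (_ : in_chart _ _ _ = cst 0); first exact: differentiable_cst.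
  by apply/funext => y; rewrite /in_chart; case: insub.
move=> a _ _ /asboolP[f hf ->] /asboolP[g hg ->]; apply/asboolP.
exists (a *: f + g) => // i j x x0.
rewrite (_ : in_chart _ _ _ = a *: in_chart f i j + in_chart g i j).
  by apply: differentiableD; [apply: differentiableZ; exact: hf | exact: hg].
apply/funext => y; rewrite /in_chart !fctE.
by case: insub => //; rewrite scaler0 addr0.
Qed.

HB.instance Definition _ := GRing.isSubmodClosed.Build C (Mred -> C)
  analytic_pred analytic_submod_closed.

Record A : Type := AnalyticFun {
  afun :> Mred -> C ;
  _ : afun \in analytic_pred
}.

HB.instance Definition _ := [isSub for afun].
HB.instance Definition _ := [Choice of A by <:].
HB.instance Definition _ := [SubChoice_isSubLmodule of A by <:].

Fact A_has_extension (f : A) :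
  exists ghat : Mhat -> C, holomorphic ghat /\ (f : Mred -> C) = ghat \o Delta_red.
Proof. by case: f => f /= /asboolP[g]; exists g. Qed.

(* The choice is immaterial: the extension is unique when 0 < s, by the
   identity theorem. *)
Definition extension (f : A) : {family compact, Mhat -> C} :=
  projT1 (cid (A_has_extension f)).

(* Mhat is locally compact, so locally uniform convergence is uniform
   convergence on compact sets. *)
HB.instance Definition _ := Uniform.copy A (initial_topology extension).

Definition multiindex := {ffun 'I_n.+1 -> nat}.

Definition mdeg (P : multiindex) : nat := \sum_k P k.

Definition mpow (z : V) (P : multiindex) : C := \prod_k z 0 k ^+ P k.

Definition b_red (P Q : multiindex) (x : Mred) : C :=
  let rho := val (repr x) in mpow rho P * mpow (map_mx Num.conj rho) Q.

Lemma mpowZ (a : C) (z : V) P : mpow (a *: z) P = a ^+ mdeg P * mpow z P.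
Proof.
rewrite /mpow /mdeg -prodrXr -big_split /=.
by apply: eq_bigr => k _; rewrite mxE exprMn.
Qed.

Lemma b_redE P Q (z : Z) : mdeg P = mdeg Q ->
  b_red P Q (\pi z) = mpow (val z) P * mpow (map_mx Num.conj (val z)) Q.
Proof.
move=> PQ; rewrite /b_red /=.
have /eqmodP/asboolP[u u1 ->] : repr (\pi_Mred z) = z %[mod Mred].
  by rewrite reprK.
rewrite map_mxZ !mpowZ PQ mulrACA -exprMn -normCK u1 expr1n expr1n mul1r //.
Qed.

Definition bhat (P Q : multiindex) (w : Mhat) : C :=
  let p := val (repr w) in mpow p.1 P * mpow p.2 Q.

Fact bhatE P Q (p : Zhat) : mdeg P = mdeg Q ->
  bhat P Q (\pi_Mhat p) = mpow (val p).1 P * mpow (val p).2 Q.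
Proof.
move=> PQ; rewrite /bhat /=.
have /eqmodP/asboolP[a a0 ->] :
    repr (\pi_{eq_quot Cstar_equiv} p) = p %[mod {eq_quot Cstar_equiv}].
  by rewrite reprK.
by rewrite /= !mpowZ PQ mulrACA -exprMn mulfV// expr1n mul1r.
Qed.

Fact diff_prod (W : normedModType C) (f : 'I_n.+1 -> W -> C) (x : W) :
  (forall k, differentiable (f k) x) ->
  differentiable (fun y => \prod_k f k y : C) x.
Proof.
move=> df; rewrite (_ : (fun y => _) = \prod_k f k); last first.
  by apply/funext => y; rewrite fct_prodE.
apply: (big_ind (fun h : W -> C => differentiable h x)) => [|g h dg dh|k _].
- exact: differentiable_cst.
- exact: differentiableM.
- exact: df.
Qed.

Fact diff_exp (W : normedModType C) (f : W -> C) (x : W) m :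
  differentiable f x -> differentiable (fun y => f y ^+ m : C) x.
Proof.
move=> df; elim: m => [|m IH]; first exact: differentiable_cst.
rewrite (_ : (fun y => _) = f * (fun y => f y ^+ m)); first exact: differentiableM.
by apply/funext => y; rewrite exprS.
Qed.

Fact diff_affine (W : normedModType C) (f : W -> 'rV[C]_n) i k (x : W) :
  differentiable f x -> differentiable (fun y => affine i (f y) 0 k : C) x.
Proof.
move=> df; rewrite (_ : (fun y => _) = fun y => oapp (f y 0) 1 (unlift i k));
  last by apply/funext => y; rewrite mxE.
case: (unlift i k) => [l|] /=; last exact: differentiable_cst.
by apply: (@differentiable_comp _ _ _ _ f (fun N : 'rV[C]_n => N 0 l : C)) => //;
  exact: differentiable_coord.
Qed.

Fact diff_fst (W1 W2 : normedModType C) (x : W1 * W2) :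
  differentiable (fun y : W1 * W2 => y.1) x.
Proof. by apply/(@linear_differentiable _ _ _ fst) => y; exact: cvg_fst. Qed.

Fact diff_snd (W1 W2 : normedModType C) (x : W1 * W2) :
  differentiable (fun y : W1 * W2 => y.2) x.
Proof. by apply/(@linear_differentiable _ _ _ snd) => y; exact: cvg_snd. Qed.

Lemma b_red_analytic P Q : mdeg P = mdeg Q -> b_red P Q \in analytic_pred.
Proof.
move=> PQ; apply/asboolP; exists (bhat P Q); last first.
  apply/funext => x /=; rewrite /Delta_red bhatE//.
move=> i j x x0.
pose xi k (y : 'rV[C]_n * 'rV[C]_n) : C := affine i y.1 0 k.
pose eta k (y : 'rV[C]_n * 'rV[C]_n) : C := affine j y.2 0 k.
pose jj (y : 'rV[C]_n * 'rV[C]_n) : C := Jhat (affine i y.1, affine j y.2).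
have dxi k : differentiable (xi k) x by exact/diff_affine/diff_fst.
have deta k : differentiable (eta k) x by exact/diff_affine/diff_snd.
have djj : differentiable jj x.
  rewrite (_ : jj = \sum_k (nu k *: (xi k * eta k))).
    apply: differentiable_sum => k; apply: differentiableZ.
    exact: differentiableM.
  apply/funext => y; rewrite fct_sumE /jj /Jhat.
  by apply: eq_bigr => k _ /=; rewrite -mulrA.
rewrite (_ : in_chart _ _ _ = (fun y => (jj y)^-1) * jj *
   ((fun y => (jj y)^-1 ^+ mdeg P) *
   (fun y => \prod_k xi k y ^+ P k) * (fun y => \prod_k eta k y ^+ Q k))).
  have dV := differentiableV djj x0.
  apply: differentiableM; first exact: differentiableM.
  apply: differentiableM; last by apply: diff_prod => k; exact: diff_exp.
  apply: differentiableM; first exact: diff_exp.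
  by apply: diff_prod => k; exact: diff_exp.
apply/funext => y; rewrite /in_chart !fctE -/(jj y).
have jZ : Jhat ((jj y)^-1 *: affine i y.1, affine j y.2) = (jj y)^-1 * jj y.
  rewrite {3}/jj /Jhat mulr_sumr; apply: eq_bigr => k _ /=.
  by rewrite mxE; ring.
case: insubP => [p _ ep|].
  rewrite bhatE// ep /= mpowZ.
  have := set_mem (valP p); rewrite /Zhat /= ep jZ => ->.
  by rewrite mul1r.
move=> /negP H.
have [->|y0] := eqVneq (jj y) 0; first by rewrite mulr0 mul0r.
by case: H; apply/mem_set; rewrite /Zhat /= jZ mulVf.
Qed.

Definition monomial (P Q : multiindex) (PQ : mdeg P = mdeg Q) : A :=
  AnalyticFun (b_red_analytic PQ).

Definition falling (x : C) (m : nat) : C := \prod_(j < m) (x - j%:R).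

Definition sgn (T : multiindex) : C := \prod_k nu k ^+ T k.

Definition star_coef (hbar : C) (Q R T : multiindex) : C :=
  sgn T *
  (falling hbar^-1 (mdeg [ffun k => Q k + R k - T k]%N) /
   (falling hbar^-1 (mdeg Q) * falling hbar^-1 (mdeg R))) *
  (\prod_k ((T k)`! * 'C(Q k, T k) * 'C(R k, T k)))%:R.

(* The sum runs over all T with T k <= minn (Q k) (R k) for every k. *)
Definition star_monomial (hbar : C) (P Q R S : multiindex) : Mred -> C :=
  \sum_(T : {dffun forall k : 'I_n.+1, 'I_(minn (Q k) (R k)).+1})
    star_coef hbar Q R [ffun k => T k : nat] *:
    b_red [ffun k => P k + R k - T k]%N [ffun k => Q k + S k - T k]%N.

Definition Omega : set C :=
  ~` ([set k%:R^-1 | k in [set k | (0 < k)%N]] `|` [set 0]).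

Definition bilinear_product (mul : A -> A -> A) : Prop :=
  (forall f, linear (mul f)) /\ (forall g, linear (mul^~ g)).

(* A bilinear map on A extends the product of the span of the monomials iff it
   takes the prescribed values on pairs of monomials. *)
Definition extends_star_red (hbar : C) (mul : A -> A -> A) : Prop :=
  bilinear_product mul /\
  forall P Q R S (PQ : mdeg P = mdeg Q) (RS : mdeg R = mdeg S),
    mul (monomial PQ) (monomial RS) = star_monomial hbar P Q R S :> (Mred -> C).

Definition continuous_extension (hbar : C) (mul : A -> A -> A) : Prop :=
  extends_star_red hbar mul /\ continuous (fun p : A * A => mul p.1 p.2).

End ReducedSpaces.

Section Frechet.
Variable R : realType.
Local Notation C := (Cplx R).

Definition metrizable (E : topologicalType) : Prop :=
  exists d : E -> E -> R,
    [/\ forall x y, d x y = 0 <-> x = y,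
        forall x y, d x y = d y x,
        forall x y z, d x z <= d x y + d y z &
        forall x (U : set E),
          nbhs x U <-> exists2 e : R, 0 < e & [set y | d x y < e] `<=` U].

Record frechet_space (E : preTopologicalLmodType C) : Prop := FrechetSpace {
  frechet_add_continuous : continuous (fun p : E * E => p.1 + p.2) ;
  frechet_scale_continuous : continuous (fun p : C * E => p.1 *: p.2) ;
  frechet_locally_convex : exists2 B : set_system E,
    (forall b, b \in B -> convex_set b) & basis B ;
  frechet_metrizable : metrizable E ;
  frechet_complete : forall F : set_system E, ProperFilter F ->
    (forall U : set E, nbhs 0 U ->
       exists2 X, F X & forall x y, X x -> X y -> U (x - y)) ->
    exists x : E, F --> x
}.

Record unital_frechet_star_algebra (E : preTopologicalLmodType C)
    (mul : E -> E -> E) (inv : E -> E) : Prop := UnitalFrechetStarAlgebra {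
  fsa_frechet : frechet_space E ;
  fsa_linearl : forall g, linear (mul^~ g) ;
  fsa_linearr : forall f, linear (mul f) ;
  fsa_assoc : associative mul ;
  fsa_unit : exists e, left_id e mul /\ right_id e mul ;
  fsa_mul_continuous : continuous (fun p : E * E => mul p.1 p.2) ;
  fsa_inv_antilinear : forall (a : C) f g, inv (a *: f + g) = a^* *: inv f + inv g ;
  fsa_inv_involutive : involutive inv ;
  fsa_inv_mul : forall f g, inv (mul f g) = mul (inv g) (inv f) ;
  fsa_inv_continuous : continuous inv
}.

End Frechet.

(* Main.v *)
Require Import Defs.
From HB Require Import structures.
From mathcomp Require Import all_boot all_order all_algebra.
From mathcomp Require Import complex generic_quotient.
From mathcomp Require Import all_classical all_reals all_analysis.
From mathcomp Require Import ring lra zify.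

(** Every holomorphic function on the complexified reduced space is a series
    in the monomials b_{P,Q} in normal form modulo Jhat = 1, where the zeroth
    coordinate of xi and that of eta never occur together. Such a normal form
    is indexed by [a : 'I_n + 'I_n -> nat], the exponents of the remaining
    coordinates, and the coefficients, obtained by Cauchy estimates in the two
    charts xi^0 = 1 and eta^0 = 1, decrease faster than any geometric sequence.
    They are determined by the restriction to the diagonal, because characters
    are linearly independent. So A(M_red) is, with its topology, the Frechet
    space of rapidly decreasing families of coefficients.

    The product of two basis elements has weighted coefficient norm at most
    K B^(|a|+|b|), with K and B locally uniform in hbar, because the falling
    factorials of 1/hbar are bounded above and below by geometric multiples of
    the factorials. Hence the product extends to a continuous bilinear map, and
    it is a locally uniform limit of rational functions of hbar.

    For associativity and compatibility with the relation J = 1, let b_{P,Q}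
    act as z^P (nu d)^Q / (1/hbar)_{|Q|}, dually on functions of the exponent M
    with |M| = 1/hbar. Composition is then given by Vandermonde's identity, the
    relation J = 1 becomes sum_k (M_k - Q_k) = 1/hbar - |Q|, and this
    representation is faithful on polynomials since 1/hbar is not a natural
    number. *)

Set Implicit Arguments.
Unset Strict Implicit.
Unset Printing Implicit Defensive.

Import Order.TTheory GRing.Theory Num.Theory.
Import numFieldNormedType.Exports.

Local Open Scope classical_set_scope.
Local Open Scope ring_scope.

(** * Complex modulus and Cauchy's theorem on rectangles *)

Section Modulus.
Variable R : realType.
Local Notation C := (Cplx R).
Implicit Types z w : C.

(** The obstacle in the expansion is that no single chart shows all coefficients. A normal form may
    contain a power of the dependent coordinate w = 1 - sum_l nu_l x_l y_l, which is not a monomial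
    in the chart coordinates. With p and q the degrees in x and y, the chart xi^0 = 1 shows pure
    monomials for p <= q only, the chart eta^0 = 1 for p >= q. That both sets of Taylor coefficients
    belong to one series follows from the action (x, y) -> (l x, y / l), which fixes w: along an
    orbit the difference of the two expansions is a Laurent series in l that vanishes for all
    nonzero l, and Liouville's theorem isolates its terms of positive degree.

    Holomorphy is complex differentiability, without continuity of the derivative, so the estimates
    start from Goursat's theorem. Squares replace circles: the integrals then run over real
    intervals, with [kappa] in place of 2 pi i.

    The product is defined on normal forms and must be shown to take the prescribed value on every
    b_{P,Q}. Comparing operators spares the reduction modulo J = 1 inside the sums. *)

Definition cabs z : R := complex.Re (`|z| : R[i]).

(** The norm of [Cplx R] takes values in [Cplx R]. With [rc] and [cabs] all estimates are made in
    the ordered field [R], where [lra] and [nra] apply. *)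
Definition rc (x : R) : C := (real_complex R x).

Lemma rcD : {morph rc : x y / x + y}. Proof. by move=> x y; rewrite /rc rmorphD. Qed.
Lemma rcB : {morph rc : x y / x - y}. Proof. by move=> x y; rewrite /rc rmorphB. Qed.
Lemma rcM : {morph rc : x y / x * y}. Proof. by move=> x y; rewrite /rc rmorphM. Qed.
Lemma rcN : {morph rc : x / - x}. Proof. by move=> x; rewrite /rc rmorphN. Qed.
Lemma rcV : {morph rc : x / x^-1}.
Proof. by move=> x; rewrite /rc -(fmorphV (real_complex R)). Qed.
Lemma rcX n : {morph rc : x / x ^+ n}. Proof. by move=> x; rewrite /rc rmorphXn. Qed.
Lemma rc0 : rc 0 = 0. Proof. by []. Qed.
Lemma rc1 : rc 1 = 1. Proof. by []. Qed.
Lemma rc_nat n : rc n%:R = n%:R. Proof. by rewrite /rc rmorph_nat. Qed.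

Lemma rc_inj : injective rc. Proof. by move=> x y []. Qed.

Lemma rc_ler x y : (rc x <= rc y) = (x <= y). Proof. exact: lecR. Qed.
Lemma rc_ltr x y : (rc x < rc y) = (x < y). Proof. exact: ltcR. Qed.

Lemma normE z : `|z| = rc (cabs z).
Proof. by rewrite /cabs /rc RRe_real// normr_real. Qed.

Lemma cabsE z : cabs z = Num.sqrt ((complex.Re z) ^+ 2 + (complex.Im z) ^+ 2).
Proof. by rewrite /cabs normc_def. Qed.

Lemma cabs_ge0 z : 0 <= cabs z. Proof. by rewrite -rc_ler -normE normr_ge0. Qed.
Lemma cabs0 : cabs 0 = 0. Proof. by apply: rc_inj; rewrite -normE normr0. Qed.
Lemma cabs1 : cabs 1 = 1. Proof. by apply: rc_inj; rewrite -normE normr1. Qed.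
Lemma cabs_eq0 z : (cabs z == 0) = (z == 0).
Proof. by rewrite -[z == 0]normr_eq0 normE -[0 in RHS]rc0 (inj_eq (@rc_inj)). Qed.
Lemma cabs_gt0 z : (0 < cabs z) = (z != 0).
Proof. by rewrite lt0r cabs_eq0 cabs_ge0 andbT. Qed.
Lemma cabsM z w : cabs (z * w) = cabs z * cabs w.
Proof. by apply: rc_inj; rewrite rcM -!normE normrM. Qed.
Lemma cabsN z : cabs (- z) = cabs z.
Proof. by apply: rc_inj; rewrite -!normE normrN. Qed.
Lemma cabsB z w : cabs (z - w) = cabs (w - z).
Proof. by rewrite -cabsN opprB. Qed.
Lemma cabsV z : cabs z^-1 = (cabs z)^-1.
Proof. by apply: rc_inj; rewrite rcV -!normE normfV. Qed.
Lemma cabsX z n : cabs (z ^+ n) = cabs z ^+ n.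
Proof. by apply: rc_inj; rewrite rcX -!normE normrX. Qed.
Lemma cabsD z w : cabs (z + w) <= cabs z + cabs w.
Proof. by rewrite -rc_ler rcD -!normE ler_normD. Qed.
Lemma cabs_triB z w : cabs (z - w) <= cabs z + cabs w.
Proof. by rewrite -(cabsN w) cabsD. Qed.
Lemma cabs_dist z w : cabs z - cabs w <= cabs (z - w).
Proof. by rewrite lerBlDr (le_trans _ (cabsD _ _))// subrK. Qed.
Lemma cabs_rc x : cabs (rc x) = `|x|.
Proof. by rewrite cabsE /= expr0n addr0 sqrtr_sqr. Qed.
Lemma cabs_nat n : cabs n%:R = n%:R.
Proof. by rewrite -rc_nat cabs_rc ger0_norm. Qed.
Lemma cabs_conj z : cabs z^* = cabs z.
Proof. by apply: rc_inj; rewrite -!normE norm_conjC. Qed.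
Lemma cabs_i : cabs 'i = 1.
Proof. by apply: rc_inj; rewrite -normE normCi. Qed.
Lemma cabs_sum (I : Type) (r : seq I) (P : pred I) (F : I -> C) :
  cabs (\sum_(i <- r | P i) F i) <= \sum_(i <- r | P i) cabs (F i).
Proof.
elim/big_rec2: _ => [|i x y _ le]; first by rewrite cabs0.
by rewrite (le_trans (cabsD _ _))// lerD2l.
Qed.
Lemma cabs_prod (I : Type) (r : seq I) (P : pred I) (F : I -> C) :
  cabs (\prod_(i <- r | P i) F i) = \prod_(i <- r | P i) cabs (F i).
Proof. exact: (big_morph cabs cabsM cabs1). Qed.

Lemma Re_le z : `|complex.Re z| <= cabs z.
Proof. by rewrite cabsE -sqrtr_sqr ler_sqrt ?addr_ge0 ?sqr_ge0// lerDl sqr_ge0. Qed.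
Lemma Im_le z : `|complex.Im z| <= cabs z.
Proof. by rewrite cabsE -sqrtr_sqr ler_sqrt ?addr_ge0 ?sqr_ge0// lerDr sqr_ge0. Qed.
Lemma ReIm z : z = rc (complex.Re z) + 'i * rc (complex.Im z).
Proof. by rewrite /rc {1}[z]complexE complexiE. Qed.
Lemma cabs_ReIm z : cabs z <= `|complex.Re z| + `|complex.Im z|.
Proof.
by rewrite {1}[z]ReIm (le_trans (cabsD _ _))// cabsM cabs_i mul1r !cabs_rc.
Qed.

Lemma cabs_le0 z : cabs z <= 0 -> z = 0.
Proof. by move=> h; apply/eqP; rewrite -cabs_eq0 eq_le h cabs_ge0. Qed.

Lemma cabs_small z : (forall e, 0 < e -> cabs z <= e) -> z = 0.
Proof.
by move=> h; apply: cabs_le0; apply/ler_addgt0Pl => e e0; rewrite addr0; exact: h.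
Qed.

End Modulus.

(** * Integrals of complex-valued functions over real intervals *)

Section Integral.
Variable R : realType.
Local Notation C := (Cplx R).
Local Notation mu := (@lebesgue_measure R).
Local Notation Rec := (@complex.Re R).
Local Notation Imc := (@complex.Im R).

Definition rcont (f : R -> C) (t : R) := forall e, 0 < e -> exists2 d : R, 0 < d &
  forall u, `|u - t| < d -> cabs (f u - f t) < e.

(** A linear approximation instead of a limit of quotients, so that [h = 0] is no exception. *)
Definition rderiv (f : R -> C) (t : R) (l : C) :=
  forall e, 0 < e -> exists2 d : R, 0 < d &
  forall h, `|h| < d -> cabs (f (t + h) - f t - l * rc h) <= e * `|h|.

Definition cint (f : R -> C) (a b : R) : C :=
  rc (\int[mu]_(t in `[a, b]) Rec (f t))%R +
  'i * rc (\int[mu]_(t in `[a, b]) Imc (f t))%R.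

Lemma cReB z w : Rec (z - w) = Rec z - Rec w. Proof. by case: z w => [? ?] [? ?]. Qed.
Lemma cImB z w : Imc (z - w) = Imc z - Imc w. Proof. by case: z w => [? ?] [? ?]. Qed.
Lemma cReD z w : Rec (z + w) = Rec z + Rec w. Proof. by case: z w => [? ?] [? ?]. Qed.
Lemma cImD z w : Imc (z + w) = Imc z + Imc w. Proof. by case: z w => [? ?] [? ?]. Qed.
Lemma cReM (z w : C) : Rec (z * w) = Rec z * Rec w - Imc z * Imc w.
Proof. by case: z w => [? ?] [? ?]. Qed.
Lemma cImM (z w : C) : Imc (z * w) = Rec z * Imc w + Imc z * Rec w.
Proof. by case: z w => [? ?] [? ?]. Qed.

Lemma rcont_Re f t : rcont f t -> {for t, continuous (Rec \o f)}.
Proof.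
move=> cf; apply/cvgrPdist_lt => e e0; have [d d0 H] := cf _ e0.
exists d => //= u /=; rewrite distrC => /H H'; apply: le_lt_trans H'.
by rewrite distrC -cReB Re_le.
Qed.

Lemma rcont_Im f t : rcont f t -> {for t, continuous (Imc \o f)}.
Proof.
move=> cf; apply/cvgrPdist_lt => e e0; have [d d0 H] := cf _ e0.
exists d => //= u /=; rewrite distrC => /H H'; apply: le_lt_trans H'.
by rewrite distrC -cImB Im_le.
Qed.

Lemma cont_integrable (g : R -> R) a b :
  (forall t, a <= t <= b -> {for t, continuous g}) ->
  mu.-integrable `[a, b] (EFin \o g).
Proof.
move=> cg; apply: continuous_compact_integrable; first exact: segment_compact.
apply: continuous_in_subspaceT => x; rewrite inE /= in_itv /=; exact: cg.
Qed.

Definition rcontI f a b := forall t, a <= t <= b -> rcont f t.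

Lemma int_Re f a b : rcontI f a b -> mu.-integrable `[a, b] (EFin \o (Rec \o f)).
Proof. by move=> cf; apply: cont_integrable => t /cf /rcont_Re. Qed.
Lemma int_Im f a b : rcontI f a b -> mu.-integrable `[a, b] (EFin \o (Imc \o f)).
Proof. by move=> cf; apply: cont_integrable => t /cf /rcont_Im. Qed.

Lemma cintD f g a b : rcontI f a b -> rcontI g a b ->
  cint (fun t => f t + g t) a b = cint f a b + cint g a b.
Proof.
move=> cf cg; rewrite /cint.
under eq_Rintegral do rewrite cReD.
under [X in _ + 'i * rc X]eq_Rintegral do rewrite cImD.
rewrite (RintegralD _ (int_Re cf) (int_Re cg))//.
rewrite (RintegralD _ (int_Im cf) (int_Im cg))//.
by rewrite /= !rcD; ring.
Qed.

Lemma cintZ c f a b : rcontI f a b ->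
  cint (fun t => c * f t) a b = c * cint f a b.
Proof.
move=> cf; rewrite /cint.
under eq_Rintegral do rewrite cReM.
under [X in _ + 'i * rc X]eq_Rintegral do rewrite cImM.
have iR := int_Re cf; have iI := int_Im cf.
have iRZ k : mu.-integrable `[a, b] (EFin \o (fun t => k * Rec (f t))).
  by apply: eq_integrable (integrableZl _ k iR) => //.
have iIZ k : mu.-integrable `[a, b] (EFin \o (fun t => k * Imc (f t))).
  by apply: eq_integrable (integrableZl _ k iI) => //.
rewrite (RintegralB _ (iRZ _) (iIZ _))// (RintegralD _ (iIZ _) (iRZ _))//.
rewrite !(RintegralZl _ _ iR)// !(RintegralZl _ _ iI)//.
rewrite !(rcD, rcB, rcM).
set A := rc (Rintegral _ _ _); set B := rc (Rintegral _ _ _).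
have i2 : ('i : C) * 'i = -1 by rewrite -expr2 sqrCi.
set a' := rc (Rec c); set b' := rc (Imc c).
transitivity ((a' + 'i * b') * (A + 'i * B)); last by rewrite -ReIm.
transitivity (a' * A + 'i * (a' * B + b' * A) + 'i * 'i * (b' * B)); last by ring.
by rewrite i2; ring.
Qed.

(** Real and imaginary part are estimated separately, whence the factor 2. *)
Lemma cint_bound f a b M : a <= b -> rcontI f a b ->
  (forall t, a <= t <= b -> cabs (f t) <= M) ->
  cabs (cint f a b) <= 2 * M * (b - a).
Proof.
move=> ab cf fM.
have H (g : R -> R) : mu.-integrable `[a, b] (EFin \o g) ->
    (forall t, a <= t <= b -> `|g t| <= M) ->
    `|\int[mu]_(t in `[a, b]) g t| <= M * (b - a).
  move=> ig gM; apply: le_trans (le_normr_Rintegral _ ig) _ => //.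
  have <- : \int[mu]_(t in `[a, b]) M = M * (b - a).
    rewrite Rintegral_cst//= lebesgue_measure_itv /= lte_fin.
    by have [//|ba|->] := ltgtP a b; [rewrite ltNge ab in ba|rewrite subrr].
  apply: le_Rintegral => //.
  - by apply: eq_integrable (integrable_norm ig).
  - apply: cont_integrable => t _; exact: cvg_cst.
apply: le_trans (cabsD _ _) _; rewrite cabsM cabs_i mul1r !cabs_rc.
have -> : 2 * M * (b - a) = M * (b - a) + M * (b - a) by ring.
apply: lerD.
  apply: H (int_Re cf) _ => t ht; exact: le_trans (Re_le _) (fM _ ht).
apply: H (int_Im cf) _ => t ht; exact: le_trans (Im_le _) (fM _ ht).
Qed.

Lemma cint_split f a m b : a <= m <= b -> rcontI f a b ->
  cint f a b = cint f a m + cint f m b.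
Proof.
move=> /andP[am mb] cf.
have H (g : R -> R) : mu.-integrable `[a, b] (EFin \o g) ->
  \int[mu]_(t in `[a, b]) g t =
  \int[mu]_(t in `[a, m]) g t + \int[mu]_(t in `[m, b]) g t.
  move=> ig; have := Rintegral_itvB ig; move=> /(_ m).
  rewrite !bnd_simp => /(_ am mb) e.
  apply/eqP; rewrite addrC -subr_eq e; apply/eqP.
  apply: Rintegral_itv_obnd_cbnd.
  apply: integrableS ig => //; apply: subset_itvr; rewrite bnd_simp//.
rewrite /cint (H (Rec \o f) (int_Re cf)) (H (Imc \o f) (int_Im cf)) !rcD.
by rewrite /comp; ring.
Qed.

Lemma eq_cint f g a b : (forall t, a <= t <= b -> f t = g t) ->
  cint f a b = cint g a b.
Proof.
move=> fg; rewrite /cint; congr (rc _ + 'i * rc _);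
by apply: eq_Rintegral => t; rewrite inE /= in_itv /= => /fg ->.
Qed.

(** [p] stands for the real or the imaginary part, so that one argument reduces both to real
    calculus. *)
Lemma rderiv_real (F : R -> C) (p : C -> R) t l :
  (forall z w, p (z - w) = p z - p w) -> (forall z, `|p z| <= cabs z) ->
  (forall z x, p (z * rc x) = p z * x) ->
  rderiv F t l -> is_derive t 1 (p \o F) (p l).
Proof.
move=> pB ple pM dF.
suff H : h^-1 *: ((p \o F) (h *: 1 + t) - (p \o F) t) @[h --> 0^'] --> p l.
  by apply: DeriveDef; [exact: cvgP H | exact: cvg_lim H].
apply/cvgrPdist_le => e e0; have [d d0 H] := dF _ e0.
exists d => //= h /=; rewrite sub0r normrN => hd h0.
have := le_trans (ple _) (H _ hd); rewrite !pB pM => {}H.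
have -> : h *: 1 + t = t + h by rewrite addrC [h *: 1]mulr1.
rewrite distrC -(ler_pM2r (_ : 0 < `|h|)) ?normr_gt0// -normrM.
by rewrite mulrBl -[_ *: _]/(_ * _) mulrAC mulVf// mul1r.
Qed.

Lemma rderiv_cont (F : R -> C) t l : rderiv F t l -> rcont F t.
Proof.
move=> dF e e0; have [d d0 H] := dF 1 ltr01.
have M0 : 0 < cabs l + 1 by rewrite ltr_wpDl ?cabs_ge0.
exists (Num.min d (e / (cabs l + 1))); first by rewrite lt_min d0 divr_gt0.
move=> u; rewrite lt_min => /andP[ud]; rewrite ltr_pdivlMr// => ue.
apply: le_lt_trans ue; have := H _ ud; rewrite (addrC t) subrK mul1r => h.
rewrite -[F u - F t](subrK (l * rc (u - t))).
apply: le_trans (cabsD _ _) _; rewrite cabsM cabs_rc mulrDr mulr1 addrC.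
by rewrite [X in X + _]mulrC lerD2l.
Qed.

Lemma cint_FTC (F f : R -> C) a b : a < b -> rcontI f a b ->
  (forall t, a <= t <= b -> rderiv F t (f t)) -> cint f a b = F b - F a.
Proof.
move=> ab cf dF.
have H (p : C -> R) : (forall z w, p (z - w) = p z - p w) ->
    (forall z, `|p z| <= cabs z) -> (forall z x, p (z * rc x) = p z * x) ->
    (forall t, rcont f t -> {for t, continuous (p \o f)}) ->
    (forall t, rcont F t -> {for t, continuous (p \o F)}) ->
    \int[mu]_(t in `[a, b]) p (f t) = p (F b) - p (F a).
  move=> pB ple pM pf pF.
  have dp t : a <= t <= b -> is_derive t 1 (p \o F) (p (f t)).
    by move=> ht; apply: rderiv_real => //; exact: dF.
  have cpF t : a <= t <= b -> {for t, continuous (p \o F)}.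
    by move=> ht; apply: pF; exact: rderiv_cont (dF _ ht).
  rewrite /Rintegral (@continuous_FTC2 _ (p \o f) (p \o F))//.
  - apply: continuous_in_subspaceT => x; rewrite inE /= in_itv /= => hx.
    exact/pf/cf.
  - split.
    + by move=> t; rewrite in_itv /= => /andP[/ltW ? /ltW ?];
        have [] := dp t; rewrite ?andbT//; apply/andP.
    + by apply: cvg_at_right_filter; apply: (cpF a); rewrite lexx ltW.
    + by apply: cvg_at_left_filter; apply: (cpF b); rewrite lexx ltW.
  - move=> t; rewrite in_itv /= => /andP[/ltW ? /ltW ?].
    by rewrite derive1E; have [] := dp t; first exact/andP.
rewrite /cint (H Rec) ?(H Imc) //.
- by rewrite [F b in RHS]ReIm [F a in RHS]ReIm !rcB; ring.
- exact: cImB.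
- exact: Im_le.
- by move=> z x; rewrite cImM /= mulr0 add0r.
- exact: rcont_Im.
- exact: rcont_Im.
- exact: cReB.
- exact: Re_le.
- by move=> z x; rewrite cReM /= mulr0 subr0.
- exact: rcont_Re.
- exact: rcont_Re.
Qed.

End Integral.

(** * Boundary integrals over rectangles *)

Section Goursat.
Variable R : realType.
Local Notation C := (Cplx R).
Implicit Types (f g F : C -> C) (z w l : C).

Definition ccont f z := forall e : R, 0 < e -> exists2 d : R, 0 < d &
  forall w, cabs (w - z) < d -> cabs (f w - f z) < e.

Definition cderiv f z l := forall e : R, 0 < e -> exists2 d : R, 0 < d &
  forall h, cabs h < d -> cabs (f (z + h) - f z - l * h) <= e * cabs h.

Lemma cderiv_cont f z l : cderiv f z l -> ccont f z.
Proof.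
move=> df e e0; have [d d0 H] := df 1 ltr01.
have M0 : 0 < cabs l + 1 by rewrite ltr_wpDl ?cabs_ge0.
exists (Num.min d (e / (cabs l + 1))); first by rewrite lt_min d0 divr_gt0.
move=> u; rewrite lt_min => /andP[ud]; rewrite ltr_pdivlMr// => ue.
apply: le_lt_trans ue; have := H _ ud; rewrite (addrC z) subrK mul1r => h.
rewrite -[f u - f z](subrK (l * (u - z))).
by apply: le_trans (cabsD _ _) _; rewrite cabsM; lra.
Qed.

Definition pt (x y : R) : C := rc x + 'i * rc y.

Definition hint f y a b := cint (fun t => f (pt t y)) a b.
Definition vint f x a b := cint (fun t => 'i * f (pt x t)) a b.

(** The boundary is traversed counterclockwise; the factor i of dz on vertical sides is part of
    [vint]. *)
Definition bint f a b c d :=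
  hint f c a b + vint f b c d - hint f d a b - vint f a c d.

Definition rect a b c d z := exists x y : R,
  [/\ a <= x <= b, c <= y <= d & z = pt x y].

Definition bdry a b c d z := exists x y : R, [/\ a <= x <= b, c <= y <= d,
  (x == a) || (x == b) || (y == c) || (y == d) & z = pt x y].

Definition contB f a b c d := forall z, bdry a b c d z -> ccont f z.

Definition contR f a b c d := forall z, rect a b c d z -> ccont f z.

Lemma rectP (a b c d x y : R) : a <= x <= b -> c <= y <= d -> rect a b c d (pt x y).
Proof. by move=> hx hy; exists x, y. Qed.

Lemma hcont f y a b : (forall x, a <= x <= b -> ccont f (pt x y)) ->
  rcontI (fun t => f (pt t y)) a b.
Proof.
move=> cf t /cf cft e /cft[d d0 H]; exists d => // u ud; apply: H.
have -> : pt u y - pt t y = rc (u - t) by rewrite /pt rcB; ring.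
by rewrite cabs_rc.
Qed.

Lemma vcont f x a b : (forall y, a <= y <= b -> ccont f (pt x y)) ->
  rcontI (fun t => 'i * f (pt x t)) a b.
Proof.
move=> cf t /cf cft e /cft[d d0 H]; exists d => // u ud.
rewrite -mulrBr cabsM cabs_i mul1r; apply: H.
have -> : pt x u - pt x t = 'i * rc (u - t) by rewrite /pt rcB; ring.
by rewrite cabsM cabs_i mul1r cabs_rc.
Qed.

Section Rect.
Variables (a b c d : R).
Hypotheses (ab : a <= b) (cd : c <= d).

Let aI : a <= a <= b. Proof. by rewrite lexx. Qed.
Let bI : a <= b <= b. Proof. by rewrite lexx andbT. Qed.
Let cI : c <= c <= d. Proof. by rewrite lexx. Qed.
Let dI : c <= d <= d. Proof. by rewrite lexx andbT. Qed.

Lemma hcontR f y : contR f a b c d -> c <= y <= d ->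
  rcontI (fun t => f (pt t y)) a b.
Proof. by move=> cf hy; apply: hcont => x hx; apply/cf/rectP. Qed.

Lemma vcontR f x : contR f a b c d -> a <= x <= b ->
  rcontI (fun t => 'i * f (pt x t)) c d.
Proof. by move=> cf hx; apply: vcont => y hy; apply/cf/rectP. Qed.

Lemma bdry_rect z : bdry a b c d z -> rect a b c d z.
Proof. by move=> [x [y [hx hy _ ->]]]; exact: rectP. Qed.

Lemma contR_B f : contR f a b c d -> contB f a b c d.
Proof. by move=> cf z /bdry_rect; exact: cf. Qed.

Lemma bdryh x y : a <= x <= b -> (y == c) || (y == d) -> bdry a b c d (pt x y).
Proof.
move=> hx hy; exists x, y; split => //; last by case/orP: hy => ->; rewrite !orbT.
by case/orP: hy => /eqP ->.
Qed.

Lemma bdryv x y : (x == a) || (x == b) -> c <= y <= d -> bdry a b c d (pt x y).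
Proof.
move=> hx hy; exists x, y; split => //; last by case/orP: hx => ->; rewrite ?orbT.
by case/orP: hx => /eqP ->.
Qed.

Lemma hcontB f y : contB f a b c d -> (y == c) || (y == d) ->
  rcontI (fun t => f (pt t y)) a b.
Proof. by move=> cf hy; apply: hcont => x hx; apply/cf/bdryh. Qed.

Lemma vcontB f x : contB f a b c d -> (x == a) || (x == b) ->
  rcontI (fun t => 'i * f (pt x t)) c d.
Proof. by move=> cf hx; apply: vcont => y hy; apply/cf/bdryv. Qed.

Lemma bintD f g : contB f a b c d -> contB g a b c d ->
  bint (fun z => f z + g z) a b c d = bint f a b c d + bint g a b c d.
Proof.
move=> cf cg.
have hD y : (y == c) || (y == d) ->
    hint (fun z => f z + g z) y a b = hint f y a b + hint g y a b.
  by move=> hy; apply: cintD; exact: hcontB.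
have vD x : (x == a) || (x == b) ->
    vint (fun z => f z + g z) x c d = vint f x c d + vint g x c d.
  move=> hx; rewrite -cintD; try exact: vcontB.
  by apply: eq_cint => t _; rewrite mulrDr.
by rewrite /bint !hD ?eqxx ?orbT// !vD ?eqxx ?orbT//; ring.
Qed.

Lemma bintZ k f : contB f a b c d ->
  bint (fun z => k * f z) a b c d = k * bint f a b c d.
Proof.
move=> cf.
have hD y : (y == c) || (y == d) ->
    hint (fun z => k * f z) y a b = k * hint f y a b.
  by move=> hy; apply: cintZ; exact: hcontB.
have vD x : (x == a) || (x == b) ->
    vint (fun z => k * f z) x c d = k * vint f x c d.
  move=> hx; rewrite -cintZ; last exact: vcontB.
  by apply: eq_cint => t _; rewrite mulrCA.
by rewrite /bint !hD ?eqxx ?orbT// !vD ?eqxx ?orbT//; ring.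
Qed.

Lemma eq_bint f g : (forall z, bdry a b c d z -> f z = g z) ->
  bint f a b c d = bint g a b c d.
Proof.
move=> fg.
have hE y : (y == c) || (y == d) -> hint f y a b = hint g y a b.
  by move=> hy; apply: eq_cint => t ht; apply/fg/bdryh.
have vE x : (x == a) || (x == b) -> vint f x c d = vint g x c d.
  by move=> hx; apply: eq_cint => t ht; rewrite fg//; exact: bdryv.
by rewrite /bint !hE ?eqxx ?orbT// !vE ?eqxx ?orbT.
Qed.

Lemma bint_bound f M : contB f a b c d ->
  (forall z, bdry a b c d z -> cabs (f z) <= M) ->
  cabs (bint f a b c d) <= 4 * M * ((b - a) + (d - c)).
Proof.
move=> cf fM.
have hM y : (y == c) || (y == d) -> cabs (hint f y a b) <= 2 * M * (b - a).
  move=> hy; apply: cint_bound => //; first exact: hcontB.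
  by move=> t ht; apply/fM/bdryh.
have vM x : (x == a) || (x == b) -> cabs (vint f x c d) <= 2 * M * (d - c).
  move=> hx; apply: cint_bound => //; first exact: vcontB.
  by move=> t ht; rewrite cabsM cabs_i mul1r; apply/fM/bdryv.
have e1 : (c == c) || (c == d) by rewrite eqxx.
have e2 : (d == c) || (d == d) by rewrite eqxx orbT.
have e3 : (a == a) || (a == b) by rewrite eqxx.
have e4 : (b == a) || (b == b) by rewrite eqxx orbT.
rewrite /bint; apply: le_trans (cabs_triB _ _) _.
have := hM _ e1; have := hM _ e2; have := vM _ e3; have := vM _ e4.
have := cabs_triB (hint f c a b + vint f b c d) (hint f d a b).
have := cabsD (hint f c a b) (vint f b c d).
by lra.
Qed.

Lemma bint_splitx f m : a <= m <= b -> contR f a b c d ->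
  bint f a b c d = bint f a m c d + bint f m b c d.
Proof.
move=> mI cf; rewrite /bint /hint !(cint_split mI); try exact: hcontR.
by rewrite -/(hint f c a m); ring.
Qed.

Lemma bint_splity f m : c <= m <= d -> contR f a b c d ->
  bint f a b c d = bint f a b c m + bint f a b m d.
Proof.
move=> mI cf; rewrite /bint /vint !(cint_split mI); try exact: vcontR.
by ring.
Qed.

End Rect.

(** Each side contributes the difference of the primitive at its two corners, and the four
    differences cancel. *)
Lemma bint_FTC a b c d F f : a < b -> c < d -> contB f a b c d ->
  (forall z, bdry a b c d z -> cderiv F z (f z)) -> bint f a b c d = 0.
Proof.
move=> ab cd cf dF; have ab' := ltW ab; have cd' := ltW cd.
have hE y : (y == c) || (y == d) -> hint f y a b = F (pt b y) - F (pt a y).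
  move=> hy; apply: (cint_FTC (F := fun t => F (pt t y))) => //.
    exact: (hcontB cd' cf).
  move=> t ht e e0; have [r r0 H] := dF _ (bdryh cd' ht hy) _ e0.
  exists r => // h hr; have := H (rc h); rewrite cabs_rc => /(_ hr).
  by rewrite (_ : pt (t + h) y = pt t y + rc h)// /pt rcD; ring.
have vE x : (x == a) || (x == b) -> vint f x c d = F (pt x d) - F (pt x c).
  move=> hx; apply: (cint_FTC (F := fun t => F (pt x t))) => //.
    exact: (vcontB ab' cf).
  move=> t ht e e0; have [r r0 H] := dF _ (bdryv ab' hx ht) _ e0.
  exists r => // h hr; have := H ('i * rc h); rewrite cabsM cabs_i mul1r cabs_rc => /(_ hr).
  rewrite (_ : pt x (t + h) = pt x t + 'i * rc h); first by rewrite mulrA [f _ * _]mulrC.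
  by rewrite /pt rcD; ring.
by rewrite /bint !hE ?eqxx ?orbT// !vE ?eqxx ?orbT//; ring.
Qed.

(** The function differentiated is a primitive of k + l (w - p), which can thereby be removed from
    boundary integrals. *)
Lemma affine_cderiv (k l p z : C) :
  cderiv (fun w => k * w + l * ((w - p) * (w - p) / 2)) z (k + l * (z - p)).
Proof.
move=> e e0; have M0 : 0 < cabs l + 1 by rewrite ltr_wpDl ?cabs_ge0.
exists (e / (cabs l + 1)); first by rewrite divr_gt0.
move=> h; rewrite ltr_pdivlMr// => he.
rewrite (_ : _ - _ - _ = l / 2 * h * h); last by field.
rewrite !cabsM cabsV cabs_nat ler_wpM2r ?cabs_ge0//.
have := cabs_ge0 l; have := cabs_ge0 h; move: (cabs h) (cabs l) he => x y; nra.
Qed.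

Lemma affine_cont (k l p z : C) : ccont (fun w => k + l * (w - p)) z.
Proof.
apply: (@cderiv_cont _ _ l) => e e0; exists 1 => // h _.
rewrite (_ : _ - _ - _ = 0); last by ring.
by rewrite cabs0 mulr_ge0 ?cabs_ge0// ltW.
Qed.

Lemma ccontB f g z : ccont f z -> ccont g z -> ccont (fun w => f w - g w) z.
Proof.
move=> cf cg e e0; have e2 : 0 < e / 2 by rewrite divr_gt0.
have [d d0 H] := cf _ e2; have [d' d'0 H'] := cg _ e2.
exists (Num.min d d'); first by rewrite lt_min d0.
move=> w; rewrite lt_min => /andP[/H h /H' h'].
rewrite (_ : _ - _ - _ = (f w - f z) - (g w - g z)); last by ring.
by apply: le_lt_trans (cabs_triB _ _) _; lra.
Qed.

(** Subtracting the affine approximation at z does not change the boundary integral, since it has a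
    primitive. What remains is at most e |w - z| <= 2 e s on the boundary, and [bint_bound] with
    half perimeter at most 2 s gives 4 * 2 e s * 2 s = 16 e s^2. *)
Lemma goursat_local f z l (e : R) : 0 < e -> cderiv f z l -> exists2 r : R, 0 < r &
  forall a b c d s, a < b -> c < d -> rect a b c d z -> contR f a b c d ->
    b - a <= s -> d - c <= s -> 2 * s < r ->
    cabs (bint f a b c d) <= 16 * e * s ^+ 2.
Proof.
move=> e0 df; have [r r0 H] := df _ e0; exists r => // a b c d s ab cd.
move=> [x0 [y0 [/andP[? ?] /andP[? ?] zE]]] cf bas dcs sr.
pose g w := f z + l * (w - z).
have cg : contB g a b c d by move=> w _; exact: affine_cont.
have cfB := contR_B cf.
have cfg : contB (fun w => f w - g w) a b c d.
  by move=> w hw; apply: ccontB; [exact: cfB|exact: cg].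
have g0 : bint g a b c d = 0.
  by apply: (bint_FTC (F := fun w => f z * w + l * ((w - z) * (w - z) / 2))) => //;
    move=> w _; exact: affine_cderiv.
have -> : bint f a b c d = bint (fun w => f w - g w) a b c d.
  rewrite -[RHS]addr0 -g0 -(bintD (ltW ab) (ltW cd))//.
  by apply: eq_bint => [||w _]; rewrite ?ltW// subrK.
have s0 : 0 <= s by lra.
apply: le_trans (bint_bound (M := e * (2 * s)) (ltW ab) (ltW cd) cfg _) _.
  move=> w [x [y [/andP[? ?] /andP[? ?] _ wE]]].
  have dist : cabs (w - z) <= 2 * s.
    rewrite (_ : w - z = rc (x - x0) + 'i * rc (y - y0)); last first.
      by rewrite wE zE /pt !rcB; ring.
    apply: le_trans (cabsD _ _) _; rewrite cabsM cabs_i mul1r !cabs_rc.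
    have : `|x - x0| <= s by rewrite ler_norml; apply/andP; split; lra.
    have : `|y - y0| <= s by rewrite ler_norml; apply/andP; split; lra.
    by lra.
  have := H (w - z) (le_lt_trans dist sr); rewrite [z + _]addrC subrK /g opprD addrA.
  by move=> /le_trans; apply; rewrite ler_pM2l.
have h2 : (b - a) + (d - c) <= 2 * s by lra.
have h3 : 0 <= 8 * (e * s) by rewrite !mulr_ge0// ltW.
have := ler_wpM2l h3 h2; rewrite (_ : 8 * (e * s) * (2 * s) = 16 * e * s ^+ 2); last by ring.
by move=> h; apply: le_trans h; rewrite le_eqVlt; apply/orP; left; apply/eqP; ring.
Qed.

Definition holR f a b c d := forall z, rect a b c d z -> exists l, cderiv f z l.

Lemma holR_cont f a b c d : holR f a b c d -> contR f a b c d.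
Proof. by move=> hf z /hf[l]; exact: cderiv_cont. Qed.

Lemma subrect a b c d a' b' c' d' z : a <= a' -> b' <= b -> c <= c' -> d' <= d ->
  rect a' b' c' d' z -> rect a b c d z.
Proof.
move=> aa bb cc dd [x [y [/andP[? ?] /andP[? ?] ->]]].
by apply: rectP; apply/andP; split; lra.
Qed.

End Goursat.

(** * Goursat's theorem by bisection *)

Section Bisection.
Variable R : realType.
Local Notation C := (Cplx R).
Implicit Types (f g F : C -> C) (z w l : C).

(** The intervals from x k to x k + u / 2^k are nested, and the supremum of the left ends lies in
    all of them. *)
Lemma nested_halving (x : nat -> R) (u : R) : 0 <= u ->
  (forall k, x k <= x k.+1 <= x k + u / 2 ^+ k.+1) ->
  exists y, forall k, x k <= y <= x k + u / 2 ^+ k.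
Proof.
move=> u0 H.
have up k m : x k <= x (k + m)%N /\ x (k + m)%N + u / 2 ^+ (k + m) <= x k + u / 2 ^+ k.
  elim: m => [|m [IH1 IH2]]; first by rewrite addn0 !lexx.
  rewrite addnS; have /andP[h1 h2] := H (k + m)%N; split; first exact: le_trans h1.
  apply: le_trans IH2; apply: le_trans (lerD h2 (lexx _)) _.
  rewrite exprS invfM -addrA lerD2l.
  have := mulr_ge0 u0 (ltW (exprn_gt0 (k + m) (_ : 0 < (2:R)^-1))).
  by rewrite exprVn => /(_ _); lra.
have mono k m : x k <= x m + u / 2 ^+ m.
  have [km|mk] := leqP k m.
    have [h _] := up k (m - k)%N; rewrite subnKC// in h; apply: le_trans h _.
    by rewrite lerDl divr_ge0// exprn_ge0.
  have [_ h] := up m (k - m)%N; rewrite subnKC 1?ltnW// in h; apply: le_trans h.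
  by rewrite lerDl divr_ge0// exprn_ge0.
have ub : has_ubound (range x) by exists (x 0 + u / 2 ^+ 0) => _ [k _ <-].
exists (sup (range x)) => k; apply/andP; split.
  by apply: ub_le_sup => //; exists k.
by apply: ge_sup; [exists (x 0), 0%N|move=> _ [m _ <-]].
Qed.

Lemma bint_quarter f (a c u v : R) : 0 < u -> 0 < v ->
  contR f a (a + (u + u)) c (c + (v + v)) ->
  bint f a (a + (u + u)) c (c + (v + v)) =
  bint f a (a + u) c (c + v) + bint f (a + u) (a + (u + u)) c (c + v) +
  (bint f a (a + u) (c + v) (c + (v + v)) +
   bint f (a + u) (a + (u + u)) (c + v) (c + (v + v))).
Proof.
move=> u0 v0 cf.
have a1 : a <= a + u <= a + (u + u) by apply/andP; split; lra.
have c1 : c <= c + v <= c + (v + v) by apply/andP; split; lra.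
have sub c' d' : c <= c' -> d' <= c + (v + v) -> contR f a (a + (u + u)) c' d'.
  by move=> h1 h2 z hz; apply: cf; apply: subrect hz.
have [c2 c3] := andP c1; have [a2 a3] := andP a1.
rewrite (bint_splity (le_trans a2 a3) c1 cf).
rewrite (bint_splitx c2 a1 (sub _ _ (lexx _) c3)).
by rewrite (bint_splitx c3 a1 (sub _ _ c2 (lexx _))).
Qed.

Lemma goursat f a b c d : a < b -> c < d -> holR f a b c d -> bint f a b c d = 0.
Proof.
move=> ab cd hf; have cf := holR_cont hf; apply: cabs_small => e e0.
rewrite leNgt; apply/negP => big.
pose u := b - a; pose v := d - c.
have u0 : 0 < u by rewrite subr_gt0.
have v0 : 0 < v by rewrite subr_gt0.
have halving (w : R) : 0 < w -> exists W : nat -> R,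
    [/\ W 0%N = w, forall k, 0 < W k, forall k, W k = W k.+1 + W k.+1 &
        forall k, W k = w / 2 ^+ k].
  move=> w0; exists (fun k => w / 2 ^+ k); split=> //.
  - by rewrite expr0 divr1.
  - by move=> k; rewrite divr_gt0// exprn_gt0.
  - by move=> k; rewrite exprS; field; rewrite gt_eqF// exprn_gt0.
have [U [U0 Up US UE]] := halving _ u0; have [V [V0 Vp VS VE]] := halving _ v0.
pose inside k (p : R * R) := [/\ a <= p.1, p.1 + U k <= b,
  c <= p.2 & p.2 + V k <= d].
pose mu k (p : R * R) := bint f p.1 (p.1 + U k) p.2 (p.2 + V k).
pose bad k (p : R * R) := inside k p /\ e / 4 ^+ k < cabs (mu k p).
(* The hypothesis [bad k p] is kept under the existential, so that choice yields a total function
   [nxt]. *)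
have step k p : exists p' : R * R, bad k p -> bad k.+1 p' /\
   (p.1 <= p'.1 <= p.1 + U k.+1 /\ p.2 <= p'.2 <= p.2 + V k.+1).
  have [bp|] := pselect (bad k p); last by exists p.
  suff [p' hp'] : exists p', bad k.+1 p' /\
   (p.1 <= p'.1 <= p.1 + U k.+1 /\ p.2 <= p'.2 <= p.2 + V k.+1).
    by exists p'.
  case: bp => -[i1 i2 i3 i4] bp.
  have := Up k.+1; have := Vp k.+1; rewrite US in i2; rewrite VS in i4.
  set u' := U k.+1 in i2 *; set v' := V k.+1 in i4 * => v'0 u'0.
  have E : mu k p = mu k.+1 p + mu k.+1 (p.1 + u', p.2) +
     (mu k.+1 (p.1, p.2 + v') + mu k.+1 (p.1 + u', p.2 + v')).
    have cf' : contR f p.1 (p.1 + (u' + u')) p.2 (p.2 + (v' + v')).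
      by move=> z hz; apply: cf; apply: subrect hz.
    have Q := bint_quarter u'0 v'0 cf'.
    by rewrite /mu US VS Q [in RHS]/= -/u' -/v' -!(addrA p.1) -!(addrA p.2).
  (* If the integrals over all four quarters were at most e / 4^(k+1), their sum would be at most e
     / 4^k. *)
  have [p' [p'E big']] : exists p' : R * R, p' \in [:: p; (p.1 + u', p.2);
      (p.1, p.2 + v'); (p.1 + u', p.2 + v')] /\ e / 4 ^+ k.+1 < cabs (mu k.+1 p').
    apply: contrapT => /forallNP H; have {}H p' : p' \in [:: p; (p.1 + u', p.2);
      (p.1, p.2 + v'); (p.1 + u', p.2 + v')] -> cabs (mu k.+1 p') <= e / 4 ^+ k.+1.
      by move=> p'E; rewrite leNgt; apply/negP => big'; apply: (H p').
    have h1 := H p; have h2 := H (p.1 + u', p.2); have h3 := H (p.1, p.2 + v').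
    have h4 := H (p.1 + u', p.2 + v').
    rewrite !inE !eqxx ?orbT in h1 h2 h3 h4.
    have := bp; rewrite ltNge => /negP; apply; rewrite E.
    apply: le_trans (cabsD _ _) _.
    have k1 := cabsD (mu k.+1 p) (mu k.+1 (p.1 + u', p.2)).
    have k2 := cabsD (mu k.+1 (p.1, p.2 + v')) (mu k.+1 (p.1 + u', p.2 + v')).
    have -> : e / 4 ^+ k = 4 * (e / 4 ^+ k.+1).
      by rewrite exprS; field; rewrite gt_eqF// exprn_gt0.
    apply: le_trans (lerD k1 k2) _.
    apply: le_trans (lerD (lerD (h1 isT) (h2 isT)) (lerD (h3 isT) (h4 isT))) _.
    by rewrite le_eqVlt; apply/orP; left; apply/eqP; ring.
  exists p'; move: p'E big'; rewrite !inE => /or4P[] /eqP -> /= big';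
    (split; first by split => //; split; rewrite /= -/u' -/v'; clear -i1 i2 i3 i4 u'0 v'0; lra);
    split; apply/andP; split; clear -i1 i2 i3 i4 u'0 v'0; lra.
have /choice[nxt nxtP] : forall q : nat * (R * R), exists p' : R * R,
   bad q.1 q.2 -> bad q.1.+1 p' /\
   (q.2.1 <= p'.1 <= q.2.1 + U q.1.+1 /\ q.2.2 <= p'.2 <= q.2.2 + V q.1.+1).
  by move=> [k p]; exact: step.
pose sq := fix sq k : R * R := if k is j.+1 then nxt (j, sq j) else (a, c).
have sqb k : bad k (sq k).
  elim: k => [|k IH]; last by have [] := nxtP (k, sq k) IH.
  split; first by rewrite /inside /= U0 V0 /u /v; split; lra.
  by rewrite /mu /= expr0 divr1 U0 V0 /u /v !subrKC.
have [x xP] : exists y, forall k, (sq k).1 <= y <= (sq k).1 + U k.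
  have [k|x xP] := @nested_halving (fun k => (sq k).1) u (ltW u0).
    by have [_ []] := nxtP (k, sq k) (sqb k); rewrite UE.
  by exists x => k; rewrite UE.
have [y yP] : exists y, forall k, (sq k).2 <= y <= (sq k).2 + V k.
  have [k|y yP] := @nested_halving (fun k => (sq k).2) v (ltW v0).
    by have [_ []] := nxtP (k, sq k) (sqb k); rewrite VE.
  by exists y => k; rewrite VE.
have xyR : rect a b c d (pt x y).
  apply: rectP; first by have := xP 0%N; rewrite /= U0 /u subrKC.
  by have := yP 0%N; rewrite /= V0 /v subrKC.
have [l dl] := hf _ xyR.
(* At scale k both sides are at most s / 2^k. The accuracy e / (16 s^2) turns the local bound at
   that scale into exactly e / 4^k, which contradicts [bad]. *)
pose s := u + v; have s0 : 0 < s by rewrite addr_gt0.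
have e'0 : 0 < e / (16 * s ^+ 2) by rewrite divr_gt0// mulr_gt0// exprn_gt0.
have [r r0 H] := goursat_local e'0 dl.
have [k kr] : exists k, 2 * s / 2 ^+ k < r.
  pose m := (Num.truncn (2 * s / r)).+1.
  have hm : 2 * s / r < m%:R by exact: truncnS_gt.
  have hm2 : m%:R < 2 ^+ m :> R by rewrite -natrX ltr_nat ltn_expl.
  exists m; rewrite ltr_pdivrMr ?exprn_gt0// [r * _]mulrC -ltr_pdivrMr//.
  exact: lt_trans hm hm2.
have [[i1 i2 i3 i4] bk] := sqb k.
have sk : s / 2 ^+ k = U k + V k by rewrite UE VE mulrDl.
have uk := Up k; have vk := Vp k.
have : cabs (mu k (sq k)) <= 16 * (e / (16 * s ^+ 2)) * (s / 2 ^+ k) ^+ 2.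
  apply: H; rewrite ?ltrDl//.
  - exact: rectP.
  - by move=> z hz; apply: cf; apply: subrect hz.
  - by rewrite sk addrAC subrr add0r lerDl ltW.
  - by rewrite sk addrAC subrr add0r lerDr ltW.
  - by rewrite mulrA.
apply/negP; rewrite -ltNge; apply: le_lt_trans bk.
rewrite expr_div_n -exprM mulnC exprM (_ : 2 ^+ 2 = 4); last by ring.
rewrite le_eqVlt; apply/orP; left; apply/eqP; field.
by rewrite !gt_eqF// exprn_gt0.
Qed.

End Bisection.

(** * Rules of complex differentiation and removable points *)

Section CauchyTaylor.
Variable R : realType.
Local Notation C := (Cplx R).
Implicit Types (f g F : C -> C) (z w l : C).

Lemma rc_gt0P (e : C) : 0 < e -> exists2 x : R, 0 < x & e = rc x.
Proof.
move=> e0; exists (cabs e); first by rewrite cabs_gt0 gt_eqF.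
by rewrite -normE gtr0_norm.
Qed.

Lemma rc_gt0 (x : R) : (0 < rc x) = (0 < x).
Proof. by rewrite -rc0 rc_ltr. Qed.

Lemma slopeK (x h : C) : h != 0 -> (h^-1 *: x) * h = x.
Proof. by move=> h0; rewrite -[_ *: _]/(_ * _) mulrAC mulVf// mul1r. Qed.

Lemma is_derive_cderiv f z l : is_derive (z : C) (1 : C) (f : C -> C) l -> cderiv f z l.
Proof.
move=> [dfz dfl] e e0.
have : h^-1 *: ((f \o shift z) (h *: (1 : C)) - f z) @[h --> 0^'] --> l.
  by rewrite -dfl; exact: dfz.
move=> /cvgrPdist_le /(_ (rc e)); rewrite rc_gt0 => /(_ e0) [d /= d0 H].
have [x x0 dE] := rc_gt0P d0; exists x => // h hx.
have [->|h0] := eqVneq h 0; first by rewrite addr0 subrr mulr0 subrr !cabs0 mulr0.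
have := H h; rewrite /= sub0r normrN dE !normE rc_ltr => /(_ hx h0).
rewrite rc_ler -(ler_pM2r (_ : 0 < cabs h)) ?cabs_gt0// -cabsM => {}H.
rewrite cabsB; apply: le_trans H; rewrite le_eqVlt; apply/orP; left; apply/eqP.
by rewrite mulrBl slopeK// [h *: 1]mulr1 [h + z]addrC.
Qed.

Lemma cderiv_is_derive f z l : cderiv f z l -> is_derive (z : C) (1 : C) (f : C -> C) l.
Proof.
move=> df.
suff H : h^-1 *: ((f \o shift z) (h *: (1 : C)) - f z) @[h --> 0^'] --> l.
  by apply: DeriveDef; [exact: cvgP H | exact: cvg_lim H].
apply/cvgrPdist_le => e' /rc_gt0P[e e0 ->]; have [d d0 H] := df _ e0.
exists (rc d); first by rewrite /= rc_gt0.
move=> h /=; rewrite sub0r normrN normE rc_ltr => hd h0.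
have {}H := H _ hd; rewrite normE rc_ler cabsB.
rewrite -(ler_pM2r (_ : 0 < cabs h)) ?cabs_gt0// -cabsM.
apply: le_trans H; rewrite le_eqVlt; apply/orP; left; apply/eqP.
by rewrite mulrBl slopeK// [h *: 1]mulr1 [h + z]addrC.
Qed.

Lemma derivable_cderiv f z : derivable (f : C -> C) (z : C) (1 : C) -> exists l, cderiv f z l.
Proof. by move=> /derivableP df; exists ('D_1 (f : C -> C) (z : C)); exact: is_derive_cderiv. Qed.

Lemma cderiv_derivable f z l : cderiv f z l -> derivable (f : C -> C) (z : C) (1 : C).
Proof. by move=> /cderiv_is_derive []. Qed.

Lemma cderiv_near f g z l r : 0 < r ->
  (forall w, cabs (w - z) < r -> f w = g w) -> cderiv f z l -> cderiv g z l.
Proof.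
move=> r0 fg df e e0; have [d d0 H] := df _ e0.
exists (Num.min d r); first by rewrite lt_min d0.
move=> h; rewrite lt_min => /andP[hd hr]; rewrite -!fg ?subrr ?cabs0//; first exact: H.
by rewrite addrC addrA addNr add0r.
Qed.

Lemma cderivZ k f z l : cderiv f z l -> cderiv (fun w => k * f w) z (k * l).
Proof. by move=> /cderiv_is_derive df; apply: is_derive_cderiv; apply: is_deriveZ. Qed.

Lemma cderivM f g z k l : cderiv f z k -> cderiv g z l ->
  cderiv (fun w => f w * g w) z (f z * l + g z * k).
Proof.
move=> /cderiv_is_derive df /cderiv_is_derive dg; apply: is_derive_cderiv.
Qed.

Lemma cderivD f g z k l : cderiv f z k -> cderiv g z l ->
  cderiv (fun w => f w + g w) z (k + l).
Proof.
move=> /cderiv_is_derive df /cderiv_is_derive dg; apply: is_derive_cderiv.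
Qed.

Lemma cderiv_cst k z : cderiv (fun=> k) z 0.
Proof. by move=> e e0; exists 1 => // h _; rewrite subrr mul0r subrr cabs0 mulr_ge0 ?cabs_ge0 ?ltW. Qed.

Lemma cderiv_id z : cderiv id z 1.
Proof.
move=> e e0; exists 1 => // h _; rewrite /= mul1r (_ : _ - _ = 0); last by ring.
by rewrite cabs0 mulr_ge0 ?cabs_ge0 ?ltW.
Qed.

Lemma cderiv_inv z : z != 0 -> cderiv (fun w => w^-1) z (- z ^- 2).
Proof.
move=> z0 e e0; have az : 0 < cabs z by rewrite cabs_gt0.
have h3 : 0 < e * cabs z ^+ 3 / 2 by rewrite divr_gt0// mulr_gt0// exprn_gt0.
(* The first bound keeps |z + h| >= |z| / 2; with it, the second makes |h| / (|z|^2 |z + h|) at most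
   e. *)
exists (Num.min (cabs z / 2) (e * cabs z ^+ 3 / 2)).
  by rewrite lt_min h3 divr_gt0.
move=> h; rewrite lt_min => /andP[h1 h2].
have zh : cabs z / 2 <= cabs (z + h).
  by have := cabs_dist z (- h); rewrite opprK cabsN; lra.
have zh0 : z + h != 0 by rewrite -cabs_gt0; apply: lt_le_trans zh; rewrite divr_gt0.
rewrite (_ : _ - _ = h * (h / (z ^+ 2 * (z + h)))); last by field; rewrite z0 zh0.
rewrite cabsM mulrC ler_wpM2r ?cabs_ge0// cabsM cabsV cabsM cabsX.
rewrite ler_pdivrMr ?mulr_gt0 ?exprn_gt0// ?cabs_gt0//.
apply: le_trans (ltW h2) _.
have -> : e * cabs z ^+ 3 / 2 = e * (cabs z ^+ 2 * (cabs z / 2)) by ring.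
by rewrite !ler_pM2l// exprn_gt0.
Qed.

Lemma cderiv_invX z k : z != 0 -> cderiv (fun w => w^-1 ^+ k) z (- k%:R * z^-1 ^+ k.+1).
Proof.
move=> z0; elim: k => [|k IH].
  rewrite oppr0 mul0r; have := cderiv_cst 1 z.
  by congr cderiv; apply/funext => w; rewrite expr0.
have := cderivM (cderiv_inv z0) IH.
have -> : (fun w : C => w^-1 ^+ k.+1) = (fun w => w^-1 * w^-1 ^+ k).
  by apply/funext => w; rewrite exprS.
suff -> : - k.+1%:R * z^-1 ^+ k.+2 = z^-1 * (- k%:R * z^-1 ^+ k.+1) + z^-1 ^+ k * - z ^- 2 by [].
by rewrite -exprVn -natr1 !exprS; set u := z^-1; ring.
Qed.

Lemma cderiv_comp_shift f z l p : cderiv f (z - p) l -> cderiv (fun w => f (w - p)) z l.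
Proof.
move=> df e e0; have [d d0 H] := df _ e0; exists d => // h /H.
by rewrite (_ : z + h - p = z - p + h)// addrAC.
Qed.

Lemma pt_ReIm z : z = pt (complex.Re z) (complex.Im z).
Proof. exact: ReIm. Qed.

Lemma pt_inj (x y x' y' : R) : pt x y = pt x' y' -> x = x' /\ y = y'.
Proof.
have E (a b : R) : pt a b = (Complex a b : C).
  rewrite /pt /rc -complexiE; apply/eqP; rewrite eq_complex /=.
  by rewrite ?(mul0r, mul1r, mulr0, subr0, addr0, add0r, sub0r, oppr0) !eqxx.
by rewrite !E => -[].
Qed.

Lemma rect_pt (a b c d x y : R) : rect a b c d (pt x y) -> a <= x <= b /\ c <= y <= d.
Proof. by move=> [x' [y' [hx hy /pt_inj[-> ->]]]]. Qed.

Lemma cabs_pt (x y : R) : cabs (pt x y) <= `|x| + `|y|.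
Proof. by apply: le_trans (cabsD _ _) _; rewrite cabsM cabs_i mul1r !cabs_rc. Qed.

(* The point p is isolated in a small square, whose boundary integral tends to
   0 because h is only required to be bounded there. *)
Lemma bint_removable h (p : C) (a b c d : R) :
  a < complex.Re p -> complex.Re p < b -> c < complex.Im p -> complex.Im p < d ->
  contR h a b c d ->
  (forall z, rect a b c d z -> z != p -> exists l, cderiv h z l) ->
  bint h a b c d = 0.
Proof.
set x := complex.Re p; set y := complex.Im p => ax xb cy yd ch dh.
have pE : p = pt x y by exact: pt_ReIm.
have [r r0 Hr] : exists2 r : R, 0 < r & forall w, cabs (w - p) < r -> cabs (h w) <= cabs (h p) + 1.
  have hp : rect a b c d p by rewrite pE; apply: rectP; rewrite !ltW.
  have [r r0 H] := ch _ hp _ ltr01; exists r => // w /H hw.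
  by have := cabs_dist (h w) (h p); lra.
apply: cabs_small => e e0; pose M := cabs (h p) + 1.
have M0 : 0 < M by rewrite ltr_wpDl ?cabs_ge0.
(* The square of half side s about p lies in the rectangle and in the disc where h is bounded by M,
   and its boundary integral is at most 4 M * 4 s = 16 M s < e. *)
have [s [s0 sE]] : exists s : R, 0 < s /\
    [/\ s < x - a, s < b - x, s < y - c, s < d - y & 2 * s < r /\ 16 * M * s < e].
  pose m := Num.min (Num.min (Num.min (x - a) (b - x)) (Num.min (y - c) (d - y)))
    (Num.min (r / 2) (e / (16 * M))).
  have m0 : 0 < m by rewrite !lt_min !subr_gt0 ax xb cy yd !divr_gt0// mulr_gt0.
  exists (m / 2); split; first by rewrite divr_gt0.
  have : m / 2 < m by lra.
  move: (m / 2) => s; rewrite !lt_min -!andbA => /and5P[-> -> -> ->] /andP[sr se].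
  by split => //; split; [lra|rewrite mulrC -ltr_pdivlMr// mulr_gt0].
case: sE => sa sb sc sd [sr se].
have xm : a <= x - s <= b by apply/andP; split; lra.
have xp : x - s <= x + s <= b by apply/andP; split; lra.
have ym : c <= y - s <= d by apply/andP; split; lra.
have yp : y - s <= y + s <= d by apply/andP; split; lra.
have cdle : c <= d by lra.
have able : a <= b by lra.
have sub a' b' c' d' : a <= a' -> b' <= b -> c <= c' -> d' <= d -> contR h a' b' c' d'.
  by move=> h1 h2 h3 h4 z hz; apply: ch; apply: subrect hz.
have zero a' b' c' d' : a <= a' -> b' <= b -> c <= c' -> d' <= d -> a' < b' -> c' < d' ->
    (x < a') || (b' < x) || (y < c') || (d' < y) -> bint h a' b' c' d' = 0.
  move=> h1 h2 h3 h4 h5 h6 out; apply: goursat => // z hz.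
  apply: dh; first exact: subrect hz.
  apply/eqP => zp; move: hz; rewrite zp pE => /rect_pt[/andP[q1 q2] /andP[q3 q4]].
  by move: out; rewrite !ltNge q1 q2 q3 q4.
have xs : x - s < x + s by lra.
have ys : y - s < y + s by lra.
(* Four cuts remove the strips to the left, to the right, below and above the small square; none of
   them contains p. *)
rewrite (bint_splitx cdle xm ch) zero ?lexx ?(andP xm).2 ?add0r//; last 3 first.
- by lra.
- by lra.
- by rewrite [x - s < x]ltrBlDr ltrDl s0 orbT.
rewrite (bint_splitx cdle xp (sub _ _ _ _ (andP xm).1 (lexx _) (lexx _) (lexx _))).
rewrite [X in _ + X]zero ?lexx ?addr0//; last 4 first.
- by lra.
- by lra.
- by lra.
- by rewrite ltrDl s0.
have sub1 := sub _ _ _ _ (andP xm).1 (andP xp).2 (lexx c) (lexx d).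
rewrite (bint_splity (ltW xs) ym sub1) zero ?(andP xm).1 ?(andP xp).2 ?lexx ?add0r ?(andP ym).2//; last 2 first.
- by lra.
- by rewrite [y - s < y]ltrBlDr ltrDl s0 !orbT.
have sub2 := sub _ _ _ _ (andP xm).1 (andP xp).2 (andP ym).1 (lexx d).
rewrite (bint_splity (ltW xs) yp sub2) [X in _ + X]zero ?addr0 ?lexx ?(andP xm).1 ?(andP xp).2//; last 3 first.
- by lra.
- by lra.
- by rewrite [y < y + s]ltrDl s0 !orbT.
have sub3 := sub _ _ _ _ (andP xm).1 (andP xp).2 (andP ym).1 (andP yp).2.
apply: le_trans (bint_bound (M := M) (ltW xs) (ltW ys) (contR_B sub3) _) _; last first.
  by apply: ltW; apply: le_lt_trans se; rewrite le_eqVlt; apply/orP; left; apply/eqP; ring.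
move=> w [x' [y' [/andP[q1 q2] /andP[q3 q4] _ ->]]]; apply: Hr.
rewrite pE (_ : pt x' y' - pt x y = pt (x' - x) (y' - y)); last by rewrite /pt !rcB; ring.
apply: le_lt_trans (cabs_pt _ _) _; apply: le_lt_trans sr.
have : `|x' - x| <= s by rewrite ler_norml; apply/andP; split; lra.
have : `|y' - y| <= s by rewrite ler_norml; apply/andP; split; lra.
by lra.
Qed.

End CauchyTaylor.

(** * Taylor coefficients *)

Section Taylor.
Variable R : realType.
Local Notation C := (Cplx R).
Implicit Types (f g F : C -> C) (z w l : C).

Lemma ptE (x y : R) : pt x y = (Complex x y : C).
Proof.
rewrite /pt /rc -complexiE; apply/eqP; rewrite eq_complex /=.
by rewrite ?(mul0r, mul1r, mulr0, subr0, addr0, add0r, sub0r, oppr0) !eqxx.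
Qed.

Lemma cint_Im_ge (f : R -> C) (a b m : R) : a <= b -> rcontI f a b ->
  (forall t, a <= t <= b -> m <= complex.Im (f t)) ->
  m * (b - a) <= complex.Im (cint f a b).
Proof.
move=> ab cf fm.
have -> : complex.Im (cint f a b) =
    (\int[@lebesgue_measure R]_(t in `[a, b]) complex.Im (f t))%R.
  by rewrite /cint -/(pt _ _) ptE.
have <- : \int[@lebesgue_measure R]_(t in `[a, b]) m = m * (b - a).
  rewrite Rintegral_cst//= lebesgue_measure_itv /= lte_fin.
  by have [//|ba|->] := ltgtP a b; [rewrite ltNge ab in ba|rewrite subrr].
apply: le_Rintegral => //.
- apply: cont_integrable => t _; exact: cvg_cst.
- exact: int_Im cf.
Qed.

Lemma cint_Im_le (f : R -> C) (a b m : R) : a <= b -> rcontI f a b ->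
  (forall t, a <= t <= b -> complex.Im (f t) <= m) ->
  complex.Im (cint f a b) <= m * (b - a).
Proof.
move=> ab cf fm.
have -> : complex.Im (cint f a b) =
    (\int[@lebesgue_measure R]_(t in `[a, b]) complex.Im (f t))%R.
  by rewrite /cint -/(pt _ _) ptE.
have <- : \int[@lebesgue_measure R]_(t in `[a, b]) m = m * (b - a).
  rewrite Rintegral_cst//= lebesgue_measure_itv /= lte_fin.
  by have [//|ba|->] := ltgtP a b; [rewrite ltNge ab in ba|rewrite subrr].
apply: le_Rintegral => //.
- exact: int_Im cf.
- apply: cont_integrable => t _; exact: cvg_cst.
Qed.

Section Square.
Variable r : R.
Hypothesis r0 : 0 < r.
Let Nr : - r < r. Proof. by rewrite gtrN. Qed.
Let Nrr : - r <= r. Proof. exact: ltW. Qed.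

Let sq z := rect (- r) r (- r) r z.
Let sqb z := bdry (- r) r (- r) r z.
Let I f := bint f (- r) r (- r) r.

Lemma sq_cabs z : sq z -> cabs z <= 2 * r.
Proof.
move=> [x [y [hx hy ->]]]; apply: le_trans (cabs_pt _ _) _.
by rewrite -!ler_norml in hx hy; lra.
Qed.

Lemma sqb_cabs z : sqb z -> r <= cabs z.
Proof.
move=> [x [y [hx hy h ->]]].
have E1 : complex.Re (pt x y) = x by rewrite ptE.
have E2 : complex.Im (pt x y) = y by rewrite ptE.
have rr : `|r| = r by rewrite ger0_norm// ltW.
have := Re_le (pt x y); have := Im_le (pt x y); rewrite E1 E2.
by case/orP: h => [/orP[/orP[]|]|] /eqP ->; rewrite ?normrN rr.
Qed.

Lemma sqb_neq0 z : sqb z -> z != 0.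
Proof. by move=> /sqb_cabs h; rewrite -cabs_gt0; exact: lt_le_trans h. Qed.

Lemma invX_contB k : contB (fun w => w^-1 ^+ k) (- r) r (- r) r.
Proof. by move=> z /sqb_neq0 /(cderiv_invX k) /cderiv_cont. Qed.

Lemma I_invX k : I (fun w => w^-1 ^+ k.+2) = 0.
Proof.
apply: (bint_FTC (F := fun w => - k.+1%:R^-1 * w^-1 ^+ k.+1)) => //.
  exact: invX_contB.
move=> z /sqb_neq0 z0.
have -> : z^-1 ^+ k.+2 = - k.+1%:R^-1 * (- k.+1%:R * z^-1 ^+ k.+2).
  by rewrite mulrA mulrNN mulVf ?mul1r// pnatr_eq0.
exact/cderivZ/cderiv_invX.
Qed.

(* Only kappa <> 0 is needed, not its value 2 pi i. *)
Definition kappa : C := I (fun w => w^-1 ^+ 1).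

Lemma Im_inv (x y : R) : complex.Im (pt x y)^-1 = - y / (x ^+ 2 + y ^+ 2).
Proof. by rewrite ptE /= mulNr. Qed.

Lemma Re_inv (x y : R) : complex.Re (pt x y)^-1 = x / (x ^+ 2 + y ^+ 2).
Proof. by rewrite ptE. Qed.

(** On a side of the square t^2 + r^2 is at most 2 r^2. *)
Lemma inv_bound (t : R) : - r <= t <= r -> (2 * r)^-1 <= r / (t ^+ 2 + r ^+ 2).
Proof.
rewrite -ler_norml => tr; have t2 : t ^+ 2 <= r ^+ 2.
  by rewrite -[t ^+ 2]real_normK ?num_real// ler_pXn2r ?nnegrE ?normr_ge0// ltW.
have q0 : 0 < t ^+ 2 + r ^+ 2 by rewrite ltr_wpDl ?sqr_ge0// exprn_gt0.
rewrite ler_pdivlMr// mulrC ler_pdivrMr ?mulr_gt0//.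
by rewrite (_ : r * (2 * r) = r ^+ 2 + r ^+ 2); [rewrite lerD2r|ring].
Qed.

(** By [inv_bound] each of the four sides, of length 2 r, contributes at least (2 r)^-1 * 2 r = 1 to
    the imaginary part. *)
Lemma cabs_kappa : 4 <= cabs kappa.
Proof.
apply: le_trans (Im_le _); apply: le_trans (ler_norm _).
have q : (2 * r)^-1 * (r - - r) = 1 by field; rewrite gt_eqF.
have cB := invX_contB 1.
have e1 : (- r == - r) || (- r == r) by rewrite eqxx.
have e2 : (r == - r) || (r == r) by rewrite eqxx orbT.
have h1 : 1 <= complex.Im (hint (fun w => w^-1 ^+ 1) (- r) (- r) r).
  rewrite -q; apply: cint_Im_ge => //; first exact: (hcontB Nrr cB e1).
  by move=> t /inv_bound ht; rewrite expr1 Im_inv opprK sqrrN.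
have h2 : 1 <= complex.Im (vint (fun w => w^-1 ^+ 1) r (- r) r).
  rewrite -q; apply: cint_Im_ge => //; first exact: (vcontB Nrr cB e2).
  move=> t /inv_bound ht; rewrite expr1 -complexiE cImM Re_inv Im_inv /=.
  by rewrite mul0r add0r mul1r addrC.
have h3 : complex.Im (hint (fun w => w^-1 ^+ 1) r (- r) r) <= - 1.
  rewrite -q -mulNr; apply: cint_Im_le => //; first exact: (hcontB Nrr cB e2).
  by move=> t /inv_bound ht; rewrite expr1 Im_inv mulNr lerN2.
have h4 : complex.Im (vint (fun w => w^-1 ^+ 1) (- r) (- r) r) <= - 1.
  rewrite -q -mulNr; apply: cint_Im_le => //; first exact: (vcontB Nrr cB e1).
  move=> t /inv_bound ht; rewrite expr1 -complexiE cImM Re_inv Im_inv /=.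
  by rewrite mul0r add0r mul1r sqrrN addrC mulNr lerN2.
rewrite /kappa /I /bint 2!cImB cImD.
have -> : 4 = 1 + 1 - -1 - -1 :> R by ring.
exact: lerB (lerB (lerD h1 h2) h3) h4.
Qed.

Lemma kappa_neq0 : kappa != 0.
Proof. by rewrite -cabs_gt0; apply: lt_le_trans cabs_kappa. Qed.

Lemma ccontM f g z : ccont f z -> ccont g z -> ccont (fun w => f w * g w) z.
Proof.
move=> cf cg e e0.
have M0 : 0 < cabs (f z) + cabs (g z) + 1 by rewrite ltr_wpDl ?addr_ge0 ?cabs_ge0.
pose e' := Num.min 1 (e / (cabs (f z) + cabs (g z) + 1)).
have e'0 : 0 < e' by rewrite lt_min ltr01 divr_gt0.
have [d d0 H] := cf _ e'0; have [d' d'0 H'] := cg _ e'0.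
exists (Num.min d d'); first by rewrite lt_min d0.
move=> w; rewrite lt_min => /andP[/H h /H' h'].
have e'1 : e' <= 1 by rewrite ge_min lexx.
have e'e : e' * (cabs (f z) + cabs (g z) + 1) <= e.
  by rewrite -ler_pdivlMr// ge_min lexx orbT.
apply: lt_le_trans e'e.
rewrite (_ : _ - _ = (f w - f z) * (g w - g z) + ((f w - f z) * g z + f z * (g w - g z))); last by ring.
apply: le_lt_trans (cabsD _ _) _.
have := cabsD ((f w - f z) * g z) (f z * (g w - g z)); rewrite !cabsM.
have := cabs_ge0 (f z); have := cabs_ge0 (g z).
have := cabs_ge0 (f w - f z); have := cabs_ge0 (g w - g z).
move: (cabs (f w - f z)) (cabs (g w - g z)) (cabs (f z)) (cabs (g z)) h h' => x y u v.
by clear -e'1 e'0; nra.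
Qed.

Lemma ccont_sum (J : Type) (s : seq J) (F : J -> C -> C) z :
  (forall j, ccont (F j) z) -> ccont (fun w => \sum_(j <- s) F j w) z.
Proof.
move=> cF; elim: s => [|j s IH].
  by move=> e e0; exists 1 => // w _; rewrite !big_nil subrr cabs0.
move=> e e0; have e2 : 0 < e / 2 by rewrite divr_gt0.
have [d d0 H] := cF j _ e2; have [d' d'0 H'] := IH _ e2.
exists (Num.min d d'); first by rewrite lt_min d0.
move=> w; rewrite lt_min => /andP[/H h /H' h']; rewrite !big_cons.
set A := \sum_(k <- s) F k w in h' *; set B := \sum_(k <- s) F k z in h' *.
rewrite (_ : _ - _ = (F j w - F j z) + (A - B)); last by ring.
by apply: le_lt_trans (cabsD _ _) _; lra.
Qed.

Lemma bint_sum (J : Type) (s : seq J) (F : J -> C -> C) :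
  (forall j, contB (F j) (- r) r (- r) r) ->
  I (fun w => \sum_(j <- s) F j w) = \sum_(j <- s) I (F j).
Proof.
move=> cF; elim: s => [|j s IH].
  rewrite big_nil; transitivity (I (fun w => 0 * w^-1 ^+ 1)).
    by apply: eq_bint => // w _; rewrite big_nil mul0r.
  by rewrite /I (bintZ Nrr Nrr _ (invX_contB 1)) mul0r.
rewrite big_cons -IH /I -(bintD Nrr Nrr (cF j)).
  by apply: eq_bint => // w _; rewrite big_cons.
by move=> z hz; apply: ccont_sum => k; exact: cF.
Qed.

Variables (f : C -> C) (M : R).
Hypothesis df : forall z, cabs z <= 2 * r -> exists l, cderiv f z l.
Hypothesis fM : forall z, cabs z <= 2 * r -> cabs (f z) <= M.

Let M0 : 0 <= M.
Proof. by apply: le_trans (cabs_ge0 _) (fM (z := 0) _); rewrite cabs0 mulr_ge0// ltW. Qed.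

Definition tcoef_at k : C := kappa^-1 * I (fun w => f w * w^-1 ^+ k.+1).

Let fc : contB f (- r) r (- r) r.
Proof. by move=> z /bdry_rect /sq_cabs /df[l]; exact: cderiv_cont. Qed.

Let fXc k : contB (fun w => f w * w^-1 ^+ k) (- r) r (- r) r.
Proof. by move=> z hz; apply: ccontM; [exact: fc|exact: invX_contB]. Qed.

Let kappaV : cabs kappa^-1 <= 4^-1.
Proof. by rewrite cabsV lef_pV2 ?cabs_kappa// posrE// cabs_gt0 kappa_neq0. Qed.

(** On the boundary |w| >= r, so [bint_bound] gives 4 * M / r^(k+1) * 4 r, and the inverse of
    [kappa] contributes 1/4. *)
Lemma tcoef_bound k : cabs (tcoef_at k) <= 4 * M / r ^+ k.
Proof.
rewrite /tcoef_at cabsM.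
have rk : 0 < r ^+ k.+1 by rewrite exprn_gt0.
apply: le_trans (ler_pM _ _ kappaV (bint_bound (M := M / r ^+ k.+1) Nrr Nrr (fXc _) _)) _;
  rewrite ?cabs_ge0//.
  move=> z hz; rewrite cabsM cabsX cabsV ler_pM ?cabs_ge0 ?exprn_ge0 ?invr_ge0 ?cabs_ge0//.
    by apply/fM/sq_cabs/bdry_rect.
  rewrite exprVn lef_pV2 ?posrE ?exprn_gt0//; last by rewrite cabs_gt0 sqb_neq0.
  by rewrite ler_pXn2r ?nnegrE ?cabs_ge0 ?sqb_cabs// ltW.
rewrite le_eqVlt; apply/orP; left; apply/eqP; rewrite exprS; field.
by rewrite ?expf_neq0 ?(gt_eqF r0).
Qed.

Let geo (z w : C) D : w != 0 -> w - z != 0 ->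
  (w - z)^-1 = \sum_(k < D) z ^+ k * w^-1 ^+ k.+1 + z ^+ D * (w^-1 ^+ D * (w - z)^-1).
Proof.
move=> w0 wz; elim: D => [|D IH]; first by rewrite big_ord0 add0r !expr0 !mul1r.
rewrite big_ord_recr /= {1}IH -addrA; congr (_ + _); rewrite !exprS; field.
by rewrite w0 wz.
Qed.

Section Point.
Variable z : C.
Hypothesis zr : cabs z <= r / 2.

Let wz_ge w : sqb w -> r / 2 <= cabs (w - z).
Proof.
move=> /sqb_cabs h; apply: le_trans (cabs_dist w z).
by have zr' := zr; lra.
Qed.

Let wz_neq0 w : sqb w -> w - z != 0.
Proof. by move=> /wz_ge h; rewrite -cabs_gt0; apply: lt_le_trans h; rewrite divr_gt0. Qed.

Let invz_contB : contB (fun w => (w - z)^-1) (- r) r (- r) r.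
Proof.
move=> w hw; have w0 := wz_neq0 hw.
exact: cderiv_cont (cderiv_comp_shift (cderiv_inv w0)).
Qed.

Let remc D : contB (fun w => w^-1 ^+ D * (w - z)^-1) (- r) r (- r) r.
Proof. by move=> w hw; apply: ccontM; [exact: invX_contB|exact: invz_contB]. Qed.

(** The finite geometric sum for 1 / (w - z) is integrated against g, which will be the constant 1
    for [kappa_z] and f for the Taylor remainder. On the boundary |w - z| >= r / 2, and [bint_bound]
    yields 4 * N r^-D (2 / r) * 4 r = 32 N r^-D. *)
Lemma cauchy_expansion g (N : R) D : contB g (- r) r (- r) r ->
  (forall w, sqb w -> cabs (g w) <= N) ->
  cabs (I (fun w => g w * (w - z)^-1) -
    \sum_(k < D) z ^+ k * I (fun w => g w * w^-1 ^+ k.+1)) <=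
  32 * N * (cabs z / r) ^+ D.
Proof.
move=> cg gN.
have cX k : contB (fun w => g w * w^-1 ^+ k) (- r) r (- r) r.
  by move=> w hw; apply: ccontM; [exact: cg|exact: invX_contB].
have cR : contB (fun w => g w * (w^-1 ^+ D * (w - z)^-1)) (- r) r (- r) r.
  by move=> w hw; apply: ccontM; [exact: cg|exact: remc].
have cZ k m : contB (fun w => k * (g w * w^-1 ^+ m)) (- r) r (- r) r.
  move=> w hw; apply: ccontM; last exact: cX.
  by move=> e e0; exists 1 => // v _; rewrite subrr cabs0.
have -> : I (fun w => g w * (w - z)^-1) =
   \sum_(k < D) z ^+ k * I (fun w => g w * w^-1 ^+ k.+1) +
   z ^+ D * I (fun w => g w * (w^-1 ^+ D * (w - z)^-1)).
  have -> : \sum_(k < D) z ^+ k * I (fun w => g w * w^-1 ^+ k.+1) =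
      I (fun w => \sum_(k < D) z ^+ k * (g w * w^-1 ^+ k.+1)).
    by rewrite bint_sum//; apply: eq_bigr => k _; rewrite /I bintZ.
  rewrite /I -bintZ// -bintD//.
  - apply: eq_bint => // w hw.
    rewrite {1}(geo D (sqb_neq0 hw) (wz_neq0 hw)) mulrDr; congr (_ + _); last exact: mulrCA.
    by rewrite mulr_sumr; apply: eq_bigr => k _; exact: mulrCA.
  - by move=> w hw; apply: ccont_sum => k; exact: cZ.
  - move=> w hw; apply: ccontM; last exact: cR.
    by move=> e e0; exists 1 => // v _; rewrite subrr cabs0.
rewrite addrAC subrr add0r cabsM cabsX expr_div_n.
have rD : 0 < r ^+ D by rewrite exprn_gt0.
have N0 : 0 <= N.
  by apply: le_trans (cabs_ge0 _) (gN (pt r r) _); exists r, r; rewrite !Nrr !lexx eqxx !orbT.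
rewrite mulrCA ler_wpM2l ?exprn_ge0 ?cabs_ge0//.
apply: le_trans (bint_bound (M := N * (r ^- D * (2 / r))) Nrr Nrr cR _) _.
  move=> w hw; rewrite !cabsM cabsX !cabsV.
  apply: ler_pM; rewrite ?cabs_ge0 ?mulr_ge0 ?invr_ge0 ?exprn_ge0 ?invr_ge0 ?cabs_ge0 ?gN//.
  apply: ler_pM; rewrite ?invr_ge0 ?exprn_ge0 ?invr_ge0 ?cabs_ge0//.
    rewrite exprVn lef_pV2 ?posrE ?exprn_gt0//; last by rewrite cabs_gt0 sqb_neq0.
    by apply: lerXn2r; rewrite ?nnegrE ?cabs_ge0 ?sqb_cabs ?(ltW r0).
  by rewrite -[2 / r]invf_div lef_pV2 ?posrE ?divr_gt0 ?wz_ge// cabs_gt0 wz_neq0.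
rewrite le_eqVlt; apply/orP; left; apply/eqP; field.
by rewrite ?expf_neq0 ?(gt_eqF r0).
Qed.

(** For g = 1 all terms of [cauchy_expansion] except the first vanish by [I_invX], and the remainder
    tends to 0 as D grows. *)
Lemma kappa_z : I (fun w => (w - z)^-1) = kappa.
Proof.
have H D : cabs (I (fun w => (w - z)^-1) - kappa) <= 32 * (cabs z / r) ^+ D.+1.
  have c1 : contB (fun=> 1 : C) (- r) r (- r) r.
    by move=> w _ e e0; exists 1 => // v _; rewrite subrr cabs0.
  have := @cauchy_expansion (fun=> 1) 1 D.+1 c1; rewrite mulr1.
  rewrite big_ord_recl expr0 mul1r big1 ?addr0; last first.
    move=> k _; rewrite /= [X in _ * X](_ : _ = 0) ?mulr0//.
    by rewrite -[RHS](I_invX k); apply: eq_bint => // w _; rewrite mul1r.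
  rewrite (_ : I (fun w => 1 * (w - z)^-1) = I (fun w => (w - z)^-1)); last first.
    by apply: eq_bint => // w _; rewrite mul1r.
  rewrite (_ : I (fun w => 1 * w^-1 ^+ 1) = kappa); last first.
    by apply: eq_bint => // w _; rewrite mul1r.
  by apply=> w _; rewrite cabs1.
apply/eqP; rewrite -subr_eq0; apply/eqP; apply: cabs_small => e e0.
pose m := (Num.truncn (32 / e)).
have hm : 32 / e < m.+1%:R by exact: truncnS_gt.
have hm2 : m.+1%:R < 2 ^+ m.+1 :> R by rewrite -natrX ltr_nat ltn_expl.
apply: le_trans (H m) _.
apply: le_trans (_ : 32 * (2^-1) ^+ m.+1 <= _).
  rewrite ler_pM2l// ler_pXn2r ?nnegrE ?divr_ge0 ?cabs_ge0 ?invr_ge0 ?(ltW r0)//.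
  by rewrite ler_pdivrMr// mulrC.
rewrite exprVn ler_pdivrMr ?exprn_gt0// -ler_pdivrMl// mulrC.
exact: ltW (lt_trans hm hm2).
Qed.

(** The difference quotient of f at z, continued by the derivative, is continuous at z and
    holomorphic elsewhere, so [bint_removable] applies to it. *)
Lemma cauchy_formula : I (fun w => f w * (w - z)^-1) = f z * kappa.
Proof.
have zr1 := zr; have r01 := r0.
 have z2 : cabs z <= 2 * r by lra.
have [l dl] := df z2.
pose h w := if w == z then l else (f w - f z) * (w - z)^-1.
have hder w : sq w -> w != z -> exists l', cderiv h w l'.
  move=> hw wz; have [l' dl'] := df (sq_cabs hw).
  have wz' : w - z != 0 by rewrite subr_eq0.
  have d1 := cderivD dl' (cderiv_cst (- f z) w).
  have d2 := cderivM d1 (cderiv_comp_shift (cderiv_inv wz')).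
  eexists; apply: cderiv_near d2; first by rewrite -cabs_gt0 in wz'; exact: wz'.
  move=> v vw; rewrite /h; case: eqP => // vz; move: vw.
  by rewrite vz -cabsN opprB ltxx.
have hcont : contR h (- r) r (- r) r.
  move=> w hw; have [->|wz] := eqVneq w z; last first.
    by have [l' /cderiv_cont] := hder _ hw wz.
  move=> e e0; have e2 : 0 < e / 2 by rewrite divr_gt0.
  have [d d0 H] := dl _ e2; exists d => // v vd; rewrite /h eqxx.
  have [_|vz] := eqVneq v z; first by rewrite subrr cabs0.
  have vz0 : 0 < cabs (v - z) by rewrite cabs_gt0 subr_eq0.
  have := H (v - z) vd; rewrite [z + _]addrC subrK => {}H.
  rewrite -(ltr_pM2r vz0) -cabsM mulrBl mulfVK ?subr_eq0//.
  by apply: le_lt_trans H _; rewrite ltr_pM2r//; lra.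
have zRe : `|complex.Re z| < r by have := Re_le z; lra.
have zIm : `|complex.Im z| < r by have := Im_le z; lra.
rewrite !ltr_norml in zRe zIm; have [a1 a2] := andP zRe; have [b1 b2] := andP zIm.
have := bint_removable a1 a2 b1 b2 hcont hder.
have -> : bint h (- r) r (- r) r = I (fun w => f w * (w - z)^-1) - f z * kappa.
  rewrite -kappa_z -mulNr /I -bintZ// -bintD//.
  - apply: eq_bint => // w hw; rewrite /h.
    have /negPf := wz_neq0 hw; rewrite subr_eq0 => ->; ring.
  - by move=> w hw; apply: ccontM; [exact: fc|exact: invz_contB].
  - move=> w hw; apply: ccontM; last exact: invz_contB.
    by move=> e e0; exists 1 => // v _; rewrite subrr cabs0.
by move=> /eqP; rewrite subr_eq0 => /eqP.
Qed.

Lemma taylor_rem D : cabs (f z - \sum_(k < D) tcoef_at k * z ^+ k) <=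
  8 * M * (cabs z / r) ^+ D.
Proof.
have fN w : sqb w -> cabs (f w) <= M by move=> hw; apply/fM/sq_cabs/bdry_rect.
have := cauchy_expansion D fc fN; rewrite cauchy_formula => H.
have -> : f z - \sum_(k < D) tcoef_at k * z ^+ k = kappa^-1 *
   (f z * kappa - \sum_(k < D) z ^+ k * I (fun w => f w * w^-1 ^+ k.+1)).
  rewrite mulrBr mulr_sumr mulrCA mulVf ?kappa_neq0// mulr1; congr (_ - _).
  by apply: eq_bigr => k _; rewrite /tcoef_at; ring.
rewrite cabsM; apply: le_trans (ler_pM _ _ kappaV H) _; rewrite ?cabs_ge0//.
by rewrite le_eqVlt; apply/orP; left; apply/eqP; field; rewrite ?(gt_eqF r0).
Qed.

End Point.

End Square.

Theorem taylor_local f (r M : R) : 0 < r ->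
  (forall z, cabs z <= 2 * r -> exists l, cderiv f z l) ->
  (forall z, cabs z <= 2 * r -> cabs (f z) <= M) ->
  exists c : nat -> C, (forall k, cabs (c k) <= 4 * M / r ^+ k) /\
   forall z D, cabs z <= r / 2 ->
     cabs (f z - \sum_(k < D) c k * z ^+ k) <= 8 * M * (cabs z / r) ^+ D.
Proof.
move=> r0 df fM; exists (tcoef_at r f); split.
  by move=> k; exact: tcoef_bound.
by move=> z D zr; exact: taylor_rem.
Qed.

End Taylor.

(** * Holomorphic functions on normed spaces *)

Section Weierstrass.
Variable R : realType.
Local Notation C := (Cplx R).

Lemma pow2_small (e : R) : 0 < e -> exists m : nat, 2^-1 ^+ m < e.
Proof.
move=> e0; pose m := Num.truncn e^-1.
have hm : e^-1 < m.+1%:R by exact: truncnS_gt.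
have hm2 : m.+1%:R < 2 ^+ m.+1 :> R by rewrite -natrX ltr_nat ltn_expl.
exists m.+1; rewrite exprVn -[e]invrK ltf_pV2 ?posrE ?invr_gt0 ?exprn_gt0//.
exact: lt_trans hm hm2.
Qed.

Lemma cauchy_complete (u : nat -> C) :
  (forall e : R, 0 < e -> exists N, forall m k, (N <= m)%N -> (N <= k)%N -> cabs (u m - u k) <= e) ->
  exists l, forall e : R, 0 < e -> exists N, forall m, (N <= m)%N -> cabs (u m - l) <= e.
Proof.
move=> cu.
have H (p : C -> R) : (forall z w, p (z - w) = p z - p w) -> (forall z, `|p z| <= cabs z) ->
   exists l, forall e : R, 0 < e -> exists N, forall m, (N <= m)%N -> `|p (u m) - l| <= e.
  move=> pB ple.
  have : cvg ((p \o u) @ \oo).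
    apply/cauchy_cvgP/cauchy_exP => e e0; have e2 : 0 < e / 2 by rewrite divr_gt0.
    have [N HN] := cu _ e2; exists (p (u N)), N => // m /= hm.
    rewrite /ball /= -pB; apply: le_lt_trans (ple _) _.
    by apply: le_lt_trans (HN _ _ (leqnn _) hm) _; lra.
  move=> /cvg_ex[l /cvgrPdist_le Hl]; exists l => e e0.
  have [N _ HN] := Hl _ e0; exists N => m hm; rewrite distrC; exact: HN.
have [a Ha] := H _ (@cReB R) (@Re_le R); have [b Hb] := H _ (@cImB R) (@Im_le R).
exists (Complex a b : C) => e e0; have e2 : 0 < e / 2 by rewrite divr_gt0.
have [N1 H1] := Ha _ e2; have [N2 H2] := Hb _ e2; exists (maxn N1 N2) => m.
rewrite geq_max => /andP[m1 m2]; apply: le_trans (cabs_ReIm _) _.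
by rewrite cReB cImB /=; have := H1 _ m1; have := H2 _ m2; lra.
Qed.

Lemma cderiv_unique f z (l l' : C) : cderiv f z l -> cderiv f z l' -> l = l'.
Proof.
by move=> /cderiv_is_derive[_ <-] /cderiv_is_derive[_ <-].
Qed.

Variable W : normedModType C.
Implicit Types (x h : W) (f g : W -> C).

Definition wn h : R := cabs `|h|.

Lemma wnE h : `|h| = rc (wn h).
Proof. by rewrite -normE normr_id. Qed.

Lemma wn_ge0 h : 0 <= wn h. Proof. exact: cabs_ge0. Qed.

Lemma wnZ (t : C) h : wn (t *: h) = cabs t * wn h.
Proof. by apply: rc_inj; rewrite -wnE normrZ rcM -wnE normE. Qed.

Lemma wn0 : wn 0 = 0. Proof. by rewrite /wn normr0 cabs0. Qed.

Lemma wnN h : wn (- h) = wn h. Proof. by rewrite /wn normrN. Qed.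

Lemma wn_eq0 h : (wn h == 0) = (h == 0).
Proof. by rewrite /wn cabs_eq0 normr_eq0. Qed.

Lemma nbhs_wn x (U : set W) : nbhs x U <-> exists2 d : R, 0 < d & forall y, wn (y - x) < d -> U y.
Proof.
split.
  move=> /nbhs_ballP[e /= /rc_gt0P[d d0 ->] H]; exists d => // y yd; apply: H.
  by rewrite -ball_normE /ball_ /= distrC wnE rc_ltr.
move=> [d d0 H]; apply/nbhs_ballP; exists (rc d); first by rewrite /= rc_gt0.
by move=> y; rewrite -ball_normE /ball_ /= distrC wnE rc_ltr; exact: H.
Qed.

Lemma diff_eps f x : differentiable f x -> forall e : R, 0 < e ->
  exists2 d : R, 0 < d & forall h, wn h < d -> cabs (f (x + h) - f x - 'd f x h) <= e * wn h.
Proof.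
move=> /diff_locally /eqaddoP H e e0.
have /H : 0 < rc e by rewrite rc_gt0.
move=> /nbhs_wn[d d0 Hd]; exists d => // h hd; have := Hd h; rewrite subr0 => /(_ hd).
by rewrite !fctE /= normE wnE -rcM rc_ler opprD addrA [h + x]addrC.
Qed.

(** The bound [B] supplies the continuity of [L], which is part of differentiability in a normed
    space. *)
Lemma eps_diff f x (L : {linear W -> C}) (B : R) :
  (forall h, cabs (L h) <= B * wn h) ->
  (forall e : R, 0 < e -> exists2 d : R, 0 < d &
     forall h, wn h < d -> cabs (f (x + h) - f x - L h) <= e * wn h) ->
  differentiable f x.
Proof.
move=> LB H.
have cL : continuous L.
  apply/linear_bounded_continuous/linear_boundedP.
  exists (rc B); split; first by apply/complex_realP; exists B.
  move=> r Br h; rewrite normE wnE; apply: le_trans (_ : rc B * rc (wn h) <= _).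
    by rewrite -rcM rc_ler.
  by apply: ler_wpM2r; [rewrite -wnE normr_ge0|exact: ltW].
have fL : f \o shift x = cst (f x) + L +o_ 0 id.
  apply/eqaddoP => _ /rc_gt0P[e e0 ->]; have [d d0 Hd] := H _ e0.
  apply/nbhs_wn; exists d => // h; rewrite subr0 => /Hd.
  by rewrite !fctE /= normE wnE -rcM rc_ler opprD addrA [h + x]addrC.
by apply/diff_locallyP; rewrite (diff_unique cL fL).
Qed.

Lemma diff_line f x h (t : C) : differentiable f (x + t *: h) ->
  cderiv (fun u : C => f (x + u *: h)) t ('d f (x + t *: h) h).
Proof.
move=> /diff_eps df e e0; have w0 : 0 < wn h + 1 by rewrite ltr_wpDl ?wn_ge0.
have ew : 0 < e / (wn h + 1) by rewrite divr_gt0.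
have [d d0 H] := df _ ew; exists (d / (wn h + 1)); first by rewrite divr_gt0.
move=> u; rewrite ltr_pdivlMr// => ud.
have hu : wn (u *: h) < d.
  by rewrite wnZ; apply: le_lt_trans ud; rewrite ler_wpM2l ?cabs_ge0// lerDl.
have -> : f (x + (t + u) *: h) - f (x + t *: h) - 'd f (x + t *: h) h * u =
    f (x + t *: h + u *: h) - f (x + t *: h) - 'd f (x + t *: h) (u *: h).
  by congr (f _ - _ - _); [rewrite scalerDl addrA|rewrite linearZ mulrC].
apply: le_trans (H _ hu) _; rewrite wnZ.
rewrite (_ : _ * _ = e * cabs u * (wn h / (wn h + 1))); last by ring.
rewrite ler_piMr//; first by rewrite mulr_ge0 ?cabs_ge0 ?ltW.
by rewrite ler_pdivrMr// mul1r lerDl.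
Qed.

(** The one-variable expansion is applied to t -> f (x + t h). The radius r with r |h| = d / 4 keeps
    x + t h within d / 2 of x for |t| <= 2 r, and |h| <= d / 8 means 1 <= r / 2, so that t = 1 is
    admissible. The constants are 4 M / r and 8 M / r^2 with 1 / r = 4 |h| / d. *)
Lemma diff_taylor f x (d M : R) : 0 < d ->
  (forall y, wn (y - x) < d -> differentiable f y) ->
  (forall y, wn (y - x) < d -> cabs (f y) <= M) ->
  forall h, wn h <= d / 8 ->
   cabs ('d f x h) <= 16 * M / d * wn h /\
   cabs (f (x + h) - f x - 'd f x h) <= 128 * M / d ^+ 2 * wn h ^+ 2.
Proof.
move=> d0 df fM h hd.
have [->|h0] := eqVneq h 0.
  by rewrite linear0 addr0 subr0 subrr cabs0 wn0 expr0n !mulr0.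
have w0 : 0 < wn h by rewrite lt0r wn_eq0 h0 wn_ge0.
have [r [r0 rw rV]] : exists r : R, [/\ 0 < r, r * wn h = d / 4 & r^-1 = 4 * wn h / d].
  exists (d / (4 * wn h)); rewrite divr_gt0 ?mulr_gt0// invf_div; split => //.
  by field; rewrite gt_eqF.
have inb t : cabs t <= 2 * r -> wn (x + t *: h - x) < d.
  rewrite addrAC subrr add0r wnZ => tr.
  by apply: le_lt_trans (ler_wpM2r (ltW w0) tr) _; rewrite -mulrA rw; lra.
have [t tr|t tr|c [cM cr]] := @taylor_local R (fun t => f (x + t *: h)) r M r0.
- by eexists; apply: diff_line; apply/df/inb.
- exact/fM/inb.
have c0 : c 0%N = f x.
  apply/eqP; rewrite eq_sym -subr_eq0; apply/eqP/cabs_le0.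
  have := cr 0 1%N; rewrite cabs0 scale0r addr0 big_ord1 mulr1 mul0r expr1 mulr0.
  by apply; rewrite divr_ge0// ltW.
have M0 : 0 <= M.
  by apply: le_trans (cabs_ge0 _) (fM x _); rewrite subrr wn0.
have c1 : c 1%N = 'd f x h.
  apply: (@cderiv_unique (fun t => f (x + t *: h)) 0).
    move=> e e0; pose K := 8 * M / r ^+ 2 + 1.
    have K0 : 0 < K.
      by rewrite ltr_wpDl// (divr_ge0 (mulr_ge0 (ler0n _ 8) M0) (exprn_ge0 2 (ltW r0))).
    exists (Num.min (r / 2) (e / K)); first by rewrite lt_min !divr_gt0.
    move=> u; rewrite lt_min => /andP[ur]; rewrite ltr_pdivlMr// => ue.
    have := cr u 2%N (ltW ur); rewrite big_ord_recl big_ord1 /= c0 ?mulr1 ?expr1.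
    rewrite add0r scale0r addr0 opprD addrA => /le_trans; apply.
    apply: le_trans (_ : K * cabs u ^+ 2 <= _).
      by rewrite expr_div_n mulrCA mulrC ler_wpM2r ?exprn_ge0 ?cabs_ge0// /K mulrC lerDl.
    by rewrite expr2 mulrA ler_wpM2r ?cabs_ge0// mulrC ltW.
  by have := @diff_line f x h 0; rewrite scale0r addr0; apply; apply: df; rewrite subrr wn0.
rewrite -c1; split.
  apply: le_trans (cM _) _; rewrite expr1 rV le_eqVlt; apply/orP; left; apply/eqP; ring.
have := cr 1 2%N; rewrite scale1r big_ord_recl big_ord1 /= c0 ?mulr1 ?expr1 ?expr1n ?mulr1.
rewrite cabs1 opprD addrA mul1r => H; apply: le_trans (H _) _.
  by rewrite ler_pdivlMr// mul1r -(ler_pM2r w0) rw; lra.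
by rewrite rV le_eqVlt; apply/orP; left; apply/eqP; field; rewrite gt_eqF.
Qed.

Let sub_rearrange (a b c a' b' c' g g' g'' : C) :
  g = a - a' -> g' = b - b' -> g'' = c - c' -> (a - b - c) - (a' - b' - c') = g - g' - g''.
Proof. by move=> -> -> ->; ring. Qed.

(** The estimates of [diff_taylor], applied to differences F D - F E, show that the derivatives at x
    form a Cauchy sequence and that the first-order remainders are close to each other up to a term
    quadratic in h. Both facts pass to the limit. *)
Lemma weierstrass (F : nat -> W -> C) f x (d : R) : 0 < d ->
  (forall D y, wn (y - x) < d -> differentiable (F D) y) ->
  (forall e : R, 0 < e -> exists N, forall D, (N <= D)%N ->
      forall y, wn (y - x) < d -> cabs (F D y - f y) <= e) ->
  differentiable f x.
Proof.
move=> d0 dF Ff.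
have d8 : 0 < d / 8 by rewrite divr_gt0.
have dxx : wn (x - x) < d by rewrite subrr wn0.
have [dd ddE] : exists dd : nat -> {linear W -> C}, forall D h, dd D h = 'd (F D) x h.
  by exists (fun D => 'd (F D) x).
have close (e : R) : 0 < e -> exists N, forall D E, (N <= D)%N -> (N <= E)%N -> forall h,
   wn h <= d / 8 -> cabs (dd D h - dd E h) <= 16 * e / d * wn h /\
   cabs ((F D (x + h) - F D x - dd D h) - (F E (x + h) - F E x - dd E h)) <=
     128 * e / d ^+ 2 * wn h ^+ 2.
  move=> e0; have e2 : 0 < e / 2 by rewrite divr_gt0.
  have [N HN] := Ff _ e2; exists N => D E hD hE h hh.
  have [G [GE dG dGE]] : exists G : W -> C, [/\ forall y, G y = F D y - F E y,
     forall y, wn (y - x) < d -> differentiable G y &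
     forall k, 'd G x k = dd D k - dd E k].
    have [/= G' G'E] : exists G' : W -> C, G' = F D - F E by exists (F D - F E).
    exists G'; split.
    - by move=> y; rewrite G'E fctE.
    - move=> y hy; rewrite G'E.
      exact: (differentiableB (dF D y hy) (dF E y hy)).
    - move=> k; rewrite G'E.
      rewrite !ddE; have e1 := diffB (dF D x dxx) (dF E x dxx).
      exact: (congr1 (fun q => q k) e1).
  have BM y : wn (y - x) < d -> cabs (G y) <= e.
    move=> hy; rewrite GE (_ : _ - _ = (F D y - f y) - (F E y - f y)); last by ring.
    apply: le_trans (cabs_triB _ _) _.
    by have := HN _ hD _ hy; have := HN _ hE _ hy; lra.
  have [h1 h2] := diff_taylor d0 dG BM hh; split; first by rewrite -dGE; exact: h1.
  apply: le_trans h2; rewrite le_eqVlt; apply/orP; left; apply/eqP; congr cabs.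
  exact: sub_rearrange (GE _) (GE _) (dGE _).
(* Estimates on the ball of radius d / 8 extend to all h by homogeneity. *)
have lin_small h : exists2 t : C, t != 0 & wn (t *: h) <= d / 8.
  exists (rc (d / 8 / (wn h + 1))).
    by rewrite -cabs_gt0 cabs_rc gtr0_norm divr_gt0// ltr_wpDl ?wn_ge0.
  rewrite wnZ cabs_rc gtr0_norm ?divr_gt0 ?ltr_wpDl ?wn_ge0//.
  by rewrite mulrAC ler_pdivrMr ?ltr_wpDl ?wn_ge0// ler_pM2l// lerDl.
have /choice[L HL] : forall h, exists l, forall e : R, 0 < e ->
    exists N, forall D, (N <= D)%N -> cabs (dd D h - l) <= e.
  move=> h; apply: cauchy_complete => e e0.
  have [t t0 th] := lin_small h.
  pose K := 16 / d * wn h + 1.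
  have K0 : 0 < K by rewrite ltr_wpDl// mulr_ge0 ?divr_ge0 ?wn_ge0// ltW.
  have [N HN] := close (e / K) (divr_gt0 e0 K0); exists N => D E hD hE.
  have [+ _] := HN _ _ hD hE _ th.
  have -> : dd D (t *: h) - dd E (t *: h) = t * (dd D h - dd E h).
    by rewrite mulrBr; congr (_ - _); exact: linearZ.
  rewrite cabsM wnZ mulrCA.
  rewrite ler_pM2l ?cabs_gt0// => /le_trans; apply.
  rewrite (_ : 16 * (e / K) / d * wn h = e * (16 / d * wn h) / K); last by ring.
  by rewrite ler_pdivrMr// ler_pM2l// /K lerDl.
have Luniq h l : (forall e : R, 0 < e -> exists N, forall D, (N <= D)%N ->
     cabs (dd D h - l) <= e) -> L h = l.
  move=> Hl; apply/eqP; rewrite -subr_eq0; apply/eqP; apply: cabs_small => e e0.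
  have e2 : 0 < e / 2 by rewrite divr_gt0.
  have [N1 H1] := Hl _ e2; have [N2 H2] := HL h _ e2.
  have := H1 _ (leq_maxl N1 N2); have := H2 _ (leq_maxr N1 N2).
  set D := maxn _ _ => a b; rewrite (_ : _ - _ = (dd D h - l) - (dd D h - L h)); last by ring.
  by apply: le_trans (cabs_triB _ _) _; lra.
have Llin : linear L.
  move=> k h h'; apply: Luniq => e e0.
  have e2 : 0 < e / 2 / (cabs k + 1) by rewrite !divr_gt0// ltr_wpDl ?cabs_ge0.
  have [N1 H1] := HL h _ e2; have [N2 H2] := HL h' _ (divr_gt0 e0 (ltr0n _ 2)).
  exists (maxn N1 N2) => D; rewrite geq_max => /andP[/H1 a /H2 b].
  rewrite linearP (_ : _ - _ = k * (dd D h - L h) + (dd D h' - L h')); last first.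
    by rewrite -![_ *: _]/(_ * _); ring.
  apply: le_trans (cabsD _ _) _; rewrite cabsM.
  rewrite ler_pdivlMr ?ltr_wpDl ?cabs_ge0// in a.
  have := cabs_ge0 k; have := cabs_ge0 (dd D h - L h).
  move: (cabs k) (cabs (dd D h - L h)) (cabs (dd D h' - L h')) a b.
  by clear -e0 => p q s; nra.
pose LM := GRing.isLinear.Build C W C *:%R L Llin.
pose LL : {linear W -> C} := HB.pack L LM.
have LLE h : LL h = L h by [].
have Lclose (e : R) : 0 < e -> exists N, forall D, (N <= D)%N -> forall h, wn h <= d / 8 ->
    cabs (dd D h - L h) <= 16 * e / d * wn h /\
    cabs ((F D (x + h) - F D x - dd D h) - (f (x + h) - f x - L h)) <=
      128 * e / d ^+ 2 * wn h ^+ 2.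
  move=> e0; have [N HN] := close _ e0; exists N => D hD h hh.
  have xh : wn (x + h - x) < d by rewrite addrAC subrr add0r; lra.
  split; apply/ler_addgt0Pr => q q0.
    have [N1 H1] := HL h _ q0; have [+ _] := HN D (maxn N N1) hD (leq_maxl _ _) h hh.
    have := H1 _ (leq_maxr N N1); set E := maxn _ _ => a b.
    rewrite (_ : _ - _ = (dd D h - dd E h) + (dd E h - L h)); last by ring.
    by apply: le_trans (cabsD _ _) _; exact: lerD.
  have q3 : 0 < q / 3 by rewrite divr_gt0.
  have [N1 H1] := HL h _ q3; have [N2 H2] := Ff _ q3.
  pose E := maxn N (maxn N1 N2).
  have E1 : (N1 <= E)%N by rewrite /E !leq_max leqnn orbT.
  have E2 : (N2 <= E)%N by rewrite /E !leq_max leqnn !orbT.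
  have [_ b] := HN D E hD (leq_maxl _ _) h hh.
  have a1 := H1 _ E1; have a2 := H2 _ E2 _ xh; have a3 := H2 _ E2 _ dxx.
  rewrite (_ : _ - _ = ((F D (x + h) - F D x - dd D h) -
     (F E (x + h) - F E x - dd E h)) +
    ((F E (x + h) - f (x + h)) - (F E x - f x) - (dd E h - L h))); last by ring.
  apply: le_trans (cabsD _ _) _; apply: lerD b _.
  apply: le_trans (cabs_triB _ _) _.
  have := cabs_triB (F E (x + h) - f (x + h)) (F E x - f x); lra.
(* One fixed member of the sequence suffices for all e: its remainder differs from that of f by a
   multiple of |h|^2, which is below e |h| / 2 for small h. *)
have [N1 HN1] := Lclose _ ltr01.
pose D := N1; have dD := dF D x dxx.
have [B HB] : exists B : R, forall h, cabs (dd D h) <= B * wn h.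
  have : continuous ('d (F D) x) := diff_continuous dD.
  move=> /linear_bounded_continuous/linear_boundedP.
  move=> /pinfty_ex_gt0[_ /rc_gt0P[B B0 ->] HB]; exists B => h.
  by have := HB h; rewrite ddE normE wnE -rcM rc_ler.
apply: (@eps_diff f x LL (B + 16 * 1 / d)).
  move=> h; rewrite LLE.
  have small k : wn k <= d / 8 -> cabs (L k) <= (B + 16 * 1 / d) * wn k.
    move=> hk; have [a _] := HN1 D (leqnn _) k hk.
    rewrite (_ : L k = dd D k - (dd D k - L k)); last by ring.
    by apply: le_trans (cabs_triB _ _) _; rewrite mulrDl lerD.
  have [t t0 th] := lin_small h; have := small _ th.
  by rewrite -!LLE linearZ /= cabsM wnZ mulrCA ler_pM2l// cabs_gt0.
move=> e e0; have e2 : 0 < e / 2 by rewrite divr_gt0.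
have [r r0 Hr] := diff_eps dD e2.
have K0 : 0 < e / 2 / (128 * 1 / d ^+ 2) by rewrite !divr_gt0 ?mulr_gt0// exprn_gt0.
exists (Num.min r (Num.min (d / 8) (e / 2 / (128 * 1 / d ^+ 2)))).
  by rewrite !lt_min r0 d8 K0.
move=> h; rewrite !lt_min => /and3P[h1 h2 h3]; rewrite LLE.
have a := Hr _ h1; rewrite -ddE in a; have [_ b] := HN1 D (leqnn _) h (ltW h2).
rewrite ltr_pdivlMr in h3; last by rewrite divr_gt0 ?mulr_gt0// exprn_gt0.
rewrite (_ : _ - _ = (F D (x + h) - F D x - dd D h) -
   ((F D (x + h) - F D x - dd D h) - (f (x + h) - f x - L h))); last by ring.
apply: le_trans (cabs_triB _ _) _; apply: le_trans (lerD a b) _.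
rewrite expr2 mulrA -mulrDl ler_wpM2r ?wn_ge0//.
by rewrite [X in _ + X]mulrC; lra.
Qed.

End Weierstrass.

(** * Taylor coefficients of entire functions and Liouville's theorem *)

Section Entire.
Variable R : realType.
Local Notation C := (Cplx R).
Implicit Types (f : C -> C) (z w : C).

Definition entire f := forall z, exists l, cderiv f z l.

(** One family serves all radii at once, which is the source of decrease faster than any geometric
    sequence. *)
Definition coefs_of f (c : nat -> C) := forall r M : R, 0 < r ->
  (forall z, cabs z <= 2 * r -> cabs (f z) <= M) ->
  (forall k, cabs (c k) <= 4 * M / r ^+ k) /\
  forall z D, cabs z <= r / 2 ->
     cabs (f z - \sum_(k < D) c k * z ^+ k) <= 8 * M * (cabs z / r) ^+ D.

(** Once the lower coefficients agree, the difference of those of order k is at most 2 K |z| for all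
    small z, hence 0. *)
Lemma taylor_unique f (c c' : nat -> C) (d : R) (K : nat -> R) : 0 < d ->
  (forall z D, cabs z <= d -> cabs (f z - \sum_(k < D) c k * z ^+ k) <= K D * cabs z ^+ D) ->
  (forall z D, cabs z <= d -> cabs (f z - \sum_(k < D) c' k * z ^+ k) <= K D * cabs z ^+ D) ->
  c =1 c'.
Proof.
move=> d0 H H'; elim/ltn_ind => k IH.
apply/eqP; rewrite -subr_eq0; apply/eqP; apply: cabs_small => e e0.
have K0 : 0 < 2 * `|K k.+1| + 1 by rewrite ltr_wpDl ?mulr_ge0.
pose x := Num.min d (e / (2 * `|K k.+1| + 1)).
have x0 : 0 < x by rewrite lt_min d0 divr_gt0.
have ax : cabs (rc x) = x by rewrite cabs_rc gtr0_norm.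
have xd : cabs (rc x) <= d by rewrite ax ge_min lexx.
have := H (rc x) k.+1 xd; have := H' (rc x) k.+1 xd.
rewrite !big_ord_recr /= (eq_bigr (fun i : 'I_k => c i * rc x ^+ i)); last first.
  by move=> i _; rewrite -IH.
set S := \sum_(i < k) _ => h' h.
have hh : cabs ((c k - c' k) * rc x ^+ k) <= 2 * `|K k.+1| * x ^+ k.+1.
  rewrite (_ : _ * _ = (f (rc x) - (S + c' k * rc x ^+ k)) - (f (rc x) - (S + c k * rc x ^+ k))); last by ring.
  apply: le_trans (cabs_triB _ _) _; apply: le_trans (lerD h' h) _.
  rewrite ax -mulrDl ler_wpM2r ?exprn_ge0 ?(ltW x0)//.
  by have := ler_norm (K k.+1); lra.
move: hh; rewrite cabsM cabsX ax exprS mulrA ler_pM2r ?exprn_gt0// => /le_trans; apply.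
apply: le_trans (_ : (2 * `|K k.+1| + 1) * x <= _).
  by rewrite ler_wpM2r ?(ltW x0)// lerDl.
by rewrite mulrC -ler_pdivlMr// ge_min lexx orbT.
Qed.

(** The coefficients found on one disc agree with those on any other by [taylor_unique]. If f is
    bounded on no disc, the property is vacuous and the zero family serves. *)
Lemma entire_coefs f : entire f -> exists c, coefs_of f c.
Proof.
move=> ef.
have [[r0 [M0 [r00 fM0]]]|no] := pselect (exists r M : R, 0 < r /\
   forall z, cabs z <= 2 * r -> cabs (f z) <= M); last first.
  by exists (fun=> 0) => r M r0 fM; case: no; exists r, M.
have [c [cM cr]] := taylor_local r00 (fun z _ => ef z) fM0.
exists c => r M rp fM; have [c' [c'M c'r]] := taylor_local rp (fun z _ => ef z) fM.
suff cc : c' =1 c.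
  split=> [k|z D zr]; first by rewrite -cc.
  by have := c'r z D zr; under eq_bigr do rewrite cc.
have M00 : 0 <= M0.
  by apply: le_trans (cabs_ge0 _) (fM0 0 _); rewrite cabs0 mulr_ge0// ltW.
have M'0 : 0 <= M.
  by apply: le_trans (cabs_ge0 _) (fM 0 _); rewrite cabs0 mulr_ge0// ltW.
pose K D := 8 * M / r ^+ D + 8 * M0 / r0 ^+ D.
have d0 : 0 < Num.min (r / 2) (r0 / 2) by rewrite lt_min !divr_gt0.
have k1 D : 0 <= 8 * M / r ^+ D.
  exact: divr_ge0 (mulr_ge0 (ler0n _ 8) M'0) (exprn_ge0 _ (ltW rp)).
have k2 D : 0 <= 8 * M0 / r0 ^+ D.
  exact: divr_ge0 (mulr_ge0 (ler0n _ 8) M00) (exprn_ge0 _ (ltW r00)).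
apply: (taylor_unique (K := K) d0) => z D; rewrite le_min => /andP[z1 z2].
  apply: le_trans (c'r _ _ z1) _; rewrite expr_div_n mulrCA mulrC.
  by rewrite ler_wpM2r ?exprn_ge0 ?cabs_ge0// /K lerDl.
apply: le_trans (cr _ _ z2) _; rewrite expr_div_n mulrCA mulrC.
by rewrite ler_wpM2r ?exprn_ge0 ?cabs_ge0// /K lerDr.
Qed.

Definition tcoef f : nat -> C := xget (fun=> 0) [set c | coefs_of f c].

Lemma tcoefP f : entire f -> coefs_of f (tcoef f).
Proof. by move=> /entire_coefs[c fc]; apply: (xgetPex (fun=> 0)); exists c. Qed.

Lemma liouville f (M : R) : entire f -> (forall z, cabs (f z) <= M) -> forall z, f z = f 0.
Proof.
move=> ef fM z; apply/eqP; rewrite -subr_eq0; apply/eqP; apply: cabs_small => e e0.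
have M0 : 0 <= M by apply: le_trans (cabs_ge0 _) (fM 0).
(* In the remainder bound 8 M |z| / r for D = 1, the first summand makes z admissible and the second
   brings the bound below e. *)
pose r := 2 * cabs z + 16 * M * cabs z / e + 1.
have q0 : 0 <= 16 * M * cabs z / e by rewrite divr_ge0 ?mulr_ge0 ?cabs_ge0 ?(ltW e0).
have r0 : 0 < r by rewrite ltr_wpDl// addr_ge0// mulr_ge0 ?cabs_ge0.
have [_ H] := tcoefP ef r0 (fun z _ => fM z).
have zr : cabs z <= r / 2 by rewrite ler_pdivlMr// /r; lra.
have h1 := H z 1%N zr; have h0 := H 0 1%N.
rewrite cabs0 mul0r expr1 mulr0 in h0.
have {}h0 := h0 (divr_ge0 (ltW r0) (ler0n _ 2)).
rewrite big_ord1 expr0 in h0; move/cabs_le0/subr0_eq: h0 => h0.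
rewrite big_ord1 expr0 -h0 expr1 in h1; apply: le_trans h1 _.
rewrite mulrA ler_pdivrMr// /r !mulrDr.
have -> : e * (16 * M * cabs z / e) = 16 * M * cabs z by field; rewrite gt_eqF.
have : 0 <= M * cabs z by rewrite mulr_ge0 ?cabs_ge0.
have : 0 <= e * (2 * cabs z) by rewrite !mulr_ge0 ?cabs_ge0 ?(ltW e0).
by rewrite mulr1 -!mulrA; move: (M * cabs z) (e * (2 * cabs z)) => p q; lra.
Qed.

Lemma entire_differentiable f z : entire f -> differentiable (f : C -> C) (z : C).
Proof. by move=> /(_ z)[l /cderiv_derivable]; move/derivable1_diffP. Qed.

Lemma differentiable_entire f : (forall z : C, differentiable (f : C -> C) (z : C)) -> entire f.
Proof. by move=> df z; apply: derivable_cderiv; apply/derivable1_diffP. Qed.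

Lemma cderiv_sum (J : Type) (s : seq J) (F : J -> C -> C) y :
  (forall q, exists m, cderiv (F q) y m) ->
  exists m, cderiv (fun w => \sum_(q <- s) F q w) y m.
Proof.
move=> dF; elim: s => [|j s [m dm]].
  exists 0; rewrite (_ : (fun _ => _) = (fun=> 0)); first exact: cderiv_cst.
  by apply/funext => v; rewrite big_nil.
have [l dl] := dF j; exists (l + m).
rewrite (_ : (fun _ => _) = (fun w => F j w + \sum_(q <- s) F q w)).
  exact: cderivD.
by apply/funext => v; rewrite big_cons.
Qed.

(** No integral is differentiated: the coefficient of order k is the locally uniform limit, as t
    tends to 0, of F w t minus its Taylor polynomial of degree below k, divided by t^k. These
    quotients are holomorphic in w by induction on k. *)
Lemma tcoef_param (F : C -> C -> C) : (forall t, entire (F^~ t)) -> (forall w, entire (F w)) ->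
  (forall w, exists d M : R, 0 < d /\ forall w' t, cabs (w' - w) < d -> cabs t <= 4 ->
       cabs (F w' t) <= M) ->
  forall k, entire (fun w => tcoef (F w) k).
Proof.
move=> eF1 eF2 bF; elim/ltn_ind => k IH; apply: differentiable_entire => w.
have [d [M [d0 FM]]] := bF w.
(* All these t satisfy |t| <= 1 = r / 2 for the radius r = 2, whose coefficient bounds use F on |t|
   <= 4; this is the 4 in the hypothesis. *)
pose tN (N : nat) : C := rc (2^-1 ^+ N).
have tN0 N : tN N != 0.
  by rewrite /tN -cabs_gt0 cabs_rc gtr0_norm exprn_gt0// invr_gt0.
pose A N w := (F w (tN N) - \sum_(q < k) tcoef (F w) q * tN N ^+ q) * (tN N ^- k).
have wnC (x : C) : wn (x : C) = cabs x by apply: rc_inj; rewrite -wnE normE.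
apply: (@weierstrass _ _ A _ w d d0).
  move=> N y _; apply: entire_differentiable => {}y.
  have [l dl] := eF1 (tN N) y.
  suff [l' dl'] : exists l', cderiv (fun w => F w (tN N) + \sum_(q < k) tcoef (F w) q * (- tN N ^+ q)) y l'.
    exists ((F y (tN N) + \sum_(q < k) tcoef (F y) q * (- tN N ^+ q)) * 0 + tN N ^- k * l').
    have := cderivM dl' (cderiv_cst (tN N ^- k) y).
    congr cderiv; apply/funext => v; rewrite /A; congr ((_ + _) * _).
    by rewrite -sumrN; apply: eq_bigr => q _; rewrite mulrN.
  suff [m dm] : exists m, cderiv (fun w => \sum_(q < k) tcoef (F w) q * (- tN N ^+ q)) y m.
    by exists (l + m); exact: cderivD dl dm.
  apply: cderiv_sum => q; have [m' dm'] := IH _ (ltn_ord q) y.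
  eexists; exact: cderivM dm' (cderiv_cst (- tN N ^+ q) y).
move=> e e0; have M0 : 0 <= M.
  by apply: le_trans (cabs_ge0 _) (FM w 0 _ _); rewrite ?subrr ?cabs0.
have [N HN] := @pow2_small _ (e / (8 * M + 1)) (divr_gt0 e0 (ltr_wpDl (mulr_ge0 (ler0n _ 8) M0) ltr01)).
exists N => D ND y; rewrite wnC => yw.
have FM4 z : cabs z <= 2 * 2 -> cabs (F y z) <= M by move=> hz; apply: FM => //; lra.
have [_ H] := tcoefP (eF2 y) (ltr0n _ 2) FM4.
have tD : cabs (tN D) = 2^-1 ^+ D by rewrite cabs_rc gtr0_norm// exprn_gt0// invr_gt0.
have tD1 : 2^-1 ^+ D <= 1 :> R by rewrite exprn_ile1// ?invr_ge0// invf_le1// ler1n.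
have := H (tN D) k.+1; rewrite tD divff// => /(_ tD1); rewrite big_ord_recr /=.
have -> : A D y - tcoef (F y) k = (F y (tN D) -
   (\sum_(i < k) tcoef (F y) i * tN D ^+ i + tcoef (F y) k * tN D ^+ k)) * tN D ^- k.
  by rewrite opprD addrA mulrBl mulfK ?expf_neq0.
rewrite cabsM cabsV cabsX tD => H'.
rewrite ler_pdivrMr ?exprn_gt0 ?invr_gt0//; apply: le_trans H' _.
rewrite expr_div_n -mulrA [X in _ <= X](_ : _ = e * (2^-1 ^+ D) ^+ k); last by [].
have p0 : 0 < (2^-1 ^+ D : R) by rewrite exprn_gt0// invr_gt0.
apply: le_trans (_ : 8 * M * (2^-1 ^+ D) ^+ k.+1 <= _).
  rewrite -mulrA; apply: ler_wpM2l => //; apply: ler_wpM2l => //.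
  by rewrite ler_piMr ?exprn_ge0 ?(ltW p0)// invf_le1 ?exprn_gt0// exprn_ege1// ler1n.
rewrite exprS mulrA ler_wpM2r ?exprn_ge0 ?(ltW p0)//.
have DN : 2^-1 ^+ D <= 2^-1 ^+ N :> R.
  by rewrite ler_wiXn2l ?invr_ge0// invf_le1// ler1n.
have {}HN : 2^-1 ^+ D * (8 * M + 1) < e.
  by rewrite -ltr_pdivlMr ?ltr_wpDl ?mulr_ge0//; exact: le_lt_trans DN HN.
apply: ltW; apply: le_lt_trans HN; rewrite mulrC ler_wpM2l ?(ltW p0)//.
by rewrite lerDl.
Qed.

End Entire.

(** * Entire functions of several variables *)

Section SeveralVariables.
Variable R : realType.
Local Notation C := (Cplx R).
Variable I : finType.
Implicit Types (z : I -> C) (F : (I -> C) -> C).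

Definition upd (T : Type) (z : I -> T) i t : I -> T := fun j => if j == i then t else z j.

Lemma updK (T : Type) (z : I -> T) i : upd z i (z i) = z.
Proof. by apply/funext => j; rewrite /upd; case: eqP => [->|]. Qed.

Lemma updd (T : Type) (z : I -> T) i s t : upd (upd z i s) i t = upd z i t.
Proof. by apply/funext => j; rewrite /upd; case: eqP. Qed.

Lemma updC (T : Type) (z : I -> T) i j s t : i != j ->
  upd (upd z i s) j t = upd (upd z j t) i s.
Proof.
move=> ij; apply/funext => k; rewrite /upd; have [->|//] := eqVneq k j.
by rewrite eq_sym (negPf ij).
Qed.

(** Bounds on polydiscs are included so that the one-variable Cauchy estimates can be iterated with
    constants independent of the other variables. *)
Definition separately_entire F := (forall z i, entire (fun t => F (upd z i t))) /\
  (forall p : R, exists M : R, forall z, (forall i, cabs (z i) <= p) -> cabs (F z) <= M).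

Definition cof i k F : (I -> C) -> C := fun z => tcoef (fun t => F (upd z i t)) k.

Definition indep i F := forall z t, F (upd z i t) = F z.

Lemma cof_indep i k F : indep i (cof i k F).
Proof. by move=> z t; rewrite /cof; under [in LHS]eq_fun do rewrite updd. Qed.

Lemma cof_indepW i j k F : indep j F -> indep j (cof i k F).
Proof.
move=> iF; have [->|ij] := eqVneq j i; first exact: cof_indep.
by move=> z t; rewrite /cof; under [in LHS]eq_fun do rewrite updC// iF.
Qed.

Lemma cof_bound i k F (p M : R) z : separately_entire F -> 0 < p ->
  (forall z, (forall i, cabs (z i) <= p) -> cabs (F z) <= M) ->
  (forall j, cabs (z j) <= p) -> cabs (cof i k F z) <= 4 * M / (p / 2) ^+ k.
Proof.
move=> [eF _] p0 FM zp; have p2 : 0 < p / 2 by rewrite divr_gt0.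
have FM' t : cabs t <= 2 * (p / 2) -> cabs (F (upd z i t)) <= M.
  move=> tp; apply: FM => j; rewrite /upd; case: eqP => // _.
  by apply: le_trans tp _; rewrite mulrC divfK.
by have [H _] := tcoefP (eF z i) p2 FM'; exact: H.
Qed.

Lemma cof_sep i k F : separately_entire F -> separately_entire (cof i k F).
Proof.
move=> sF; have [eF bF] := sF; split.
  move=> z j; have [->|ij] := eqVneq j i.
    move=> t; exists 0; have := cderiv_cst (cof i k F z) t.
    by congr cderiv; apply/funext => s; rewrite cof_indep.
  have := @tcoef_param R (fun w t => F (upd (upd z j w) i t)).
  apply=> [t|w|w].
  - have := eF (upd z i t) j.
    by congr entire; apply/funext => w; rewrite updC// eq_sym.
  - exact: eF.
  - pose p := \sum_l cabs (z l) + cabs w + 5.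
    have [M HM] := bF p; exists 1, M; split => // w' t ww t4; apply: HM => l.
    have s0 : 0 <= \sum_l cabs (z l) by apply: sumr_ge0 => q _; exact: cabs_ge0.
    have w0 := cabs_ge0 w; rewrite /upd /p; case: eqP => _; first by lra.
    case: eqP => _.
      have := cabsD (w' - w) w; rewrite subrK; lra.
    rewrite (bigD1 l)//=.
    have : 0 <= \sum_(q | q != l) cabs (z q) by apply: sumr_ge0 => q _; exact: cabs_ge0.
    by move: (\sum_(q | q != l) cabs (z q)) (cabs (z l)) => u v; lra.
move=> p; have q0 : 0 < `|p| + 1 by rewrite ltr_wpDl.
have [M HM] := bF (`|p| + 1).
exists (4 * M / ((`|p| + 1) / 2) ^+ k) => z zp; apply: cof_bound => // j.
by apply: le_trans (zp j) _; have := ler_norm p; lra.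
Qed.

Fixpoint coefS (s : seq I) F (a : I -> nat) : C :=
  if s is i :: s' then coefS s' (cof i (a i) F) a else F (fun=> 0).

Fixpoint polyS (s : seq I) (D : nat) F z : C :=
  if s is i :: s' then \sum_(k < D) z i ^+ k * polyS s' D (cof i k F) z
  else F (fun=> 0).

(** Per variable: 8 from the one-variable remainder, and in front of the error in the remaining
    variables 4 from the Cauchy estimate times 2 from a geometric series. *)
Fixpoint Kpoly (m : nat) : R := if m is j.+1 then 8 + 8 * Kpoly j else 0.

Lemma Kpoly_ge0 m : 0 <= Kpoly m.
Proof. by elim: m => //= m IH; rewrite addr_ge0// mulr_ge0. Qed.

Lemma geo_sum2 D : \sum_(k < D) (2^-1 : R) ^+ k <= 2.
Proof.
have : \sum_(k < D) (2^-1 : R) ^+ k = 2 - 2 * 2^-1 ^+ D.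
  by elim: D => [|D IH]; [rewrite big_ord0 expr0; ring|rewrite big_ord_recr /= IH exprS; field].
by move=> ->; rewrite gerBl mulr_ge0// exprn_ge0// invr_ge0.
Qed.

(** The points are made equal one coordinate at a time; the list [l] holds the coordinates that may
    still differ. *)
Lemma indep_eq (s : seq I) F : (forall j, j \notin s -> indep j F) ->
  forall z w, (forall i, i \in s -> z i = w i) -> F z = F w.
Proof.
move=> iF.
have H (l : seq I) z w : (forall i, i \notin l -> z i = w i) ->
   (forall i, i \in s -> z i = w i) -> F z = F w.
  elim: l z w => [|j l IH] z w h1 h2.
    by congr F; apply/funext => i; exact: h1.
  have [js|js] := boolP (j \in s).
    apply: IH => // i il; have [->|ij] := eqVneq i j; first exact: h2.
    by apply: h1; rewrite inE negb_or ij.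
  rewrite -(iF j js z (w j)); apply: IH => i il; rewrite /upd; case: eqP => [->//|/eqP ij].
    by apply: h1; rewrite inE negb_or ij.
  exact: h2.
by move=> z w; apply: (H (index_enum I)) => i; rewrite mem_index_enum.
Qed.

Lemma polyS_err (s : seq I) F (p M : R) D z : separately_entire F -> 0 < p ->
  (forall j, j \notin s -> indep j F) ->
  (forall z, (forall i, cabs (z i) <= p) -> cabs (F z) <= M) ->
  (forall i, cabs (z i) <= p / 4) ->
  cabs (F z - polyS s D F z) <= Kpoly (size s) * M * 2^-1 ^+ D.
Proof.
move=> + p0; elim: s F M => [|i s IH] F M sF iF FM zp /=.
  rewrite (@indep_eq [::] F _ z (fun=> 0))// subrr cabs0.
  by rewrite !mul0r.
have [eF _] := sF; have p2 : 0 < p / 2 by rewrite divr_gt0.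
have zp' j : cabs (z j) <= p by apply: le_trans (zp j) _; lra.
have M0 : 0 <= M by apply: le_trans (cabs_ge0 _) (FM z zp').
have FM' t : cabs t <= 2 * (p / 2) -> cabs (F (upd z i t)) <= M.
  move=> tp; apply: FM => j; rewrite /upd; case: eqP => // _.
  by apply: le_trans tp _; rewrite mulrC divfK.
have [_ H] := tcoefP (eF z i) p2 FM'.
have zi2 : cabs (z i) <= p / 2 / 2 by have := zp i; lra.
have := H (z i) D zi2; rewrite updK => {}H.
set S := \sum_(k < D) _ in H *; set T := \sum_(k < D) _.
(* This is the reason for p / 4: against the Cauchy estimate with radius p / 2 the powers of z_i
   form a geometric series of ratio 1/2. *)
have q1 : cabs (z i) / (p / 2) <= 2^-1 by rewrite ler_pdivrMr//; lra.
have q0 : 0 <= cabs (z i) / (p / 2) by rewrite divr_ge0 ?cabs_ge0 ?(ltW p2).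
rewrite (_ : F z - T = (F z - S) + (S - T)); last by ring.
apply: le_trans (cabsD _ _) _.
have -> : (8 + 8 * Kpoly (size s)) * M * 2^-1 ^+ D =
  8 * M * 2^-1 ^+ D + 8 * Kpoly (size s) * M * 2^-1 ^+ D by ring.
apply: lerD.
  apply: le_trans H _; apply: ler_wpM2l; first exact: mulr_ge0.
  by apply: lerXn2r; rewrite ?nnegrE// invr_ge0.
rewrite -sumrB; apply: le_trans (cabs_sum _ _ _) _.
apply: le_trans (_ : \sum_(k < D) (2^-1 ^+ k) * (Kpoly (size s) * (4 * M) * 2^-1 ^+ D) <= _).
  apply: ler_sum => k _.
  rewrite [_ * z i ^+ k]mulrC -mulrBr cabsM cabsX.
  apply: le_trans (_ : cabs (z i) ^+ k * (Kpoly (size s) * (4 * M / (p / 2) ^+ k) * 2^-1 ^+ D) <= _).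
    apply: ler_wpM2l; first by rewrite exprn_ge0 ?cabs_ge0.
    apply: IH => //; first exact: cof_sep.
      move=> j js; have [->|ij] := eqVneq j i; first exact: cof_indep.
      by apply: cof_indepW; apply: iF; rewrite inE negb_or ij.
    by move=> w wp; exact: (cof_bound _ _ sF p0 FM wp).
  rewrite (_ : cabs (z i) ^+ k * _ = (cabs (z i) / (p / 2)) ^+ k * (Kpoly (size s) * (4 * M) * 2^-1 ^+ D)); last first.
    by rewrite [(_ / (p / 2)) ^+ k]expr_div_n; move: ((p / 2) ^+ k) (cabs (z i) ^+ k) (2^-1 ^+ D) => u v w; ring.
  apply: ler_wpM2r.
    by rewrite !mulr_ge0 ?Kpoly_ge0 ?exprn_ge0 ?invr_ge0.
  by apply: lerXn2r; rewrite ?nnegrE// invr_ge0.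
rewrite -mulr_suml; apply: le_trans (ler_wpM2r _ (geo_sum2 D)) _.
  by rewrite !mulr_ge0 ?Kpoly_ge0 ?exprn_ge0 ?invr_ge0.
by rewrite le_eqVlt; apply/orP; left; apply/eqP; ring.
Qed.

Lemma coefS_bound (s : seq I) F (p M : R) a : separately_entire F -> 0 < p ->
  (forall z, (forall i, cabs (z i) <= p) -> cabs (F z) <= M) ->
  cabs (coefS s F a) <= 4 ^+ size s * M / (p / 2) ^+ (\sum_(i <- s) a i).
Proof.
move=> + p0; elim: s F M => [|i s IH] F M sF FM /=.
  by rewrite big_nil !expr0 mul1r divr1; apply: FM => j; rewrite cabs0 ltW.
apply: le_trans (IH _ (4 * M / (p / 2) ^+ a i) (cof_sep _ _ sF) _) _.
  by move=> w wp; exact: (cof_bound _ _ sF p0 FM wp).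
rewrite big_cons exprD exprS invfM le_eqVlt; apply/orP; left; apply/eqP; ring.
Qed.

Lemma coefS_ext (s : seq I) F (a b : I -> nat) : {in s, a =1 b} -> coefS s F a = coefS s F b.
Proof.
elim: s F => //= i s IH F ab; rewrite (ab i) ?mem_head//; apply: IH => j js.
by apply: ab; rewrite inE js orbT.
Qed.

(** Partial sums run over cubes of exponents, because nested one-variable Taylor polynomials produce
    exactly these, see [polyS_sum]. *)
Definition box (D : nat) := {ffun I -> 'I_D.+1}.
Definition boxi D (a : box D) : I -> nat := fun i => a i.

Definition bsum (D : nat) (b : (I -> nat) -> C) : C := \sum_(a : box D) b (boxi a).

Lemma polyS_sum (s : seq I) D F z : uniq s -> polyS s D.+1 F z =
  \sum_(a : box D | [forall i, (i \notin s) ==> (a i == ord0)])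
    coefS s F (boxi a) * \prod_(i <- s) z i ^+ a i.
Proof.
elim: s F => [|i s IH] F /=.
  move=> _; rewrite (big_pred1 [ffun=> ord0]).
    by rewrite big_nil mulr1.
  move=> a; apply/forallP/eqP => [h|-> j]; last by rewrite ffunE.
  by apply/ffunP => j; rewrite ffunE; apply/eqP/h.
move=> /andP[iNs us].
rewrite (partition_big (fun a : box D => a i) xpredT)//=; apply: eq_bigr => k _.
rewrite IH// mulr_sumr.
(* Changing the exponent at i matches the boxes with exponent k there with those with exponent 0,
   over which the induction hypothesis sums. *)
pose ins (a : box D) (l : 'I_D.+1) : box D := [ffun j => if j == i then l else a j].
rewrite [RHS](reindex_onto (ins^~ k) (ins^~ ord0)) /=; last first.
  move=> a /andP[_ /eqP <-]; apply/ffunP => j; rewrite !ffunE.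
  by case: eqP => [->|].
apply: eq_big => [a|a /forallP ha].
  apply/forallP/andP => [h|[/andP[/forallP h _] /eqP aE] j].
    split; last first.
      apply/eqP/ffunP => j; rewrite !ffunE; case: eqP => [->|//].
      by have /eqP := implyP (h i) iNs.
    apply/andP; split; last by rewrite ffunE eqxx.
    apply/forallP => j; apply/implyP; rewrite inE negb_or ffunE => /andP[/negPf -> js].
    by have := implyP (h j) js.
  apply/implyP => js; have [->|ji] := eqVneq j i.
    by rewrite -aE !ffunE eqxx.
  by have := implyP (h j); rewrite inE negb_or ji js ffunE (negPf ji); exact.
rewrite big_cons ffunE eqxx mulrCA; congr (_ * (_ * _)).
  rewrite /boxi ffunE eqxx; apply: coefS_ext => j js; rewrite ffunE.
  by case: eqP => // ji; rewrite -ji js in iNs.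
rewrite !big_seq; apply: eq_bigr => j js; rewrite ffunE.
by case: eqP => // ji; rewrite -ji js in iNs.
Qed.

Lemma size_index_enum : size (index_enum I) = #|I|.
Proof. by rewrite cardT enumT. Qed.

Definition mcoef F (a : I -> nat) : C := coefS (index_enum I) F a.
Definition msize (a : I -> nat) : nat := \sum_i a i.

Lemma mcoef_bound F (p M : R) a : separately_entire F -> 0 < p ->
  (forall z, (forall i, cabs (z i) <= p) -> cabs (F z) <= M) ->
  cabs (mcoef F a) <= 4 ^+ #|I| * M / (p / 2) ^+ msize a.
Proof.
by move=> sF p0 FM; have := coefS_bound (index_enum I) a sF p0 FM; rewrite size_index_enum.
Qed.

Lemma mtaylor F (p M : R) D z : separately_entire F -> 0 < p ->
  (forall z, (forall i, cabs (z i) <= p) -> cabs (F z) <= M) ->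
  (forall i, cabs (z i) <= p / 4) ->
  cabs (F z - bsum D (fun a => mcoef F a * \prod_i z i ^+ a i)) <= Kpoly #|I| * M * 2^-1 ^+ D.
Proof.
move=> sF p0 FM zp.
have M0 : 0 <= M.
  by apply: le_trans (cabs_ge0 _) (FM z _) => i; apply: le_trans (zp i) _; lra.
have -> : bsum D (fun a => mcoef F a * \prod_i z i ^+ a i) = polyS (index_enum I) D.+1 F z.
  rewrite polyS_sum ?index_enum_uniq//; apply: eq_bigl => a.
    by apply/esym/forallP => i; rewrite mem_index_enum.
have iF j : j \notin index_enum I -> indep j F by rewrite mem_index_enum.
have H := polyS_err D.+1 sF p0 iF FM zp; apply: le_trans H _.
rewrite size_index_enum; apply: ler_wpM2l; first by rewrite mulr_ge0 ?Kpoly_ge0.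
by rewrite exprS ler_piMl ?exprn_ge0 ?invr_ge0// invf_le1// ler1n.
Qed.

End SeveralVariables.

(** * Sums over boxes of exponents *)

Section BoxSums.
Variable R : realType.
Local Notation C := (Cplx R).
Variable I : finType.
Implicit Types (a : I -> nat) (b : (I -> nat) -> C).

Lemma bsumD D b b' : bsum D (fun a => b a + b' a) = bsum D b + bsum D b' :> C.
Proof. by rewrite /bsum big_split. Qed.

Lemma bsumZ D (k : C) b : bsum D (fun a => k * b a) = k * bsum D b.
Proof. by rewrite /bsum mulr_sumr. Qed.

Lemma eq_bsum D b b' : b =1 b' -> bsum D b = bsum D b' :> C.
Proof. by move=> bb; apply: eq_bigr => a _; exact: bb. Qed.

Lemma box_geo (D : nat) : \sum_(a : box I D) (2^-1 : R) ^+ msize (boxi a) <= 2 ^+ #|I|.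
Proof.
under eq_bigr do rewrite /msize -prodrXr.
rewrite -(bigA_distr_bigA (fun (i : I) (k : 'I_D.+1) => (2^-1 : R) ^+ k)) /=.
rewrite -[leRHS]mulr1 -iter_mulr -big_const.
apply: ler_prod => i _; rewrite geo_sum2 andbT.
by apply: sumr_ge0 => k _; rewrite exprn_ge0// invr_ge0.
Qed.

Lemma bsum_le D b (M : R) (e : R) : 0 <= M -> 0 <= e <= 2^-1 ->
  (forall a, cabs (b a) <= M * e ^+ msize a) -> cabs (bsum D b) <= 2 ^+ #|I| * M.
Proof.
move=> M0 /andP[e0 e1] bM; apply: le_trans (cabs_sum _ _ _) _.
apply: le_trans (_ : \sum_(a : box I D) M * 2^-1 ^+ msize (boxi a) <= _).
  apply: ler_sum => a _; apply: le_trans (bM _) _; apply: ler_wpM2l => //.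
  by apply: lerXn2r; rewrite ?nnegrE// invr_ge0.
by rewrite -mulr_sumr mulrC ler_wpM2r// box_geo.
Qed.

Definition inbox (D : nat) (a : I -> nat) := [forall i, (a i <= D)%N].

Lemma bsum_restrict D D' b : (D <= D')%N ->
  bsum D b = \sum_(a : box I D' | inbox D (boxi a)) b (boxi a).
Proof.
move=> DD; have le1 : (D.+1 <= D'.+1)%N by [].
pose h (a : box I D) : box I D' := [ffun i => widen_ord le1 (a i)].
pose h' (a : box I D') : box I D := [ffun i => inord (a i)].
rewrite [RHS](reindex_onto h h') /=; last first.
  move=> a /forallP ha; apply/ffunP => i; rewrite !ffunE; apply/val_inj => /=.
  by rewrite inordK// ltnS; exact: ha.
rewrite /bsum; apply: eq_big => [a|a _].
  apply/esym/andP; split.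
    by apply/forallP => i; rewrite /boxi ffunE /= -ltnS.
  by apply/eqP/ffunP => i; rewrite !ffunE; apply/val_inj; rewrite /= inordK.
by congr b; apply/funext => i; rewrite /boxi ffunE.
Qed.

Lemma notin_box D a : ~~ inbox D a -> (D < msize a)%N.
Proof.
rewrite negb_forall; case/fintype.existsP => i; rewrite -ltnNge => Di; apply: leq_trans Di _.
by rewrite /msize (bigD1 i)//= leq_addr.
Qed.

(** An exponent outside the smaller box has |a| > D, so 4^-|a| <= 2^-D 2^-|a|, and the last factor
    is summed by [box_geo]. *)
Lemma bsum_diff D D' b (M : R) : 0 <= M -> (D <= D')%N ->
  (forall a, cabs (b a) <= M * 4^-1 ^+ msize a) ->
  cabs (bsum D' b - bsum D b) <= 2 ^+ #|I| * M * 2^-1 ^+ D.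
Proof.
move=> M0 DD bM; rewrite (bsum_restrict _ DD) {1}/bsum (bigID (fun a : box I D' => inbox D (boxi a)))/=.
rewrite addrAC subrr add0r; apply: le_trans (cabs_sum _ _ _) _.
apply: le_trans (_ : \sum_(a : box I D') M * 2^-1 ^+ D * 2^-1 ^+ msize (boxi a) <= _).
  rewrite [leRHS](bigID (fun a : box I D' => inbox D (boxi a)))/= ler_wpDl//.
    by apply: sumr_ge0 => a _; rewrite !mulr_ge0 ?exprn_ge0 ?invr_ge0.
  apply: ler_sum => a /notin_box/ltnW Da; apply: le_trans (bM _) _.
  rewrite -mulrA; apply: ler_wpM2l => //.
  have -> : 4^-1 = 2^-1 * 2^-1 :> R by field.
  rewrite exprMn; apply: ler_wpM2r; first by rewrite exprn_ge0// invr_ge0.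
  by rewrite ler_wiXn2l ?invr_ge0// invf_le1// ler1n.
rewrite -mulr_sumr mulrC -mulrA; apply: ler_wpM2r (box_geo D').
by rewrite mulr_ge0// exprn_ge0// invr_ge0.
Qed.

End BoxSums.

Local Open Scope quotient_scope.

(** * Expansion of holomorphic functions on the complexified reduced space *)

Section Lift.
Variable R : realType.
Local Notation C := (Cplx R).

Lemma diff_near (W : normedModType C) (f g : W -> C) (x : W) :
  (\forall y \near x, f y = g y) -> differentiable f x -> differentiable g x.
Proof.
move=> /nbhs_wn[r r0 fg] df.
have [B HB] : exists B : R, forall h, cabs ('d f x h) <= B * wn h.
  have : continuous ('d f x) := diff_continuous df.
  move=> /linear_bounded_continuous/linear_boundedP.
  move=> /pinfty_ex_gt0[_ /rc_gt0P[B B0 ->] HB]; exists B => h.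
  by have := HB h; rewrite normE wnE -rcM rc_ler.
apply: (@eps_diff _ _ g x ('d f x) B HB) => e e0.
have [d d0 H] := diff_eps df e0; exists (Num.min d r); first by rewrite lt_min d0.
move=> h; rewrite lt_min => /andP[hd hr].
by rewrite -!fg ?subrr ?wn0//; [exact: H|rewrite addrAC subrr add0r].
Qed.

Lemma diff_row (W : normedModType C) (m : nat) (f : 'I_m -> W -> C) (x : W) :
  (forall l, differentiable (f l) x) ->
  differentiable (fun y => \row_l f l y : 'rV[C]_m) x.
Proof.
move=> df; rewrite (_ : (fun _ => _) = \sum_(l < m) (fun y => f l y *: (delta_mx 0 l : 'rV[C]_m))).
  by apply: differentiable_sum => l; exact: differentiableZl.
apply/funext => y; rewrite fct_sumE; apply/rowP => l; rewrite !mxE summxE (bigD1 l)//=.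
rewrite !mxE !eqxx mulr1 big1 ?addr0// => k kl.
by rewrite !mxE eq_sym (negPf kl) andbF mulr0.
Qed.

Lemma diff_entry1 (m1 m2 : nat) k (x : 'rV[C]_m1 * 'rV[C]_m2) :
  differentiable (fun y : 'rV[C]_m1 * 'rV[C]_m2 => y.1 0 k : C) x.
Proof.
apply: (@differentiable_comp _ _ _ _ fst (fun N : 'rV[C]_m1 => N 0 k : C)).
  exact: diff_fst.
exact: differentiable_coord.
Qed.

Lemma diff_entry2 (m1 m2 : nat) k (x : 'rV[C]_m1 * 'rV[C]_m2) :
  differentiable (fun y : 'rV[C]_m1 * 'rV[C]_m2 => y.2 0 k : C) x.
Proof.
apply: (@differentiable_comp _ _ _ _ snd (fun N : 'rV[C]_m2 => N 0 k : C)).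
  exact: diff_snd.
exact: differentiable_coord.
Qed.

Lemma diff_mul (W : normedModType C) (f g : W -> C) (x : W) :
  differentiable f x -> differentiable g x -> differentiable (fun y => f y * g y) x.
Proof. exact: differentiableM. Qed.

Lemma diff_scale (W : normedModType C) (f : W -> C) (k : C) (x : W) :
  differentiable f x -> differentiable (fun y => k * f y) x.
Proof. by move=> df; apply: diff_mul => //; exact: differentiable_cst. Qed.

Lemma diff_add (W : normedModType C) (f g : W -> C) (x : W) :
  differentiable f x -> differentiable g x -> differentiable (fun y => f y + g y) x.
Proof. exact: differentiableD. Qed.

Lemma diff_bigsum (J : Type) (r : seq J) (W : normedModType C) (f : J -> W -> C) (x : W) :
  (forall j, differentiable (f j) x) -> differentiable (fun y => \sum_(j <- r) f j y) x.
Proof.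
move=> df; elim: r => [|j r IH].
  rewrite (_ : (fun _ => _) = cst 0); first exact: differentiable_cst.
  by apply/funext => y; rewrite big_nil.
rewrite (_ : (fun _ => _) = (fun y => f j y + \sum_(k <- r) f k y)); first exact: diff_add.
by apply/funext => y; rewrite big_cons.
Qed.

Variables n s : nat.
Local Notation V := 'rV[C]_n.+1.
Local Notation Mh := (Mhat R n s).
Implicit Types (g : Mh -> C) (p : V * V).

(* g as a homogeneous function of degree 0 on {Jhat <> 0}, with the junk value
   0 outside. *)
Definition hlift g p : C :=
  if insub ((Jhat s p)^-1 *: p.1, p.2) is Some q then g (\pi_Mh (q : Zhat s)) else 0.

Lemma in_chartE g i j x : in_chart g i j x = hlift g (affine i x.1, affine j x.2).
Proof. by []. Qed.

Lemma JhatZ (a b : C) (u v : V) : Jhat s (a *: u, b *: v) = a * b * Jhat s (u, v).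
Proof.
rewrite /Jhat mulr_sumr; apply: eq_bigr => k _; rewrite /= !mxE; ring.
Qed.

Lemma Jhat_normalized p : Jhat s p != 0 -> Jhat s ((Jhat s p)^-1 *: p.1, p.2) = 1.
Proof.
by move=> p0; rewrite -[p.2]scale1r JhatZ mulr1; case: p p0 => u v /= p0; rewrite mulVf.
Qed.

Definition pim p (hp : Jhat s p = 1) : Mh :=
  \pi_Mh (exist (fun q => q \in Zhat s) p (mem_set hp) : Zhat s).

Lemma pim_repr (x : Mh) : exists p (hp : Jhat s p = 1), x = pim hp /\ p = val (repr x : Zhat s).
Proof.
have hp : Jhat s (val (repr x : Zhat s)) = 1 by exact: (set_mem (valP (repr x : Zhat s))).
exists (val (repr x : Zhat s)), hp; split => //.
rewrite /pim -[LHS]reprK; congr (\pi_Mh _); exact: val_inj.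
Qed.

Lemma pim_eq p q (hp : Jhat s p = 1) (hq : Jhat s q = 1) (a : C) : a != 0 ->
  q = (a *: p.1, a^-1 *: p.2) -> pim hp = pim hq.
Proof.
move=> a0 qE; rewrite /pim; apply/eqmodP => /=.
by apply/asboolP; exists a.
Qed.

Lemma hliftE g p (p0 : Jhat s p != 0) : hlift g p = g (pim (Jhat_normalized p0)).
Proof.
rewrite /hlift insubT; first exact/mem_set/Jhat_normalized.
move=> h; rewrite /pim; congr (g (\pi_Mh _)); exact: val_inj.
Qed.

Lemma hlift0 g p : Jhat s p = 0 -> hlift g p = 0.
Proof.
move=> p0; rewrite /hlift insubF//; apply/negP => /set_mem; rewrite /Zhat /= p0 invr0.
by rewrite -[p.2]scale1r JhatZ !mul0r => /eqP; rewrite eq_sym oner_eq0.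
Qed.

Lemma hlift_pim g p (hp : Jhat s p = 1) : hlift g p = g (pim hp).
Proof.
have p0 : Jhat s p != 0 by rewrite hp oner_eq0.
rewrite hliftE; congr g; apply/esym/(@pim_eq _ _ _ _ 1); first exact: oner_neq0.
by rewrite hp invr1 !scale1r.
Qed.

Lemma hlift_scale g p (a b : C) : a != 0 -> b != 0 -> hlift g (a *: p.1, b *: p.2) = hlift g p.
Proof.
case: p => u v a0 b0 /=; have [p0|p0] := eqVneq (Jhat s (u, v)) 0.
  by rewrite !hlift0// JhatZ p0 mulr0.
have q0 : Jhat s (a *: u, b *: v) != 0 by rewrite JhatZ !mulf_neq0.
rewrite (hliftE _ p0) (hliftE _ q0); congr g; apply/esym/(@pim_eq _ _ _ _ b^-1).
  by rewrite invr_eq0.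
rewrite /= invrK JhatZ !scalerA; congr (_ *: _, _).
by rewrite !invfM mulrAC -mulrA [a * _]mulrC; field; rewrite a0 b0 p0.
Qed.

Lemma affine_proj (i : 'I_n.+1) (v : V) : v 0 i != 0 ->
  affine i (\row_l (v 0 (lift i l) / v 0 i)) = (v 0 i)^-1 *: v.
Proof.
move=> vi; apply/rowP => k; rewrite !mxE; case: unliftP => [l ->|->] /=.
  by rewrite !mxE mulrC.
by rewrite mulVf.
Qed.

Lemma diff_Jhat p : differentiable (fun q : V * V => Jhat s q) p.
Proof.
apply: diff_bigsum => k; apply: diff_mul; last exact: diff_entry2.
by apply: diff_scale; exact: diff_entry1.
Qed.

Lemma near_neq0 (W : normedModType C) (f : W -> C) (x : W) : differentiable f x ->
  f x != 0 -> \forall y \near x, f y != 0.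
Proof.
move=> /differentiable_continuous cf fx; apply: (cf [set z | z != 0]).
apply/nbhs_wn; exists (cabs (f x)); first by rewrite cabs_gt0.
move=> z zc; apply/eqP => z0; move: zc.
by rewrite z0 sub0r wnN /wn normE cabs_rc ger0_norm ?cabs_ge0// ltxx.
Qed.

(** Near p the lift is a chart function composed with the projection to affine coordinates, because
    it is homogeneous of degree 0 in xi and in eta separately. *)
Lemma hlift_diff g p : holomorphic g -> Jhat s p != 0 -> differentiable (hlift g) p.
Proof.
move=> hg p0.
have ex (u : V) : u != 0 -> exists i, u 0 i != 0.
  by move=> u0; apply: contrapT => /forallNP h; move/eqP: u0; apply; apply/rowP => i;
    rewrite mxE; have /negP := h i; rewrite negbK => /eqP.
have [i pi] : exists i, p.1 0 i != 0.
  apply: ex; apply/eqP => z; move/eqP: p0; apply.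
  by rewrite /Jhat big1// => k _; rewrite z mxE mulr0 mul0r.
have [j pj] : exists j, p.2 0 j != 0.
  apply: ex; apply/eqP => z; move/eqP: p0; apply.
  by rewrite /Jhat big1// => k _; rewrite z mxE mulr0.
pose pr (q : V * V) : 'rV[C]_n * 'rV[C]_n := (\row_l (q.1 0 (lift i l) / q.1 0 i), \row_l (q.2 0 (lift j l) / q.2 0 j)).
have prE (q : V * V) : q.1 0 i != 0 -> q.2 0 j != 0 -> in_chart g i j (pr q) = hlift g q.
  move=> h1 h2; rewrite in_chartE /pr /= !affine_proj//.
  by rewrite hlift_scale ?invr_eq0.
have dpr : differentiable pr p.
  apply: differentiable_pair; apply: diff_row => l; apply: diff_mul.
  - exact: diff_entry1.
  - by apply: differentiableV => //; exact: diff_entry1.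
  - exact: diff_entry2.
  - by apply: differentiableV => //; exact: diff_entry2.
apply: (@diff_near _ (in_chart g i j \o pr)).
  have n1 := near_neq0 (diff_entry1 i p) pi; have n2 := near_neq0 (diff_entry2 j p) pj.
  by near=> q; rewrite /= prE//; near: q.
apply: differentiable_comp => //; apply: hg.
rewrite /pr /= !affine_proj// JhatZ -invfM mulf_neq0 ?invr_eq0 ?mulf_neq0//. 
Unshelve. all: by end_near. Qed.

Lemma hlift_holo g : (forall p, Jhat s p != 0 -> differentiable (hlift g) p) -> holomorphic g.
Proof.
move=> dg i j x x0.
apply: (@differentiable_comp _ _ _ _ (fun y : 'rV[C]_n * 'rV[C]_n => (affine i y.1, affine j y.2)) (hlift g)); last exact: dg.
have E (k : 'I_n.+1) (f : 'rV[C]_n * 'rV[C]_n -> 'rV[C]_n) :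
   (fun y => affine k (f y)) = (fun y => \row_l (affine k (f y) 0 l)).
  by apply/funext => y; apply/rowP => l; rewrite [RHS]mxE.
apply: differentiable_pair.
  by rewrite (E i fst); apply: diff_row => l; apply: diff_affine; exact: diff_fst.
by rewrite (E j snd); apply: diff_row => l; apply: diff_affine; exact: diff_snd.
Qed.

(* hsize does not depend on the representative, since |xi| |eta| is invariant
   under (xi, eta) |-> (a xi, eta / a). *)
Definition vn (v : V) : R := \sum_k cabs (v 0 k).
Definition hsize (x : Mh) : R := vn (val (repr x : Zhat s)).1 * vn (val (repr x : Zhat s)).2.

Lemma vn_ge0 (v : V) : 0 <= vn v.
Proof. by apply: sumr_ge0 => k _; exact: cabs_ge0. Qed.

Lemma vnZ (a : C) (v : V) : vn (a *: v) = cabs a * vn v.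
Proof. by rewrite /vn mulr_sumr; apply: eq_bigr => k _; rewrite mxE cabsM. Qed.

Lemma le_vn (v : V) k : cabs (v 0 k) <= vn v.
Proof. by rewrite /vn (bigD1 k)//= lerDl; apply: sumr_ge0 => l _; exact: cabs_ge0. Qed.

Lemma hsize_pim p (hp : Jhat s p = 1) : hsize (pim hp) = vn p.1 * vn p.2.
Proof.
rewrite /hsize.
have /eqmodP/asboolP[a a0 e] :
    (\pi_{eq_quot Cstar_equiv R n s} (exist (fun q => q \in Zhat s) p (mem_set hp) : Zhat s)) =
    \pi_{eq_quot Cstar_equiv R n s} (repr (pim hp) : Zhat s).
  by rewrite -[LHS]reprK.
by rewrite e /= !vnZ cabsV mulrACA mulfV ?mul1r// cabs_eq0.
Qed.

Lemma mpow_le (v : V) (P : multiindex n) : cabs (mpow v P) <= vn v ^+ mdeg P.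
Proof.
rewrite /mpow cabs_prod /mdeg -prodrXr; apply: ler_prod => k _.
by rewrite cabsX exprn_ge0 ?cabs_ge0//= lerXn2r ?nnegrE ?cabs_ge0 ?vn_ge0 ?le_vn.
Qed.

Lemma bhat_le (P Q : multiindex n) (x : Mh) : mdeg P = mdeg Q ->
  cabs (bhat P Q x) <= hsize x ^+ mdeg P.
Proof.
move=> PQ; rewrite /bhat /hsize cabsM exprMn.
by apply: ler_pM; rewrite ?cabs_ge0 ?mpow_le// PQ mpow_le.
Qed.

Lemma bhat_pim (P Q : multiindex n) p (hp : Jhat s p = 1) : mdeg P = mdeg Q ->
  bhat P Q (pim hp) = mpow p.1 P * mpow p.2 Q.
Proof. by move=> PQ; rewrite /pim bhatE. Qed.

Lemma hlift_bhat (P Q : multiindex n) p : mdeg P = mdeg Q -> Jhat s p != 0 ->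
  hlift (bhat P Q) p = (Jhat s p)^-1 ^+ mdeg P * (mpow p.1 P * mpow p.2 Q).
Proof. by move=> PQ p0; rewrite hliftE bhat_pim// mpowZ mulrA. Qed.

Lemma diff_mpow (W : normedModType C) (f : W -> V) (P : multiindex n) (x : W) :
  (forall k, differentiable (fun y => f y 0 k : C) x) ->
  differentiable (fun y => mpow (f y) P) x.
Proof. by move=> df; apply: diff_prod => k; exact: diff_exp. Qed.

Lemma bhat_holo (P Q : multiindex n) : mdeg P = mdeg Q -> holomorphic (bhat P Q : Mh -> C).
Proof.
move=> PQ; apply: hlift_holo => p p0; have nJ := near_neq0 (diff_Jhat p) p0.
apply: (@diff_near _ (fun q => (Jhat s q)^-1 ^+ mdeg P * (mpow q.1 P * mpow q.2 Q))).
  by near=> q; rewrite hlift_bhat//; near: q.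
apply: diff_mul; first by apply: diff_exp; apply: differentiableV => //; exact: diff_Jhat.
apply: diff_mul; apply: diff_mpow => k; [exact: diff_entry1|exact: diff_entry2].
Unshelve. all: by end_near. Qed.

Lemma holo_lin (a : C) g g' : holomorphic g -> holomorphic g' -> holomorphic (fun x => a * g x + g' x).
Proof.
move=> hg hg'; apply: hlift_holo => p p0; have nJ := near_neq0 (diff_Jhat p) p0.
apply: (@diff_near _ (fun q => a * hlift g q + hlift g' q)).
  near=> q; have q0 : Jhat s q != 0 by near: q.
  by rewrite !(hliftE _ q0).
by apply: diff_add; [apply: diff_scale|]; exact: hlift_diff.
Unshelve. all: by end_near. Qed.

Lemma holo0 : holomorphic (fun _ : Mh => 0 : C).
Proof.
move=> i j x _; rewrite (_ : in_chart _ _ _ = cst 0); first exact: differentiable_cst.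
by apply/funext => y; rewrite /in_chart; case: insub.
Qed.

Lemma holo_sum (J : Type) (r : seq J) (a : J -> C) (g : J -> Mh -> C) :
  (forall j, holomorphic (g j)) -> holomorphic (fun x => \sum_(j <- r) a j * g j x).
Proof.
move=> hg; elim: r => [|j r IH].
  rewrite (_ : (fun _ => _) = (fun=> 0)); first exact: holo0.
  by apply/funext => y; rewrite big_nil.
rewrite (_ : (fun _ => _) = (fun y => a j * g j y + \sum_(k <- r) a k * g k y)); first exact: holo_lin.
by apply/funext => y; rewrite big_cons.
Qed.

Lemma near_bounded (W : normedModType C) (f : W -> C) (x : W) : differentiable f x ->
  \forall y \near x, cabs (f y) <= cabs (f x) + 1.
Proof.
move=> /differentiable_continuous /cvgrPdist_lt /(_ 1 ltr01); apply: filterS => y.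
rewrite distrC normE -rc1 rc_ltr => h.
by have := cabs_dist (f y) (f x); lra.
Qed.

Lemma near_hsize p : Jhat s p != 0 -> exists B : R, \forall q \near p,
  Jhat s q != 0 /\ forall q0 : Jhat s q != 0, hsize (pim (Jhat_normalized q0)) <= B.
Proof.
move=> p0.
exists ((cabs (Jhat s p)^-1 + 1) * (\sum_k (cabs (p.1 0 k) + 1)) * (\sum_k (cabs (p.2 0 k) + 1))).
have dJV : differentiable (fun q : V * V => (Jhat s q)^-1) p.
  by apply: differentiableV => //; exact: diff_Jhat.
have nJ := near_neq0 (diff_Jhat p) p0; have bJ := near_bounded dJV.
have b1 : \forall q \near p, forall k, cabs ((q : V * V).1 0 k) <= cabs (p.1 0 k) + 1.
  have H k : nbhs p [set q : V * V | cabs (q.1 0 k) <= cabs (p.1 0 k) + 1].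
    exact: near_bounded (diff_entry1 k p).
  exact: (@filter_forall _ _ _ _ (nbhs_filter p) H).
have b2 : \forall q \near p, forall k, cabs ((q : V * V).2 0 k) <= cabs (p.2 0 k) + 1.
  have H k : nbhs p [set q : V * V | cabs (q.2 0 k) <= cabs (p.2 0 k) + 1].
    exact: near_bounded (diff_entry2 k p).
  exact: (@filter_forall _ _ _ _ (nbhs_filter p) H).
near=> q; split; first by near: q.
have l1 : cabs (Jhat s q)^-1 <= cabs (Jhat s p)^-1 + 1 by near: q.
have l2 : vn q.1 <= \sum_k (cabs (p.1 0 k) + 1).
  by apply: ler_sum => k _; move: k; near: q.
have l3 : vn q.2 <= \sum_k (cabs (p.2 0 k) + 1).
  by apply: ler_sum => k _; move: k; near: q.
move=> q0; rewrite hsize_pim /= vnZ.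
exact: ler_pM (mulr_ge0 (cabs_ge0 _) (vn_ge0 _)) (vn_ge0 _) (ler_pM (cabs_ge0 _) (vn_ge0 _) l1 l2) l3.
Unshelve. all: by end_near. Qed.

(** A set [hsize x <= B] contains a neighbourhood of any given point for suitable B by [near_hsize],
    and any given compact set by [compact_hsize]. *)
Definition unif_cvg (G : nat -> Mh -> C) g := forall B e : R, 0 < e ->
  exists N, forall D, (N <= D)%N -> forall x, hsize x <= B -> cabs (G D x - g x) <= e.

Lemma holo_limit (G : nat -> Mh -> C) g : (forall D, holomorphic (G D)) ->
  unif_cvg G g -> holomorphic g.
Proof.
move=> hG Gg; apply: hlift_holo => p p0.
have [B /nbhs_wn[d d0 H]] := near_hsize p0.
apply: (@weierstrass _ _ (fun D => hlift (G D)) _ p d d0).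
  by move=> D q /H[q0 _]; exact: hlift_diff.
move=> e e0; have [N HN] := Gg B e e0; exists N => D ND q /H[q0 qB].
by rewrite !(hliftE _ q0); exact: HN.
Qed.

End Lift.

(** * Limits of complex sequences *)

Section Limits.
Variable R : realType.
Local Notation C := (Cplx R).

Definition lim_to (u : nat -> C) (l : C) := forall e : R, 0 < e ->
  exists N, forall D, (N <= D)%N -> cabs (u D - l) <= e.

Lemma lim_to_unique u l l' : lim_to u l -> lim_to u l' -> l = l'.
Proof.
move=> h h'; apply/eqP; rewrite -subr_eq0; apply/eqP; apply: cabs_small => e e0.
have e2 : 0 < e / 2 by rewrite divr_gt0.
have [N1 H1] := h _ e2; have [N2 H2] := h' _ e2.
have := H1 _ (leq_maxl N1 N2); have := H2 _ (leq_maxr N1 N2); set D := maxn _ _ => a b.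
rewrite (_ : _ - _ = (u D - l') - (u D - l)); last by ring.
by apply: le_trans (cabs_triB _ _) _; lra.
Qed.

Lemma lim_toD u v l m : lim_to u l -> lim_to v m -> lim_to (fun D => u D + v D) (l + m).
Proof.
move=> h h' e e0; have e2 : 0 < e / 2 by rewrite divr_gt0.
have [N1 H1] := h _ e2; have [N2 H2] := h' _ e2; exists (maxn N1 N2) => D.
rewrite geq_max => /andP[/H1 a /H2 b].
rewrite (_ : _ - _ = (u D - l) + (v D - m)); last by ring.
by apply: le_trans (cabsD _ _) _; lra.
Qed.

Lemma lim_toZ k u l : lim_to u l -> lim_to (fun D => k * u D) (k * l).
Proof.
move=> h e e0; have k0 : 0 < cabs k + 1 by rewrite ltr_wpDl ?cabs_ge0.
have [N H] := h _ (divr_gt0 e0 k0); exists N => D /H; rewrite ler_pdivlMr// => a.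
rewrite -mulrBr cabsM; apply: le_trans a; rewrite mulrC ler_wpM2l ?cabs_ge0//.
by rewrite lerDl.
Qed.

Lemma lim_to_le u l M : lim_to u l -> (forall D, cabs (u D) <= M) -> cabs l <= M.
Proof.
move=> h uM; apply/ler_addgt0Pr => e e0; have [N H] := h _ e0.
have := H _ (leqnn N); have := uM N; have := cabs_dist l (u N); rewrite cabsB; lra.
Qed.

Lemma eq_lim_to u v l : u =1 v -> lim_to u l -> lim_to v l.
Proof. by move=> uv h e e0; have [N H] := h _ e0; exists N => D /H; rewrite uv. Qed.

Lemma lim_to_rate u (K : R) : (forall D D', (D <= D')%N -> cabs (u D' - u D) <= K * 2^-1 ^+ D) ->
  exists2 l, lim_to u l & forall D, cabs (u D - l) <= K * 2^-1 ^+ D.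
Proof.
move=> H; have p0 N : 0 < (2^-1 : R) ^+ N by rewrite exprn_gt0// invr_gt0.
have K0 : 0 <= K by have := le_trans (cabs_ge0 _) (H 0%N 0%N (leqnn _)); rewrite expr0 mulr1.
have small (e : R) : 0 < e -> exists N, K * 2^-1 ^+ N <= e.
  move=> e0; have K1 : 0 < K + 1 by rewrite ltr_wpDl.
  have [N HN] := pow2_small (divr_gt0 e0 K1); exists N.
  rewrite ltr_pdivlMr// in HN; apply/ltW; apply: le_lt_trans HN.
  by rewrite mulrC ler_wpM2l ?(ltW (p0 _))// lerDl.
have [l Hl] : exists l, lim_to u l.
  apply: cauchy_complete => e e0; have [N HN] := small _ (divr_gt0 e0 (ltr0n _ 2)).
  exists N => m k mN kN; have := H _ _ mN; have := H _ _ kN => a b.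
  rewrite (_ : _ - _ = (u m - u N) - (u k - u N)); last by ring.
  by apply: le_trans (cabs_triB _ _) _; lra.
exists l => // D; apply/ler_addgt0Pr => e e0; have [N HN] := Hl _ e0.
have := HN _ (leq_maxl N D); have := H _ _ (leq_maxr N D); set E := maxn _ _ => a b.
rewrite (_ : _ - _ = (u E - l) - (u E - u D)); last by ring.
by apply: le_trans (cabs_triB _ _) _; lra.
Qed.

End Limits.

(** * Normal-form indices and the Laurent argument *)

Section Index.
Variable R : realType.
Local Notation C := (Cplx R).
Variable n : nat.
Local Notation I := ('I_n + 'I_n)%type.
Implicit Types (a : I -> nat) (z : I -> C).

Definition psum a : nat := \sum_l a (inl l).
Definition qsum a : nat := \sum_l a (inr l).

Lemma msizeE a : msize a = (psum a + qsum a)%N.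
Proof. by rewrite /msize big_sumType. Qed.

(* Normal form modulo Jhat = 1: xi^0 and eta^0 never occur together, and the
   exponent of the one that does is forced by |P| = |Q|. *)
Definition Pm a : multiindex n :=
  [ffun k => if unlift ord0 k is Some l then a (inl l) else (qsum a - psum a)%N].
Definition Qm a : multiindex n :=
  [ffun k => if unlift ord0 k is Some l then a (inr l) else (psum a - qsum a)%N].

Lemma mdegPm a : mdeg (Pm a) = maxn (psum a) (qsum a).
Proof.
rewrite /mdeg big_ord_recl ffunE unlift_none maxnE addnC; congr (_ + _)%N.
by apply: eq_bigr => l _; rewrite ffunE liftK.
Qed.

Lemma mdegQm a : mdeg (Qm a) = maxn (psum a) (qsum a).
Proof.
rewrite /mdeg big_ord_recl ffunE unlift_none maxnC maxnE addnC; congr (_ + _)%N.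
by apply: eq_bigr => l _; rewrite ffunE liftK.
Qed.

Lemma mdegPQ a : mdeg (Pm a) = mdeg (Qm a).
Proof. by rewrite mdegPm mdegQm. Qed.

Definition fast (c : (I -> nat) -> C) := forall r : R, 0 < r -> exists2 M : R, 0 <= M &
  forall a, cabs (c a) * r ^+ msize a <= M.

Lemma fastZ (c d : (I -> nat) -> C) (B : R) : 0 < B -> fast c -> (forall a, cabs (d a) <= B ^+ msize a) ->
  fast (fun a => c a * d a).
Proof.
move=> B0 fc dB r r0; have [M M0 HM] := fc (B * r) (mulr_gt0 B0 r0); exists M => // a.
apply: le_trans (HM a); rewrite cabsM exprMn -mulrA ler_wpM2l ?cabs_ge0//.
by rewrite ler_wpM2r ?exprn_ge0 ?(ltW r0).
Qed.

Lemma fastB (c d : (I -> nat) -> C) : fast c -> fast d -> fast (fun a => c a - d a).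
Proof.
move=> fc fd r r0; have [M M0 HM] := fc r r0; have [N N0 HN] := fd r r0.
exists (M + N); first exact: addr_ge0.
move=> a; apply: le_trans (lerD (HM a) (HN a)); rewrite -mulrDl.
by rewrite ler_wpM2r ?exprn_ge0 ?(ltW r0)// cabs_triB.
Qed.

(** The character by which (x, y) -> (l x, y / l) acts on the monomial of index a, see
    [mon_scal]. *)
Definition dpow (l : C) a : C := l ^+ psum a * l^-1 ^+ qsum a.

Lemma dpow_pos l a : l != 0 -> (qsum a <= psum a)%N -> dpow l a = l ^+ (psum a - qsum a).
Proof.
move=> l0 qp; rewrite /dpow -{1}(subnK qp) exprD -mulrA -exprMn mulfV// expr1n mulr1 //.
Qed.

Lemma dpow_neg l a : l != 0 -> (psum a <= qsum a)%N -> dpow l a = l^-1 ^+ (qsum a - psum a).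
Proof.
move=> l0 qp; rewrite /dpow -{1}(subnK qp) exprD mulrCA -exprMn mulfV// expr1n mulr1 //.
Qed.

(** The strictly positive powers of l sum to an entire function u with u 0 = 0. For |l| > 1 it
    equals minus the sum of the remaining powers and is therefore bounded. Hence u is constant, and
    u 1 = 0 is the claim. *)
Lemma laurent e : fast e -> (forall l, l != 0 -> lim_to (fun D => bsum D (fun a => e a * dpow l a)) 0) ->
  lim_to (fun D => bsum D (fun a => if (qsum a < psum a)%N then e a else 0)) 0.
Proof.
move=> fe He.
pose U D (l : C) := bsum D (fun a => e a * (if (qsum a < psum a)%N then l ^+ (psum a - qsum a) else 0)).
pose W D (l : C) := bsum D (fun a => e a * (if (qsum a < psum a)%N then 0 else l^-1 ^+ (qsum a - psum a))).
have UB (r : R) l : 1 <= r -> cabs l <= r -> forall a,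
    cabs (if (qsum a < psum a)%N then l ^+ (psum a - qsum a) else 0) <= r ^+ msize a.
  move=> r1 lr a; have r0 : 0 <= r by apply: le_trans r1.
  case: ifP => _; last by rewrite cabs0 exprn_ge0.
  rewrite cabsX; apply: le_trans (_ : r ^+ (psum a - qsum a) <= _).
    by apply: lerXn2r; rewrite ?nnegrE ?cabs_ge0.
  by apply: ler_weXn2l => //; rewrite msizeE (leq_trans (leq_subr _ _)) ?leq_addr.
have Ulim (r : R) : 1 <= r -> exists2 M : R, 0 <= M & forall l, cabs l <= r ->
    forall D D', (D <= D')%N -> cabs (U D' l - U D l) <= 2 ^+ #|{: I}| * M * 2^-1 ^+ D.
  move=> r1; have r0 : 0 < r by apply: lt_le_trans r1.
  have [M M0 HM] := fe (4 * r) (mulr_gt0 (ltr0n _ 4) r0); exists M => // l lr D D' DD.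
  apply: bsum_diff => // a.
  have p4 : 0 < (4 : R) ^+ msize a by rewrite exprn_gt0.
  rewrite exprVn ler_pdivlMr// cabsM; apply: le_trans (HM a).
  by rewrite exprMn -mulrA ler_wpM2l ?cabs_ge0// mulrC ler_wpM2l ?(ltW p4)// UB.
have /choice[u uP] : forall l, exists v, lim_to (U^~ l) v.
  move=> l; have r1 : 1 <= cabs l + 1 by rewrite lerDr cabs_ge0.
  have [M M0 HM] := Ulim _ r1.
  have [v vl _] := lim_to_rate (HM l (ler_wpDr ler01 (lexx _))); by exists v.
have urate (r : R) : 1 <= r -> exists2 M : R, 0 <= M & forall l, cabs l <= r ->
    forall D, cabs (U D l - u l) <= M * 2^-1 ^+ D.
  move=> r1; have [M M0 HM] := Ulim _ r1.
  exists (2 ^+ #|{: I}| * M); first by rewrite mulr_ge0// exprn_ge0.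
  move=> l lr D; have [v vl vr] := lim_to_rate (HM l lr).
  by rewrite (lim_to_unique (uP l) vl).
have eU : entire u.
  apply: differentiable_entire => l.
  apply: (@weierstrass _ _ U _ l 1 ltr01).
    move=> D y _; apply: entire_differentiable => {}y; apply: cderiv_sum => a.
    case: (qsum (boxi a) < psum (boxi a))%N; last first.
      by exists 0; have := cderiv_cst 0 y; congr cderiv; apply/funext => w; rewrite mulr0.
    suff [m dm] : exists m, cderiv (fun x => x ^+ (psum (boxi a) - qsum (boxi a))) y m.
      by exists (e (boxi a) * m); exact: cderivZ.
    elim: (psum (boxi a) - qsum (boxi a))%N => [|k [m dm]].
      by exists 0; exact: cderiv_cst.
    eexists; have := cderivM (cderiv_id y) dm; congr cderiv.
    by apply/funext => x; rewrite exprS.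
  have r1 : 1 <= cabs l + 1 by rewrite lerDr cabs_ge0.
  have [M M0 HM] := urate _ r1 => q q0.
  have [N HN] := pow2_small (divr_gt0 q0 (ltr_wpDl M0 ltr01)).
  exists N => D ND y yl; have ly : cabs y <= cabs l + 1.
    have : wn (y - l) = cabs (y - l) by apply: rc_inj; rewrite -wnE normE.
    by move=> wE; rewrite wE in yl; have := cabs_dist y l; lra.
  apply: le_trans (HM y ly D) _; rewrite ltr_pdivlMr ?ltr_wpDl// in HN.
  apply/ltW; apply: le_lt_trans HN; rewrite mulrC.
  apply: ler_pM; rewrite ?exprn_ge0 ?invr_ge0 ?lerDl//.
  by rewrite ler_wiXn2l ?invr_ge0// invf_le1// ler1n.
have [M M0 HM] := fe 2 (ltr0n _ 2).
have half : 0 <= (2^-1 : R) <= 2^-1 by rewrite invr_ge0 lexx andbT.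
have eM a : cabs (e a) <= M * 2^-1 ^+ msize a.
  by rewrite exprVn ler_pdivlMr ?exprn_gt0.
have le1_bound (d : (I -> nat) -> C) D : (forall a, cabs (d a) <= 1) ->
    cabs (bsum D (fun a => e a * d a)) <= 2 ^+ #|{: I}| * M.
  move=> d1; apply: (@bsum_le R _ D _ M 2^-1 M0 half) => a; rewrite cabsM.
  by apply: le_trans (eM a); rewrite ler_piMr ?cabs_ge0.
have ubound l : cabs (u l) <= 2 ^+ #|{: I}| * M.
  have [l1|l1] := lerP (cabs l) 1.
    apply: (lim_to_le (uP l)) => D; apply: le1_bound => a.
    by have := UB 1 l (lexx _) l1 a; rewrite expr1n.
  have l0 : l != 0 by rewrite -cabs_gt0; apply: lt_trans l1.
  have Wl : lim_to (W^~ l) (- u l).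
    have := lim_toD (He l l0) (lim_toZ (-1) (uP l)); rewrite add0r mulN1r.
    apply: eq_lim_to => D; rewrite mulN1r /U /W -[- _]mulN1r -bsumZ -bsumD.
    apply: eq_bsum => a; have [qp|pq] := ltnP (qsum a) (psum a).
      by rewrite (dpow_pos l0 (ltnW qp)) mulr0 mulN1r subrr.
    by rewrite (dpow_neg l0 pq) !mulr0 addr0.
  rewrite -cabsN; apply: (lim_to_le Wl) => D; apply: le1_bound => a.
  case: ifP => _; first by rewrite cabs0.
  rewrite cabsX cabsV; apply: exprn_ile1; first by rewrite invr_ge0 cabs_ge0.
  by rewrite invf_le1 ?ltW// (lt_trans _ l1).
have u1 : u 1 = 0.
  rewrite (liouville eU ubound); apply: (lim_to_unique (uP 0)) => q q0; exists 0%N => D _.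
  rewrite subr0 /U /bsum big1 ?cabs0 ?ltW// => a _.
  case: ifP => h; last by rewrite mulr0.
  by rewrite expr0n subn_eq0 leqNgt h mulr0.
rewrite -u1; apply: eq_lim_to (uP 1) => D; apply: eq_bsum => a.
by case: ifP => _; rewrite ?mulr0 ?expr1n ?mulr1.
Qed.

End Index.

(** * Compact sets and bounds of continuous functions *)

Section Compactness.
Variable R : realType.
Local Notation C := (Cplx R).

Lemma wnC (z : C) : wn (z : C) = cabs z.
Proof. by apply: rc_inj; rewrite -wnE normE. Qed.

Lemma ccont_continuous (T : topologicalType) (f : T -> C) :
  (forall x (e : R), 0 < e -> \forall y \near x, cabs (f y - f x) < e) -> continuous f.
Proof.
move=> H x; apply/cvgrPdist_lt => _ /rc_gt0P[e e0 ->].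
by apply: filterS (H x e e0) => y; rewrite normE rc_ltr cabsB.
Qed.

Lemma continuous_eps (T : topologicalType) (f : T -> C) x : {for x, continuous f} ->
  forall e : R, 0 < e -> \forall y \near x, cabs (f y - f x) < e.
Proof.
move=> /cvgrPdist_lt cf e e0; have /cf : 0 < rc e by rewrite rc_gt0.
by apply: filterS => y; rewrite normE rc_ltr cabsB.
Qed.

Lemma pt_continuous : continuous (fun p : R * R => pt p.1 p.2).
Proof.
apply: ccont_continuous => -[x y] e e0.
have e2 : 0 < e / 2 by rewrite divr_gt0.
have h1 : \forall q \near (x, y), `|q.1 - x| < e / 2.
  have : (fun q : R * R => q.1) @ (x, y) --> x by exact: cvg_fst.
  by move=> /cvgrPdist_lt /(_ _ e2); apply: filterS => q; rewrite distrC.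
have h2 : \forall q \near (x, y), `|q.2 - y| < e / 2.
  have : (fun q : R * R => q.2) @ (x, y) --> y by exact: cvg_snd.
  by move=> /cvgrPdist_lt /(_ _ e2); apply: filterS => q; rewrite distrC.
near=> q; rewrite (_ : _ - _ = pt (q.1 - x) (q.2 - y)); last by rewrite /pt !rcB /=; ring.
apply: le_lt_trans (cabs_pt _ _) _.
have : `|q.1 - x| < e / 2 by near: q.
have : `|q.2 - y| < e / 2 by near: q.
by move: `|q.1 - x| `|q.2 - y| => u v; lra.
Unshelve. all: by end_near. Qed.

(** As the image of a product of real segments it is compact, and it contains the disc of radius
    p. *)
Definition square (p : R) : set C := (fun q : R * R => pt q.1 q.2) @` (`[- p, p] `*` `[- p, p]).

Lemma square_compact p : compact (square p).
Proof.
apply: continuous_compact; first exact/continuous_subspaceT/pt_continuous.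
by apply: compact_setX; exact: segment_compact.
Qed.

Lemma in_square p z : cabs z <= p -> square p z.
Proof.
move=> zp; exists (complex.Re z, complex.Im z); last by rewrite /= -pt_ReIm.
split; rewrite /= in_itv /= -ler_norml.
  exact: le_trans (Re_le _) zp.
exact: le_trans (Im_le _) zp.
Qed.

Lemma compact_cabs_bounded (T : topologicalType) (K : set T) (f : T -> C) :
  compact K -> continuous f -> exists M : R, forall x, K x -> cabs (f x) <= M.
Proof.
move=> cK cf.
have cg : continuous (fun x => cabs (f x)).
  move=> x; apply/cvgrPdist_lt => e e0; apply: filterS (continuous_eps (cf x) e0) => y h.
  apply: le_lt_trans h; have := cabs_dist (f x) (f y); have := cabs_dist (f y) (f x).
  by rewrite [cabs (f x - f y)]cabsB ler_norml => a b; apply/andP; split; lra.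
have : compact ((fun x => cabs (f x)) @` K).
  by apply: continuous_compact cK; exact: continuous_subspaceT.
move=> /compact_bounded[M [_ HM]]; exists (M + 1) => x Kx.
have := HM (M + 1) (ltr_pwDr ltr01 (lexx _)) (cabs (f x)).
by rewrite /= ger0_norm ?cabs_ge0//; apply; exists x.
Qed.

End Compactness.

(** * The two charts and the coefficients of a holomorphic function *)

Section Charts.
Variables (R : realType) (n s : nat).
Hypothesis s_gt0 : (0 < s)%N.
Local Notation C := (Cplx R).
Local Notation V := 'rV[C]_n.+1.
Local Notation Mh := (Mhat R n s).
Local Notation I := ('I_n + 'I_n)%type.
Implicit Types (z : I -> C) (a : I -> nat) (g : Mh -> C).

Lemma nu0 : nu R s (ord0 : 'I_n.+1) = 1.
Proof. by rewrite /nu s_gt0. Qed.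

(* The value that Jhat = 1 forces on the product of the zeroth coordinates. *)
Definition wchart z : C := 1 - \sum_l nu R s (lift ord0 l) * z (inl l) * z (inr l).

Definition extend (t : C) (x : 'I_n -> C) : V := \row_k oapp x t (unlift ord0 k).

Lemma extend0 t x : extend t x 0 ord0 = t.
Proof. by rewrite mxE unlift_none. Qed.
Lemma extend_lift t x l : extend t x 0 (lift ord0 l) = x l.
Proof. by rewrite mxE liftK. Qed.

Definition chart1 z : V * V := (extend 1 (z \o inl), extend (wchart z) (z \o inr)).
Definition chart2 z : V * V := (extend (wchart z) (z \o inl), extend 1 (z \o inr)).

Lemma Jhat_c1 z : Jhat s (chart1 z) = 1.
Proof.
rewrite /Jhat big_ord_recl /= !extend0 nu0 !mul1r /wchart -[RHS](subrK (\sum_l nu R s (lift ord0 l) * z (inl l) * z (inr l))).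
by congr (_ + _); apply: eq_bigr => l _; rewrite !extend_lift.
Qed.

Lemma Jhat_c2 z : Jhat s (chart2 z) = 1.
Proof.
rewrite /Jhat big_ord_recl /= !extend0 nu0 !mul1r mulr1 /wchart -[RHS](subrK (\sum_l nu R s (lift ord0 l) * z (inl l) * z (inr l))).
by congr (_ + _); apply: eq_bigr => l _; rewrite !extend_lift.
Qed.

Definition mon z a : C := \prod_i z i ^+ a i.

Lemma mpow_extend t x (P : multiindex n) :
  mpow (extend t x) P = t ^+ P ord0 * \prod_l x l ^+ P (lift ord0 l).
Proof.
rewrite /mpow big_ord_recl extend0; congr (_ * _).
by apply: eq_bigr => l _; rewrite extend_lift.
Qed.

Lemma Pm0 a : Pm a ord0 = (qsum a - psum a)%N. Proof. by rewrite ffunE unlift_none. Qed.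
Lemma Qm0 a : Qm a ord0 = (psum a - qsum a)%N. Proof. by rewrite ffunE unlift_none. Qed.
Lemma Pml a l : Pm a (lift ord0 l) = a (inl l). Proof. by rewrite ffunE liftK. Qed.
Lemma Qml a l : Qm a (lift ord0 l) = a (inr l). Proof. by rewrite ffunE liftK. Qed.

Definition ba a : Mh -> C := bhat (Pm a) (Qm a).

Lemma ba_c1 z a : hlift (ba a) (chart1 z) = mon z a * wchart z ^+ (psum a - qsum a).
Proof.
rewrite (hlift_pim _ (Jhat_c1 z)) /ba bhat_pim ?mdegPQ//= !mpow_extend expr1n mul1r Qm0 /mon big_sumType /=.
rewrite (eq_bigr (fun l => z (inl l) ^+ a (inl l))); last by move=> l _; rewrite Pml.
rewrite [in X in _ * (_ * X)](eq_bigr (fun l => z (inr l) ^+ a (inr l))); last by move=> l _; rewrite Qml.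
by rewrite -mulrA; congr (_ * _); rewrite mulrC.
Qed.

Lemma diff_c (W : normedModType C) (f : W -> I -> C) (x : W) :
  (forall i, differentiable (fun y => f y i) x) ->
  differentiable (fun y => chart1 (f y)) x /\ differentiable (fun y => chart2 (f y)) x.
Proof.
move=> df.
have dw : differentiable (fun y => wchart (f y)) x.
  rewrite (_ : (fun _ => _) = (fun y => 1 + (-1) * \sum_l nu R s (lift ord0 l) * f y (inl l) * f y (inr l))).
    apply: diff_add; first exact: differentiable_cst.
    by apply: diff_scale; apply: diff_bigsum => l; apply: diff_mul => //; exact: diff_scale.
  by apply/funext => y; rewrite mulN1r.
have dext (h : W -> C) (k : W -> 'I_n -> C) : differentiable h x ->
    (forall l, differentiable (fun y => k y l) x) -> differentiable (fun y => extend (h y) (k y)) x.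
  move=> dh dk; apply: (@diff_row _ _ _ (fun j y => oapp (k y) (h y) (unlift ord0 j))) => j.
  by case: (unlift ord0 j).
by split; apply: differentiable_pair; apply: dext => //=; exact: differentiable_cst.
Qed.

Definition tup (v : 'rV[C]_n * 'rV[C]_n) : I -> C :=
  fun i => match i with inl l => v.1 0 l | inr l => v.2 0 l end.

Lemma diff_tup i v : differentiable (fun y => tup y i) v.
Proof. by case: i => l /=; [exact: diff_entry1|exact: diff_entry2]. Qed.

Lemma tup_surj z : exists v, tup v = z.
Proof.
exists (\row_l z (inl l), \row_l z (inr l)).
by apply/funext => -[l|l] /=; rewrite mxE.
Qed.

(** Continuity on the quotient is tested on [Zhat], where g becomes the restriction of its lift. *)
Lemma holo_continuous g : holomorphic g -> continuous g.
Proof.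
move=> hg; apply/quotient_continuous.
rewrite (_ : _ \o _ = hlift g \o set_val); last first.
  apply/funext => q; have hq : Jhat s (val q) = 1 by exact: set_mem (valP q).
  rewrite /= -[set_val q]/(val q) (hlift_pim g hq); congr (g (\pi_Mh _)); exact: val_inj.
move=> q; apply: continuous_comp; first exact: initial_continuous.
apply: differentiable_continuous; apply: hlift_diff => //.
by rewrite -[set_val q]/(val q) (set_mem (valP q)) oner_neq0.
Qed.

(** The image of a product of squares in the chart [c]; it contains the image of the polydisc of
    radius p, on which the Cauchy estimates need a bound. *)
Definition Kset (c : (I -> C) -> V * V) (hc : forall z, Jhat s (c z) = 1) (p : R) : set Mh :=
  (fun v : 'rV[C]_n * 'rV[C]_n => pim (hc (tup v))) @` ([set x : 'rV[C]_n | forall l, square p (x ord0 l)] `*` [set x : 'rV[C]_n | forall l, square p (x ord0 l)]).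

Lemma Kset_compact c hc p : (forall v, differentiable (fun y => c (tup y)) v) -> compact (@Kset c hc p).
Proof.
move=> dc; apply: continuous_compact; last first.
  by apply: compact_setX; apply: (@rV_compact _ _ (fun=> square p)) => l; exact: square_compact.
apply: continuous_subspaceT.
pose h (v : 'rV[C]_n * 'rV[C]_n) : Zhat s := exist (fun q => q \in Zhat s) _ (mem_set (hc (tup v))).
have ch : continuous (h : _ -> Zhat s).
  apply: continuous_comp_initial => v; apply: differentiable_continuous; exact: dc.
move=> v; apply: (@continuous_comp _ _ _ h (\pi_Mh)); first exact: ch.
exact: pi_continuous.
Qed.

Lemma KsetP c hc p z : (forall i, cabs (z i) <= p) -> @Kset c hc p (pim (hc z)).
Proof.
move=> zp; have [v vz] := tup_surj z; exists v; last by move: hc; rewrite -vz.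
by split=> l; apply: in_square; [have := zp (inl l)|have := zp (inr l)]; rewrite -vz.
Qed.

Definition K1 p : set Mh := Kset Jhat_c1 p.
Definition K2 p : set Mh := Kset Jhat_c2 p.

Lemma K_compact p : compact (K1 p `|` K2 p).
Proof.
by apply: compactU; apply: Kset_compact => v;
  have [] := @diff_c _ tup v (fun i => diff_tup i v).
Qed.

Section Chart.
Variables (c : (I -> C) -> V * V) (hc : forall z, Jhat s (c z) = 1).
Hypothesis dc : forall (W : normedModType C) (f : W -> I -> C) (x : W),
  (forall i, differentiable (fun y => f y i) x) -> differentiable (fun y => c (f y)) x.

Lemma chart_sep g : holomorphic g -> separately_entire (fun z => hlift g (c z)).
Proof.
move=> hg; split.
  move=> z i; apply: differentiable_entire => t.
  apply: (@differentiable_comp _ _ _ _ (fun t => c (upd z i t)) (hlift g)).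
    apply: dc => j; rewrite /upd; case: eqP => _; last exact: differentiable_cst.
    exact: ex_diff.
  by apply: hlift_diff => //; rewrite hc oner_neq0.
move=> p; have cK : compact (Kset hc p).
  by apply: Kset_compact => v; apply: dc => i; exact: diff_tup.
have [M HM] := compact_cabs_bounded cK (holo_continuous hg).
by exists M => z zp; rewrite (hlift_pim _ (hc z)); apply/HM/KsetP.
Qed.
End Chart.

Lemma c1_sep g : holomorphic g -> separately_entire (fun z => hlift g (chart1 z)).
Proof. by apply: chart_sep; [exact: Jhat_c1|move=> W f x /diff_c[]]. Qed.

Lemma c2_sep g : holomorphic g -> separately_entire (fun z => hlift g (chart2 z)).
Proof. by apply: chart_sep; [exact: Jhat_c2|move=> W f x /diff_c[]]. Qed.

(* In [chart1] the basis function of index a is [mon z a] when psum a <= qsum a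
   and has an additional power of [wchart] otherwise; [chart2] is symmetric. *)
Definition acoef g a : C :=
  if (psum a <= qsum a)%N then mcoef (fun z => hlift g (chart1 z)) a
  else mcoef (fun z => hlift g (chart2 z)) a.

(** A supremum over one compact set of the complexified space controls all coefficients. This is the
    half of the comparison of topologies that rests on Cauchy's estimates. *)
Lemma acoef_bound g (p M : R) a : holomorphic g -> 0 < p ->
  (forall x, (K1 p `|` K2 p) x -> cabs (g x) <= M) ->
  cabs (acoef g a) <= 4 ^+ #|{: I}| * M / (p / 2) ^+ msize a.
Proof.
move=> hg p0 gM; rewrite /acoef; case: ifP => _; apply: mcoef_bound => //.
- exact: c1_sep.
- by move=> z zp; rewrite (hlift_pim _ (Jhat_c1 z)); apply: gM; left; exact: KsetP.
- exact: c2_sep.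
- by move=> z zp; rewrite (hlift_pim _ (Jhat_c2 z)); apply: gM; right; exact: KsetP.
Qed.

Lemma acoef_fast g : holomorphic g -> fast (acoef g).
Proof.
move=> hg r r0; have p0 : 0 < 2 * r by rewrite mulr_gt0.
have [M HM] := compact_cabs_bounded (@K_compact (2 * r)) (holo_continuous hg).
have H a := acoef_bound a hg p0 HM.
have e : 2 * r / 2 = r by field.
exists (`|4 ^+ #|{: I}| * M|) => // a; rewrite -ler_pdivlMr ?exprn_gt0//.
by apply: le_trans (H a) _; rewrite e ler_wpM2r ?ler_norm// invr_ge0 exprn_ge0// ltW.
Qed.

End Charts.

(** * Convergence of the series and comparison of the charts *)

Section Expansion.
Variables (R : realType) (n s : nat).
Hypothesis s_gt0 : (0 < s)%N.
Local Notation C := (Cplx R).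
Local Notation Mh := (Mhat R n s).
Local Notation I := ('I_n + 'I_n)%type.
Implicit Types (z : I -> C) (a : I -> nat) (g : Mh -> C) (c : (I -> nat) -> C).

Lemma rate_lim (u : nat -> C) l (K : R) : (forall D, cabs (u D - l) <= K * 2^-1 ^+ D) -> lim_to u l.
Proof.
move=> H e e0; have K0 : 0 <= K by have := le_trans (cabs_ge0 _) (H 0%N); rewrite expr0 mulr1.
have [N HN] := pow2_small (divr_gt0 e0 (ltr_wpDl K0 ltr01)); exists N => D ND.
rewrite ltr_pdivlMr ?ltr_wpDl// in HN.
apply: le_trans (H D) _; apply/ltW; apply: le_lt_trans HN; rewrite mulrC.
apply: ler_pM; rewrite ?exprn_ge0 ?invr_ge0 ?lerDl//.
by rewrite ler_wiXn2l ?invr_ge0// invf_le1// ler1n.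
Qed.

Lemma hsize_ge0 (x : Mh) : 0 <= hsize x.
Proof. by rewrite mulr_ge0 ?vn_ge0. Qed.

Lemma ba_le a (x : Mh) (B : R) : hsize x <= B -> cabs (ba a x) <= (1 + B) ^+ msize a.
Proof.
move=> xB; apply: le_trans (bhat_le x (mdegPQ a)) _; rewrite mdegPm.
have x0 := hsize_ge0 x; have B1 : 1 <= 1 + B by rewrite lerDl (le_trans x0).
apply: le_trans (_ : (1 + B) ^+ maxn (psum a) (qsum a) <= _).
  by apply: lerXn2r; rewrite ?nnegrE//; [exact: le_trans B1|lra].
by apply: ler_weXn2l => //; rewrite msizeE geq_max leq_addr leq_addl.
Qed.

Definition series c D (x : Mh) : C := bsum D (fun a => c a * ba a x).

Lemma series_rate c (B : R) : fast c -> exists2 K : R, 0 <= K & forall x : Mh, hsize x <= B ->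
  forall D D', (D <= D')%N -> cabs (series c D' x - series c D x) <= K * 2^-1 ^+ D.
Proof.
move=> fc; have B0 : 0 < 1 + `|B| by rewrite ltr_wpDr.
(* The base absorbs the growth of the basis functions from [ba_le] and leaves the factor 4^-|a| that
   [bsum_diff] expects. *)
have [r Hr] : exists r : R, r = 4 * (1 + `|B|) by exists (4 * (1 + `|B|)).
have r0 : 0 < r by rewrite Hr mulr_gt0.
have [M M0 HM] := fc r r0; exists (2 ^+ #|{: I}| * M); first by rewrite mulr_ge0 ?exprn_ge0.
move=> x xB D D' DD; apply: bsum_diff => // a.
have p4 : 0 < (4 : R) ^+ msize a by rewrite exprn_gt0.
rewrite exprVn ler_pdivlMr// cabsM; apply: le_trans (HM a).
rewrite Hr exprMn -mulrA ler_wpM2l ?cabs_ge0// mulrC ler_wpM2l ?(ltW p4)//.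
by apply: ba_le; apply: le_trans xB (ler_norm _).
Qed.

Definition sumf c (x : Mh) : C := xget 0 [set l | lim_to (fun D => series c D x) l].

Lemma sumf_lim c x : fast c -> lim_to (fun D => series c D x) (sumf c x).
Proof.
move=> fc; apply: (xgetPex 0 (P := [set l | lim_to (fun D => series c D x) l])).
have [K K0 HK] := series_rate (hsize x) fc.
by have [l Hl _] := lim_to_rate (HK x (lexx _)); exists l.
Qed.

Lemma sumf_rate c (B : R) : fast c -> exists2 K : R, 0 <= K & forall x : Mh, hsize x <= B ->
  forall D, cabs (series c D x - sumf c x) <= K * 2^-1 ^+ D.
Proof.
move=> fc; have [K K0 HK] := series_rate B fc; exists K => // x xB.
have [l Hl Hr] := lim_to_rate (HK x xB).
by rewrite (lim_to_unique (sumf_lim x fc) Hl).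
Qed.

Lemma unif_cvg_rate (G : nat -> Mh -> C) g :
  (forall B : R, exists K : R, forall x, hsize x <= B -> forall D, cabs (G D x - g x) <= K * 2^-1 ^+ D) ->
  unif_cvg G g.
Proof.
move=> H B e e0; have [K HK] := H B.
have K1 : 0 < `|K| + 1 by rewrite ltr_wpDl.
have [N HN] := pow2_small (divr_gt0 e0 K1); exists N => D ND x xB.
rewrite ltr_pdivlMr// in HN; apply: le_trans (HK x xB D) _; apply/ltW.
apply: le_lt_trans HN; rewrite mulrC; apply: le_trans (_ : 2^-1 ^+ D * `|K| <= _).
  by rewrite ler_wpM2l ?exprn_ge0 ?invr_ge0// ler_norm.
apply: ler_pM; rewrite ?exprn_ge0 ?invr_ge0 ?lerDl//.
by rewrite ler_wiXn2l ?invr_ge0// invf_le1// ler1n.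
Qed.

Lemma series_holo c D : holomorphic (series c D).
Proof. by apply: holo_sum => a; apply: bhat_holo; exact: mdegPQ. Qed.

Lemma sumf_holo c : fast c -> holomorphic (sumf c).
Proof.
move=> fc; apply: (@holo_limit _ _ _ (series c)); first by move=> D; exact: series_holo.
apply: unif_cvg_rate => B; have [K _ HK] := sumf_rate B fc; by exists K.
Qed.

Lemma mon_le z a : cabs (mon z a) <= (1 + \sum_i cabs (z i)) ^+ msize a.
Proof.
rewrite /mon cabs_prod /msize -prodrXr; apply: ler_prod => i _.
rewrite cabsX exprn_ge0 ?cabs_ge0//= lerXn2r ?nnegrE ?cabs_ge0//.
  by rewrite addr_ge0// sumr_ge0// => j _; exact: cabs_ge0.
rewrite (bigD1 i)//= addrCA lerDl addr_ge0// sumr_ge0// => j _; exact: cabs_ge0.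
Qed.

Lemma mon_base_gt0 z : 0 < 1 + \sum_i cabs (z i).
Proof. by rewrite ltr_pwDl// sumr_ge0// => j _; exact: cabs_ge0. Qed.

Lemma mcoef_fast (F : (I -> C) -> C) : separately_entire F -> fast (mcoef F).
Proof.
move=> sF r r0; have p0 : 0 < 2 * r by rewrite mulr_gt0.
have [M HM] := sF.2 (2 * r).
have e : 2 * r / 2 = r by field.
exists (`|4 ^+ #|{: I}| * M|) => // a; rewrite -ler_pdivlMr ?exprn_gt0//.
apply: le_trans (mcoef_bound a sF p0 HM) _; rewrite e.
by rewrite ler_wpM2r ?ler_norm// invr_ge0 exprn_ge0// ltW.
Qed.

Lemma mtaylor_lim (F : (I -> C) -> C) z : separately_entire F ->
  lim_to (fun D => bsum D (fun a => mcoef F a * mon z a)) (F z).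
Proof.
move=> sF; have b0 := mon_base_gt0 z; set b := 1 + _ in b0.
have p0 : 0 < 4 * b by rewrite mulr_gt0.
have [M HM] := sF.2 (4 * b); have zp i : cabs (z i) <= 4 * b / 4.
  rewrite mulrC mulKf// /b (bigD1 i)//= addrCA lerDl addr_ge0// sumr_ge0// => j _.
  exact: cabs_ge0.
apply: (@rate_lim _ _ (Kpoly R #|{: I}| * M)) => D; rewrite cabsB.
exact: (mtaylor D sF p0 HM zp).
Qed.

Definition scal (l : C) z : I -> C :=
  fun i => match i with inl k => l * z (inl k) | inr k => l^-1 * z (inr k) end.

Lemma wchart_scal l z : l != 0 -> wchart s (scal l z) = wchart s z.
Proof.
move=> l0; rewrite /wchart; congr (_ - _); apply: eq_bigr => k _ /=.
by rewrite -mulrA mulrACA mulfV// mul1r mulrA.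
Qed.

Lemma mon_scal l z a : mon (scal l z) a = mon z a * dpow l a.
Proof.
rewrite /mon /dpow !big_sumType /= /psum /qsum -!prodrXr.
under eq_bigr do rewrite exprMn; under [X in _ * X = _]eq_bigr do rewrite exprMn.
by rewrite !big_split /= mulrACA mulrC.
Qed.

Lemma scal_scal l l' z : scal l (scal l' z) = scal (l * l') z.
Proof. by apply/funext => -[k|k] /=; rewrite ?invfM mulrA. Qed.

(** Rescaling the point of the first chart by (w, w^-1) makes its zeroth eta-coordinate 1 and its
    zeroth xi-coordinate w; the other coordinates become those of [scal w z], for which w is
    unchanged. *)
Lemma chart_change g z : wchart s z != 0 ->
  hlift g (chart1 s z) = hlift g (chart2 s (scal (wchart s z) z)).
Proof.
move=> w0; rewrite -(@hlift_scale _ _ _ g (chart1 s z) (wchart s z) (wchart s z)^-1)// ?invr_eq0//.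
rewrite /chart1 /chart2 [(_, _).1]/= [(_, _).2]/= wchart_scal//; set w := wchart s z in w0 *.
apply: (congr2 (fun u v => hlift g (u, v))); apply/rowP => k; rewrite [LHS]mxE.
  by have [l ->|->] := unliftP ord0 k; rewrite ?extend_lift ?extend0 ?mulr1.
by have [l ->|->] := unliftP ord0 k; rewrite ?extend_lift ?extend0 ?mulVf.
Qed.

Lemma dpow_le (l : C) a : cabs (dpow l a) <= (1 + cabs l + cabs l^-1) ^+ msize a.
Proof.
rewrite /dpow cabsM !cabsX msizeE exprD; have h1 := cabs_ge0 l; have h2 := cabs_ge0 l^-1.
have h3 : 0 <= 1 + cabs l + cabs l^-1 by rewrite !addr_ge0.
apply: ler_pM; rewrite ?exprn_ge0//; apply: lerXn2r; rewrite ?nnegrE//.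
  by rewrite addrAC lerDr addr_ge0.
by rewrite lerDr addr_ge0.
Qed.

(** For p <= q the term of index a is the Taylor term of the first chart. For p > q it carries w^(p
    - q) and a coefficient of the second chart, and it exceeds the Taylor term by [e a]. The series
    of [e a * dpow l a] compares the two expansions along the orbit of z, where they agree by
    [chart_change]. So [laurent] shows that the excess over p > q sums to 0. *)
Lemma expansion_chart g z : holomorphic g -> wchart s z != 0 ->
  lim_to (fun D => bsum D (fun a => acoef g a * hlift (ba a : Mh -> C) (chart1 s z))) (hlift g (chart1 s z)).
Proof.
move=> hg w0; set w := wchart s z in w0 *.
have sG := c1_sep s_gt0 hg; have sH := c2_sep s_gt0 hg.
set G := (fun z => hlift g (chart1 s z)) in sG *; set H := (fun z => hlift g (chart2 s z)) in sH *.
pose e a := (mcoef H a * dpow w a - mcoef G a) * mon z a.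
have q0 : 0 < 1 + cabs w + cabs w^-1 by rewrite !ltr_pwDl ?addr_ge0 ?cabs_ge0.
have fe : fast e.
  apply: fastZ (mon_base_gt0 z) _ (mon_le z); apply: fastB; last exact: mcoef_fast.
  by apply: fastZ q0 _ (dpow_le w); exact: mcoef_fast.
have He : forall l, l != 0 -> lim_to (fun D => bsum D (fun a => e a * dpow l a)) 0.
  move=> l l0; have wl : wchart s (scal l z) = w by rewrite wchart_scal.
  have wl0 : wchart s (scal l z) != 0 by rewrite wl.
  have hG := mtaylor_lim (scal l z) sG; have hH := mtaylor_lim (scal (w * l) z) sH.
  have eq : G (scal l z) = H (scal (w * l) z).
    by rewrite /G chart_change// wl scal_scal.
  have := lim_toD hH (lim_toZ (-1) hG); rewrite -eq mulN1r subrr.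
  apply: eq_lim_to => D; rewrite -bsumZ -bsumD; apply: eq_bsum => a.
  have dM : dpow (w * l) a = dpow w a * dpow l a.
    by rewrite /dpow invfM !exprMn mulrACA.
  by rewrite !mon_scal dM /e; ring.
have := lim_toD (mtaylor_lim z sG) (laurent fe He); rewrite addr0.
apply: eq_lim_to => D; rewrite -bsumD; apply: eq_bsum => a.
rewrite (ba_c1 s_gt0) -/w /acoef /e; have [pq|qp] := leqP (psum a) (qsum a).
  by rewrite addr0 (eqP pq : (psum a - qsum a)%N = 0%N) expr0 mulr1.
by rewrite (dpow_pos w0 (ltnW qp)) -/H -/G; ring.
Qed.

End Expansion.

(** * Identity theorem and uniqueness of coefficients on the diagonal *)

Section Uniqueness.
Variables (R : realType) (n s : nat).
Hypothesis s_gt0 : (0 < s)%N.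
Local Notation C := (Cplx R).
Local Notation V := 'rV[C]_n.+1.
Local Notation Mh := (Mhat R n s).
Local Notation I := ('I_n + 'I_n)%type.
Implicit Types (z : I -> C) (a : I -> nat) (g : Mh -> C) (c : (I -> nat) -> C).

(** The chart reaches all points with both zeroth coordinates nonzero ([good]). These are dense, as
    adding a small multiple of [E] to p makes both coordinates nonzero, and the lifts are
    continuous. *)
Lemma eq_holo_chart g h : holomorphic g -> holomorphic h ->
  (forall z, wchart s z != 0 -> hlift g (chart1 s z) = hlift h (chart1 s z)) -> g = h.
Proof.
move=> hg hh gh; apply/funext => x.
have good p : Jhat s p != 0 -> p.1 0 ord0 != 0 -> p.2 0 ord0 != 0 -> hlift g p = hlift h p.
  case: p => u v /= p0 u0 v0.
  pose z : I -> C := fun i => match i with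
    inl l => u 0 (lift ord0 l) / u 0 ord0
  | inr l => (Jhat s (u, v))^-1 * u 0 ord0 * v 0 (lift ord0 l) end.
  have wE : wchart s z = (Jhat s (u, v))^-1 * u 0 ord0 * v 0 ord0.
    rewrite /wchart -(mulVf p0) {2}/Jhat big_ord_recl /= (nu0 _ _ s_gt0) mul1r mulrDr.
    rewrite mulr_sumr -mulrA -addrA -[RHS]addr0; congr (_ + _).
    rewrite -sumrB big1// => l _; field.
    by rewrite u0 p0.
  have cE : chart1 s z = ((u 0 ord0)^-1 *: u, ((Jhat s (u, v))^-1 * u 0 ord0) *: v).
    rewrite /chart1 wE; apply: (congr2 (fun x y => (x, y))); apply/rowP => k; rewrite [RHS]mxE.
      by have [l ->|->] := unliftP ord0 k; rewrite ?extend_lift ?extend0 ?mulVf//= mulrC.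
    by have [l ->|->] := unliftP ord0 k; rewrite ?extend_lift ?extend0.
  have a0 : (u 0 ord0)^-1 != 0 by rewrite invr_eq0.
  have b0 : (Jhat s (u, v))^-1 * u 0 ord0 != 0 by rewrite mulf_neq0// invr_eq0.
  have w0 : wchart s z != 0 by rewrite wE mulf_neq0.
  have := gh z w0; rewrite cE.
  by rewrite (hlift_scale g (u, v) a0 b0) (hlift_scale h (u, v) a0 b0).
have [p [hp [-> _]]] := pim_repr x; rewrite -!(hlift_pim _ hp).
have p0 : Jhat s p != 0 by rewrite hp oner_neq0.
apply/eqP; rewrite -subr_eq0; apply/eqP; apply: cabs_small => e e0.
have cf : {for p, continuous (fun q => hlift g q + (-1) * hlift h q)}.
  apply: differentiable_continuous; apply: diff_add; first exact: hlift_diff.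
  by apply: diff_scale; exact: hlift_diff.
have nJ := near_neq0 (diff_Jhat s p) p0.
have [d d0 Hd] : exists2 d : R, 0 < d & forall q, wn (q - p) < d -> Jhat s q != 0 /\
   cabs ((hlift g q + (-1) * hlift h q) - (hlift g p + (-1) * hlift h p)) < e.
  apply/nbhs_wn; near=> q; split; first by near: q.
  by near: q; exact: (continuous_eps cf e0).
have ex0 (y : C) : exists2 r : R, 0 < r & forall t : C, t != 0 -> cabs t < r -> y + t != 0.
  have [->|y0] := eqVneq y 0; first by exists 1 => // t t0 _; rewrite add0r.
  exists (cabs y); first by rewrite cabs_gt0.
  move=> t _ ty; apply/eqP => yt; move: ty.
  by rewrite -[t](addKr y) yt addr0 cabsN ltxx.
have [r1 r10 H1] := ex0 (p.1 0 ord0); have [r2 r20 H2] := ex0 (p.2 0 ord0).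
pose E : V * V := (delta_mx 0 ord0, delta_mx 0 ord0).
have E1 : 0 < wn E + 1 by rewrite ltr_wpDl ?wn_ge0.
pose t := Num.min (Num.min r1 r2) (d / (wn E + 1)) / 2.
have m0 : 0 < Num.min (Num.min r1 r2) (d / (wn E + 1)) by rewrite !lt_min r10 r20 divr_gt0.
have t0 : 0 < t by rewrite divr_gt0.
have at0 : cabs (rc t) = t by rewrite cabs_rc gtr0_norm.
have tm : t < Num.min (Num.min r1 r2) (d / (wn E + 1)) by rewrite /t; lra.
have rt0 : rc t != 0 by rewrite -cabs_gt0 at0.
move: (tm); rewrite !lt_min -andbA => /and3P[t1 t2 t3].
pose q := p + rc t *: E.
have qd : wn (q - p) < d.
  rewrite /q addrAC subrr add0r wnZ at0; rewrite ltr_pdivlMr// in t3.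
  by apply: le_lt_trans t3; rewrite ler_wpM2l ?(ltW t0)// lerDl.
have [q0 Hq] := Hd _ qd.
have qE1 : q.1 0 ord0 = p.1 0 ord0 + rc t by rewrite /q /= !mxE !eqxx mulr1.
have qE2 : q.2 0 ord0 = p.2 0 ord0 + rc t by rewrite /q /= !mxE !eqxx mulr1.
have gq : hlift g q = hlift h q.
  by apply: good => //; rewrite ?qE1 ?qE2; [apply: H1|apply: H2]; rewrite ?at0.
move: Hq; rewrite gq !mulN1r subrr sub0r cabsN; exact: ltW.
Unshelve. all: by end_near. Qed.

Theorem expansion g : holomorphic g -> g = sumf (acoef g).
Proof.
move=> hg; have fg := acoef_fast s_gt0 hg.
apply: eq_holo_chart => //; first exact: sumf_holo.
move=> z w0; apply: (lim_to_unique (expansion_chart s_gt0 hg w0)).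
rewrite (hlift_pim _ (Jhat_c1 s_gt0 z)).
apply: eq_lim_to (sumf_lim _ fg) => D; apply: eq_bsum => a.
by rewrite (hlift_pim _ (Jhat_c1 s_gt0 z)).
Qed.

(* Artin's independence of characters. *)
Lemma artin (J : eqType) (X : Type) (m : X -> X -> X) (e : X) (chi : J -> X -> C) (c : J -> C) (r : seq J) :
  (forall j v w, chi j (m v w) = chi j v * chi j w) -> (forall j, chi j e = 1) ->
  (forall i j, i != j -> exists v, chi i v != chi j v) -> uniq r ->
  (forall v, \sum_(j <- r) c j * chi j v = 0) -> {in r, forall j, c j = 0}.
Proof.
move=> chiM chi1 sep; elim: r c => [//|i r IH] c /andP[ir ur] H.
have cr : {in r, forall j, c j = 0}.
  move=> j jr; have ij : i != j by apply: contraNneq ir => ->.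
  have [v vij] := sep _ _ ij.
  have /(_ _ j jr) := IH (fun k => c k * (chi k v - chi i v)) ur.
  have H' w : \sum_(k <- r) c k * (chi k v - chi i v) * chi k w = 0.
    have := H (m v w); rewrite big_cons chiM => h1.
    have := H w; rewrite big_cons => h2.
    rewrite (eq_bigr (fun k => c k * chi k (m v w) - chi i v * (c k * chi k w))); last first.
      by move=> k _; rewrite chiM; ring.
    rewrite sumrB -mulr_sumr.
    have -> : \sum_(k <- r) c k * chi k (m v w) = - (c i * (chi i v * chi i w)).
      by apply/eqP; rewrite -addr_eq0 addrC h1.
    have -> : \sum_(k <- r) c k * chi k w = - (c i * chi i w).
      by apply/eqP; rewrite -addr_eq0 addrC h2.
    by ring.
  by move=> /(_ H') /eqP; rewrite mulf_eq0 subr_eq0 [_ == chi i v]eq_sym (negPf vij) orbF => /eqP.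
move=> j; rewrite inE => /orP[/eqP ->|]; last exact: cr.
have := H e; rewrite big_cons chi1 mulr1 big_seq big1 ?addr0// => k kr.
by rewrite cr// mul0r.
Qed.

(** If the total degrees differ, x = 2 separates. Otherwise, with m = p' - p > 0, the claim reduces
    to x^m being different from its conjugate, and an m-th root of i serves, since i and -i
    differ. *)
Lemma powers_separate (p q p' q' : nat) : (p, q) != (p', q') ->
  exists x : C, x ^+ p * x^* ^+ q != x ^+ p' * x^* ^+ q'.
Proof.
wlog pp' : p q p' q' / (p <= p')%N.
  move=> W h; have [pp|/ltnW pp] := leqP p p'; first exact: W pp h.
  have h' : (p', q') != (p, q) by rewrite eq_sym.
  by have [x hx] := W _ _ _ _ pp h'; exists x; rewrite eq_sym.
move=> ne; have [pq|pq] := eqVneq (p + q)%N (p' + q')%N; last first.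
  exists (rc 2); rewrite (_ : (rc 2)^* = rc 2); last by rewrite conj_Creal// complex_real.
  rewrite -!exprD; apply: contra pq; rewrite -!rcX (inj_eq (@rc_inj R)) -!natrX eqr_nat.
  by rewrite eqn_exp2l.
have plt : (p < p')%N.
  rewrite ltn_neqAle pp' andbT; apply: contra_neq ne => pe.
  by move: pq; rewrite pe => /addnI ->.
pose m := (p' - p)%N; have m0 : (0 < m)%N by rewrite subn_gt0.
pose x : C := m.-root 'i; have xm : x ^+ m = 'i by rewrite /x rootCK.
have x0 : x != 0 by apply: contra_eq_neq xm => ->; rewrite expr0n gtn_eqF// eq_sym neq0Ci.
have xc0 : x^* != 0 by rewrite conjC_eq0.
have E1 : p' = (p + m)%N by rewrite subnKC// ltnW.
have E2 : q = (q' + m)%N by rewrite E1 in pq; lia.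
exists x; rewrite E1 E2 !exprD -mulrA (inj_eq (mulfI (expf_neq0 p x0))).
rewrite [x ^+ m * _]mulrC (inj_eq (mulfI (expf_neq0 q' xc0))) -rmorphXn /= xm conjCi.
by rewrite eq_sym -subr_eq0 opprK -mulr2n -mulr_natl mulf_neq0 ?neq0Ci ?pnatr_eq0.
Qed.

Definition chi a (v : 'I_n -> C) : C := (\prod_l v l ^+ a (inl l)) * \prod_l (v l)^* ^+ a (inr l).

Lemma chiM a v w : chi a (fun l => v l * w l) = chi a v * chi a w.
Proof.
rewrite /chi [RHS]mulrACA; congr (_ * _); rewrite -big_split /=; apply: eq_bigr => l _.
  by rewrite exprMn.
by rewrite rmorphM exprMn.
Qed.

Lemma chi_le a v : cabs (chi a v) <= (1 + \sum_l cabs (v l)) ^+ msize a.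
Proof.
have h l : cabs (v l) <= 1 + \sum_l cabs (v l).
  by rewrite (bigD1 l)//= addrCA lerDl addr_ge0// sumr_ge0// => j _; exact: cabs_ge0.
have h0 : 0 <= 1 + \sum_l cabs (v l) by rewrite addr_ge0// sumr_ge0// => j _; exact: cabs_ge0.
rewrite /chi cabsM !cabs_prod msizeE exprD /psum /qsum -!prodrXr; apply: ler_pM; rewrite ?prodr_ge0//.
- by move=> l _; exact: cabs_ge0.
- by move=> l _; exact: cabs_ge0.
- by apply: ler_prod => l _; rewrite cabs_ge0 cabsX lerXn2r ?nnegrE ?cabs_ge0.
- by apply: ler_prod => l _; rewrite cabs_ge0 cabsX cabs_conj lerXn2r ?nnegrE ?cabs_ge0.
Qed.

Lemma chi1 a : chi a (fun=> 1) = 1.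
Proof. by rewrite /chi !big1 ?mulr1// => l _; rewrite ?rmorph1 expr1n. Qed.

Lemma chi_single a l (x : C) : chi a (fun k => if k == l then x else 1) =
  x ^+ a (inl l) * x^* ^+ a (inr l).
Proof.
rewrite /chi (bigD1 l)//= [X in _ * X](bigD1 l)//= eqxx !big1 ?mulr1// => k /negPf kl;
by rewrite kl ?rmorph1 expr1n.
Qed.

Lemma chi_separate a b : a <> b -> exists v, chi a v != chi b v.
Proof.
move=> ab; have [l hl] : exists l, (a (inl l), a (inr l)) != (b (inl l), b (inr l)).
  apply: contrapT => /forallNP h; apply: ab; apply/funext => -[l|l].
    by have /negP := h l; rewrite negbK => /eqP[].
  by have /negP := h l; rewrite negbK => /eqP[].
have [x hx] := powers_separate hl.
by exists (fun k => if k == l then x else 1); rewrite !chi_single.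
Qed.

(* The point (sqrt (1 - t^2 kappa), t v) of Z, where kappa = sum nu_k |v_k|^2. *)
Section Point.
Variables (v : 'I_n -> C) (t : R).
Definition kap : R := \sum_l (if (lift ord0 l < s)%N then 1 else - 1) * cabs (v l) ^+ 2.
Hypothesis t1 : 0 < t <= 1.
Hypothesis tk : t * `|kap| <= 2^-1.
Definition z0pt : R := Num.sqrt (1 - t ^+ 2 * kap).

Lemma tk2 : `|t ^+ 2 * kap| <= t * `|kap| * t.
Proof. by rewrite normrM ger0_norm ?sqr_ge0// expr2 mulrAC. Qed.

Lemma z0sq : z0pt ^+ 2 = 1 - t ^+ 2 * kap.
Proof.
rewrite sqr_sqrtr//; have [t0 t11] := andP t1; have := tk2; have := tk.
have : t * `|kap| * t <= t * `|kap| by rewrite ler_piMr// mulr_ge0// ltW.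
have := ler_norm (t ^+ 2 * kap); lra.
Qed.

(** (z0 - 1)(z0 + 1) is - t^2 kappa, and z0 + 1 is at least 1. *)
Lemma z0_dist : `|z0pt - 1| <= t * `|kap|.
Proof.
have z0 : 0 <= z0pt by exact: sqrtr_ge0.
have : `|(z0pt - 1) * (z0pt + 1)| <= t * `|kap|.
  rewrite (_ : _ * _ = z0pt ^+ 2 - 1); last by ring.
  rewrite z0sq addrAC subrr add0r normrN; apply: le_trans tk2 _.
  by have [t0 t11] := andP t1; rewrite ler_piMr// mulr_ge0// ltW.
rewrite normrM [`|z0pt + 1|]ger0_norm ?addr_ge0//; apply: le_trans.
by rewrite ler_peMr// lerDr.
Qed.

Lemma z0_le2 : z0pt <= 2.
Proof. by have := z0_dist; have := tk; have := ler_norm (z0pt - 1); lra. Qed.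

Lemma z0_pow m : `|z0pt ^+ m - 1| <= 2 ^+ m * (t * `|kap|).
Proof.
have z0 : 0 <= z0pt by exact: sqrtr_ge0.
have z2 := z0_le2.
have h0 : 0 <= t * `|kap| by rewrite mulr_ge0// ltW//; have [] := andP t1.
suff H : `|z0pt ^+ m - 1| <= (2 ^+ m - 1) * (t * `|kap|).
  by apply: le_trans H _; rewrite ler_wpM2r// gerBl.
elim: m => [|m IH]; first by rewrite !expr0 !subrr normr0 mul0r.
rewrite (_ : _ - _ = z0pt * (z0pt ^+ m - 1) + (z0pt - 1)); last by rewrite exprS; ring.
apply: le_trans (ler_normD _ _) _; rewrite normrM ger0_norm//.
apply: le_trans (lerD (ler_pM z0 (normr_ge0 _) z2 IH) z0_dist) _.
by rewrite exprS le_eqVlt; apply/orP; left; apply/eqP; ring.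
Qed.

Definition zpt : V := extend (rc z0pt) (fun l => rc t * v l).

Lemma nu_rc (k : 'I_n.+1) : nu R s k = rc (if (k < s)%N then 1 else -1).
Proof. by rewrite /nu; case: ifP => _ //; rewrite rcN. Qed.

Lemma conj_rc (x : R) : (rc x)^* = rc x.
Proof. by rewrite conj_Creal// complex_real. Qed.

Lemma J_zpt : J s zpt = 1.
Proof.
rewrite /J big_ord_recl (nu0 _ _ s_gt0) mul1r extend0 conj_rc -rcM -expr2 z0sq.
rewrite (eq_bigr (fun l => rc (t ^+ 2 * ((if (lift ord0 l < s)%N then 1 else - 1) * cabs (v l) ^+ 2)))); last first.
  move=> l _; rewrite !extend_lift nu_rc rmorphM /= conj_rc -mulrA mulrACA -normCK normE.
  by rewrite -rcM -rcX -!rcM; congr rc; ring.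
rewrite -(big_morph _ (@rcD R) (@rc0 R)) -rcD -mulr_sumr -/kap subrK //.
Qed.

Lemma ba_zpt a : ba a (Delta_red (\pi_(Mred R n s) (exist (fun q => q \in Z s) zpt (mem_set J_zpt) : Z s))) =
  rc (z0pt ^+ (qsum a - psum a + (psum a - qsum a)) * t ^+ msize a) * chi a v.
Proof.
rewrite Delta_redE.
have E : map_mx Num.conj zpt = extend (rc z0pt) (fun l => rc t * (v l)^*).
  apply/rowP => k; rewrite mxE; have [l ->|->] := unliftP ord0 k.
    by rewrite !extend_lift rmorphM /= conj_rc.
  by rewrite !extend0 conj_rc.
rewrite /ba bhatE ?mdegPQ// /= E !mpow_extend Pm0 Qm0 /chi.
under eq_bigr do rewrite Pml exprMn.
under [X in _ * (_ * X)]eq_bigr do rewrite Qml exprMn.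
rewrite !big_split /= !prodrXr -/(psum a) -/(qsum a) msizeE !exprD !rcM !rcX; ring.
Qed.

End Point.

Lemma leq_absdiff p q : (q - p + (p - q) <= p + q)%N.
Proof. by lia. Qed.

(* For points (sqrt (1 - t^2 kappa), t v) of Z with t -> 0, the terms of lowest
   degree form a vanishing linear combination of characters in v. *)
Lemma sumf_eq0 c : fast c -> (forall x : Mred R n s, sumf c (Delta_red x) = 0) -> forall a, c a = 0.
Proof.
move=> fc c0; suff H d : forall a, msize a = d -> c a = 0 by move=> a; exact: (H (msize a)).
elim/ltn_ind: d => d IH a ad.
suff H v : \sum_(b <- [seq b <- index_enum (box I d) | msize (boxi b) == d]) c (boxi b) * chi (boxi b) v = 0.
  have inb : inbox d a.
    by apply/forallP => i; rewrite -ad /msize (bigD1 i)//= leq_addr.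
  pose b : box I d := [ffun i => inord (a i)].
  have bE : boxi b = a by apply/funext => i; rewrite /boxi ffunE inordK// ltnS (forallP inb).
  rewrite -bE; apply: (artin (m := fun v w l => v l * w l) (e := fun=> 1)
    (chi := fun b => chi (boxi b)) (c := fun b : box I d => c (boxi b)) _ _ _ _ H).
  - by move=> j v w; exact: chiM.
  - by move=> j; exact: chi1.
  - move=> i j ij; apply: chi_separate => e; move/eqP: ij; apply.
    by apply/ffunP => k; apply/val_inj; exact: (congr1 (@^~ k) e).
  - by rewrite filter_uniq// index_enum_uniq.
  - by rewrite mem_filter bE ad eqxx mem_index_enum.
clear a ad; rewrite big_filter; apply: cabs_small => e e0.
pose ind a := if msize a == d then c a * chi a v else 0.
have [S HS] : exists S, S = \sum_(b <- index_enum (box I d) | msize (boxi b) == d) c (boxi b) * chi (boxi b) v by eexists.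
rewrite -HS; have SD D : (d <= D)%N -> bsum D ind = S.
  move=> dD; rewrite HS big_mkcond /= -[RHS]/(bsum d ind) (bsum_restrict ind dD) /bsum.
  rewrite [LHS](bigID (fun b : box I D => inbox d (boxi b)))/= [X in _ + X]big1 ?addr0// => b /notin_box db.
  by rewrite /ind gtn_eqF.
have [B B0 HB] : exists2 B : R, 0 < B & forall a, cabs (chi a v) <= B ^+ msize a.
  by exists (1 + \sum_l cabs (v l)); [rewrite ltr_pwDl// sumr_ge0// => l _; exact: cabs_ge0|move=> a0; exact: chi_le].
(* Of the factor 8, a 2 pays for the powers of [z0pt], which is at most 2, and a 4 remains for the
   summation over all indices. *)
have B8 : 0 < 8 * B by rewrite mulr_gt0.
have [M M0 HM] := fc _ B8.
have cchi a : cabs (c a * chi a v) <= M * 8^-1 ^+ msize a.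
  rewrite cabsM exprVn ler_pdivlMr ?exprn_gt0//; apply: le_trans (HM a).
  rewrite exprMn -mulrA ler_wpM2l ?cabs_ge0// mulrC ler_wpM2l ?exprn_ge0//.
pose k := kap v; pose K := 2 ^+ #|{: I}| * (M * (1 + `|k|)) : R.
have K0 : 0 <= K by rewrite mulr_ge0 ?exprn_ge0// mulr_ge0// addr_ge0.
have K1 : 0 < K + 1 by rewrite ltr_wpDl.
have k1 : 0 < 2 * (`|k| + 1) by rewrite mulr_gt0// ltr_wpDl.
(* The first two bounds make [zpt v t] a point of Z; the third makes the final error K t at most
   e. *)
pose t := Num.min (Num.min 1 (2 * (`|k| + 1))^-1) (e / (K + 1)).
have t0 : 0 < t by rewrite !lt_min ltr01 invr_gt0 k1 divr_gt0.
have : t <= t by []; rewrite {2}/t !le_min -andbA => /and3P[t1 tk te].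
have t01 : 0 < t <= 1 by rewrite t0.
have tk' : t * `|kap v| <= 2^-1.
  apply: le_trans (_ : (2 * (`|k| + 1))^-1 * `|k| <= _); first by rewrite ler_wpM2r.
  rewrite ler_pdivrMl// /k; have := normr_ge0 (kap v); lra.
have z2 := z0_le2 t01 tk'; have z00 : 0 <= z0pt v t by exact: sqrtr_ge0.
(* Terms of lower degree vanish by induction, those of higher degree carry t^(d+1), and in degree d
   the power of [z0pt] differs from 1 by a multiple of t. *)
have Htd : cabs (rc (t ^+ d) * S) <= K * t ^+ d.+1.
  pose x : Mred R n s := \pi_(Mred R n s) (exist (fun q => q \in Z s) (zpt v t) (mem_set (J_zpt t01 tk'))  : Z s).
  have L := sumf_lim (Delta_red x) fc; rewrite c0 in L.
  apply/ler_addgt0Pr => e' e'0; have [N HN] := L _ e'0.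
  have := HN (maxn N d) (leq_maxl _ _); rewrite subr0 => H1.
  have H2 : cabs (series c (maxn N d) (Delta_red x) - rc (t ^+ d) * S) <= K * t ^+ d.+1.
    rewrite -(SD (maxn N d)) ?leq_maxr// /series -mulN1r -!bsumZ -bsumD /K -mulrA.
    have h0 : 0 <= M * (1 + `|k|) * t ^+ d.+1 by rewrite mulr_ge0 ?exprn_ge0 ?(ltW t0)// mulr_ge0// addr_ge0.
    apply: (@bsum_le R _ _ _ _ 4^-1) => // [|a]; first by apply/andP; split; lra.
    rewrite ba_zpt mulN1r.
    have E4 m : (8^-1 : R) ^+ m * 2 ^+ m = 4^-1 ^+ m by rewrite -exprMn; congr (_ ^+ _); field.
    have p4 m : 0 <= (4^-1 : R) ^+ m by rewrite exprn_ge0// invr_ge0.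
    have qm : (qsum a - psum a + (psum a - qsum a) <= msize a)%N by rewrite msizeE; apply: leq_absdiff.
    have mm : `|z0pt v t ^+ (qsum a - psum a + (psum a - qsum a))| <= 2 ^+ msize a.
      rewrite ger0_norm ?exprn_ge0//; apply: le_trans (_ : 2 ^+ (qsum a - psum a + (psum a - qsum a)) <= _).
        by apply: lerXn2r; rewrite ?nnegrE.
      by rewrite ler_weXn2l// ler1n.
    rewrite /ind; case: (ltngtP (msize a) d) => ad'.
    - by rewrite (IH _ ad' a erefl) mul0r mulr0 subrr cabs0; apply: mulr_ge0 h0 (p4 _).
    - rewrite mulr0 subr0 mulrCA cabsM cabs_rc normrM mulrC.
      apply: le_trans (ler_pM (cabs_ge0 _) _ (cchi a) (ler_wpM2r _ mm)) _; rewrite ?mulr_ge0//.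
      rewrite mulrA -[_ * _ * 2 ^+ _]mulrA E4 normrX gtr0_norm//.
      rewrite [leRHS]mulrAC; apply: ler_pM; rewrite ?mulr_ge0 ?exprn_ge0 ?(ltW t0)//.
        by rewrite ler_wpM2r// ler_peMr// lerDl.
      by apply: ler_wiXn2l => //; exact: ltW.
    rewrite ad' (_ : _ - _ = rc (t ^+ d) * (rc (z0pt v t ^+ (qsum a - psum a + (psum a - qsum a)) - 1)) * (c a * chi a v)); last first.
      by rewrite rcB rcM rc1; ring.
    rewrite -ad' -rcM cabsM cabs_rc normrM normrX gtr0_norm//.
    have z0p : `|z0pt v t ^+ (qsum a - psum a + (psum a - qsum a)) - 1| <= 2 ^+ msize a * (t * `|k|).
      apply: le_trans (z0_pow _ _ _) _ => //; rewrite ler_wpM2r ?mulr_ge0 ?(ltW t0)//.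
      by rewrite ler_weXn2l// ler1n.
    have ht : 0 <= t ^+ msize a by rewrite exprn_ge0 ?(ltW t0).
    apply: le_trans (ler_pM _ (cabs_ge0 _) (ler_wpM2l ht z0p) (cchi a)) _; first by rewrite mulr_ge0.
    apply: le_trans (_ : M * `|k| * t ^+ (msize a).+1 * 4^-1 ^+ msize a <= _).
      by rewrite -E4 exprSr le_eqVlt; apply/orP; left; apply/eqP; ring.
    by rewrite ler_wpM2r// ler_wpM2r ?exprn_ge0 ?(ltW t0)// ler_wpM2l// lerDr.
  have := cabs_triB (series c (maxn N d) (Delta_red x)) (rc (t ^+ d) * S).
  have := cabs_dist (rc (t ^+ d) * S) (series c (maxn N d) (Delta_red x)); rewrite cabsB.
  move=> h _; rewrite -lerBlDr; apply: le_trans H2; apply: le_trans h; lra.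
move: Htd; rewrite cabsM cabs_rc ger0_norm ?exprn_ge0 ?(ltW t0)// exprSr mulrCA ler_pM2l ?exprn_gt0// => h.
apply: le_trans h _; apply: le_trans (ler_wpM2l K0 te) _.
by rewrite mulrC -mulrA ler_piMr ?(ltW e0)// ler_pdivrMl// mulr1 lerDl.
Qed.

End Uniqueness.

(** * The Frechet space of analytic functions *)

Section Seminorms.
Variables (R : realType).
Local Notation C := (Cplx R).
Variables (E : preTopologicalLmodType C) (p : nat -> E -> R).
Hypothesis pD : forall k x y, p k (x + y) <= p k x + p k y.
Hypothesis pZ : forall k a x, p k (a *: x) = cabs a * p k x.
Hypothesis p_mono : forall k l x, (k <= l)%N -> p k x <= p l x.
Hypothesis p_eq0 : forall x, (forall k, p k x = 0) -> x = 0.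
Hypothesis p_nbhs : forall x (U : set E), nbhs x U <->
  exists k, exists2 e, 0 < e & forall y, p k (y - x) < e -> U y.
Hypothesis p_complete : forall x : nat -> E,
  (forall k l, (k <= l)%N -> p k (x l - x k) <= 2^-1 ^+ k) ->
  exists l, forall k, p k (l - x k) <= 2^-1 ^+ k.

Lemma semi0 k : p k 0 = 0.
Proof. by rewrite -(scale0r 0) pZ cabs0 mul0r. Qed.

Lemma semiN k x : p k (- x) = p k x.
Proof. by rewrite -scaleN1r pZ cabsN cabs1 mul1r. Qed.

Lemma semi_ge0 k x : 0 <= p k x.
Proof. have := pD k x (- x); rewrite subrr semi0 semiN; lra. Qed.

Lemma semi_dist k x y : p k (x - y) = p k (y - x).
Proof. by rewrite -opprB semiN. Qed.

Lemma semi_nbhs x k e : 0 < e -> nbhs x [set y | p k (y - x) < e].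
Proof. by move=> e0; apply/p_nbhs; exists k, e. Qed.

Lemma cabs_nbhs (a : C) (e : R) : 0 < e -> nbhs a [set b | cabs (b - a) < e].
Proof. by move=> e0; apply: (@continuous_eps _ C id a _ e e0); exact: cvg_id. Qed.

Lemma semi_cont_add : continuous (fun q : E * E => q.1 + q.2).
Proof.
move=> [x y] U /p_nbhs[k [e e0 H]]; have e2 : 0 < e / 2 by rewrite divr_gt0.
exists ([set z | p k (z - x) < e / 2], [set z | p k (z - y) < e / 2]).
  by split; exact: semi_nbhs.
move=> [x' y'] /= [h1 h2]; apply: H.
rewrite opprD addrACA; apply: le_lt_trans (pD _ _ _) _; lra.
Qed.

Lemma semi_cont_scale : continuous (fun q : C * E => q.1 *: q.2).
Proof.
move=> [a x] U /p_nbhs[k [e e0 H]].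
have px := semi_ge0 k x; have ca := cabs_ge0 a.
pose d1 := Num.min 1 (e / 2 / (p k x + 1)); pose d2 := e / 2 / (cabs a + 2).
have e2 : 0 < e / 2 by rewrite divr_gt0.
have px1 : 0 < p k x + 1 by rewrite ltr_wpDl.
have ca2 : 0 < cabs a + 2 by rewrite ltr_wpDl.
have d10 : 0 < d1 by rewrite lt_min ltr01 divr_gt0.
have d20 : 0 < d2 by rewrite divr_gt0.
exists ([set b | cabs (b - a) < d1], [set z | p k (z - x) < d2]).
  by split; [exact: cabs_nbhs|exact: semi_nbhs].
move=> [b y] /= [h1 h2]; apply: H.
have -> : b *: y - a *: x = b *: (y - x) + (b - a) *: x.
  by rewrite scalerBr scalerBl addrA subrK.
apply: le_lt_trans (pD _ _ _) _; rewrite !pZ.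
have b2 : cabs b <= cabs a + 2.
  by have := cabs_dist b a; move: h1; rewrite lt_min => /andP[h _]; lra.
have h3 : cabs (b - a) * p k x < e / 2.
  move: h1; rewrite lt_min => /andP[_]; rewrite ltr_pdivlMr// => h.
  by apply: le_lt_trans h; apply: ler_wpM2l; rewrite ?cabs_ge0// lerDl.
have h4 : cabs b * p k (y - x) <= e / 2.
  move: h2; rewrite ltr_pdivlMr// mulrC => /ltW h; apply: le_trans h.
  by apply: ler_wpM2r => //; exact: semi_ge0.
lra.
Qed.

Lemma semi_ball_open k c e : open [set y | p k (y - c) < e].
Proof.
rewrite openE => y /= ye; apply/p_nbhs; exists k, (e - p k (y - c)); first by rewrite subr_gt0.
move=> z h1 /=; have := pD k (z - y) (y - c); rewrite addrA subrK => h2; lra.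
Qed.

Lemma semi_ball_convex k c e : convex_set [set y : E | p k (y - c) < e].
Proof.
have key (x y : E) (a b : C) : 0 <= a -> 0 <= b -> a + b = 1 ->
    p k (x - c) < e -> p k (y - c) < e -> p k (a *: x + b *: y - c) < e.
  move=> a0 b0 ab px py.
  have ab1 : cabs a + cabs b = 1 by apply: rc_inj; rewrite rcD -!normE !ger0_norm// ab rc1.
  have -> : a *: x + b *: y - c = a *: (x - c) + b *: (y - c).
    by rewrite !scalerBr addrACA -opprD -scalerDl ab scale1r.
  apply: le_lt_trans (pD _ _ _) _; rewrite !pZ.
  have ca := cabs_ge0 a; have cb := cabs_ge0 b.
  pose m := Num.max (p k (x - c)) (p k (y - c)).
  have me : m < e by rewrite gt_max px py.
  apply: le_lt_trans me; rewrite -[m]mul1r -ab1 mulrDl.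
  by apply: lerD; apply: ler_wpM2l => //; rewrite le_max lexx ?orbT.
move=> x y l; rewrite !inE => px py; apply: key => //; first by rewrite subr_ge0.
by rewrite addrC subrK.
Qed.

Lemma semi_locally_convex : exists2 B : set_system E,
  (forall b, b \in B -> convex_set b) & basis B.
Proof.
exists [set b | exists k c e, b = [set y | p k (y - c) < e]].
  by move=> b /set_mem[k [c [e ->]]]; exact: semi_ball_convex.
split; first by move=> b [k [c [e ->]]]; exact: semi_ball_open.
move=> x U /p_nbhs[k [e e0 H]]; exists [set y | p k (y - x) < e] => //.
by split; [exists k, x, e|rewrite /= subrr semi0].
Qed.

(** The truncation at 1 / (k + 1) keeps the supremum finite and leaves only finitely many seminorms
    to control for a ball of given radius; by monotonicity one of them is enough. *)
Definition semi_metric x y : R := sup (range (fun k => Num.min k.+1%:R^-1 (p k (x - y)))).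

Lemma semi_metric_ub x y k : Num.min k.+1%:R^-1 (p k (x - y)) <= semi_metric x y.
Proof.
apply: ub_le_sup; last by exists k.
exists 1.
by move=> _ [l _ <-]; rewrite ge_min invf_le1 ?ltr0n ?ler1n.
Qed.

Lemma semi_metric_le x y e :
  (forall k, Num.min k.+1%:R^-1 (p k (x - y)) <= e) -> semi_metric x y <= e.
Proof.
move=> H; apply: ge_sup; first by exists (Num.min 1%:R^-1 (p 0%N (x - y))), 0%N.
by move=> _ [k _ <-].
Qed.

Lemma semi_metrizable : metrizable R E.
Proof.
have mE k x y : 0 <= Num.min k.+1%:R^-1 (p k (x - y)).
  by rewrite le_min invr_ge0 ler0n semi_ge0.
exists semi_metric; split.
- move=> x y; split => [d0|->]; last first.
    apply/eqP; rewrite eq_le; apply/andP; split; last by apply: le_trans (semi_metric_ub _ _ 0%N).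
    by apply: semi_metric_le => k; rewrite subrr semi0 ge_min lexx orbT.
  apply/eqP; rewrite -subr_eq0; apply/eqP/p_eq0 => k; apply/eqP.
  rewrite eq_le semi_ge0 andbT; have := semi_metric_ub x y k.
  by rewrite d0 ge_min leNgt invr_gt0 ltr0n.
- by move=> x y; congr sup; under eq_fun do rewrite semi_dist.
- move=> x y z; apply: semi_metric_le => k.
  apply: le_trans (lerD (semi_metric_ub x y k) (semi_metric_ub y z k)).
  have := pD k (x - y) (y - z); rewrite addrA subrK.
  have := semi_ge0 k (x - y); have := semi_ge0 k (y - z).
  have : 0 <= k.+1%:R^-1 :> R by rewrite invr_ge0.
  by move: (p k (x - y)) (p k (y - z)) (p k (x - z)) (k.+1%:R^-1) => a b c d; rewrite /Num.min; case: (ltP d a) => ?; case: (ltP d b) => ?; case: (ltP d c) => ?; lra.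
move=> x U; split.
  move=> /p_nbhs[k [e e0 H]]; exists (Num.min e k.+1%:R^-1); first by rewrite lt_min e0 invr_gt0 ltr0n.
  move=> y /=; rewrite lt_min => /andP[h1 h2]; apply: H.
  have := semi_metric_ub x y k; rewrite semi_dist => h.
  have := le_lt_trans h h2; rewrite gt_min ltxx /= => h4.
  by move: h; rewrite min_r ?(ltW h4)// => h; exact: le_lt_trans h1.
move=> [e e0 H]; have e2 : 0 < e / 2 by rewrite divr_gt0.
have [K _ HK] := near_infty_natSinv_lt (PosNum e2).
have {}HK : K.+1%:R^-1 < e / 2 by exact: (HK K (leqnn _)).
apply/p_nbhs; exists K, (e / 2) => // y yx; apply: H => /=.
apply: (@le_lt_trans _ _ (e / 2)); last by lra.
apply: semi_metric_le => k; rewrite ge_min semi_dist; have [kK|/ltnW kK] := leqP k K.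
  by rewrite (le_trans (p_mono _ kK) (ltW yx)) orbT.
apply/orP; left; apply: le_trans (ltW HK).
by rewrite lef_pV2 ?posrE ?ltr0n// ler_nat.
Qed.

(** The filter contains sets X k of diameter below 2^-k for p k. Points x k in the intersection of X
    0, ..., X k form a sequence to which [p_complete] applies, and its limit attracts the filter. *)
Lemma semi_filter_complete (F : set_system E) : ProperFilter F ->
  (forall U : set E, nbhs 0 U -> exists2 X, F X & forall x y, X x -> X y -> U (x - y)) ->
  exists x : E, F --> x.
Proof.
move=> FF cF; have p2 k : 0 < (2^-1 : R) ^+ k by rewrite exprn_gt0// invr_gt0.
have HX k : exists X, F X /\ forall x y, X x -> X y -> p k (x - y) < 2^-1 ^+ k.
  have [X FX HX] := cF _ (semi_nbhs 0 k (p2 k)); exists X; split => // x y Xx Xy.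
  by have := HX x y Xx Xy; rewrite /= subr0.
have [X /all_and2[FX XE]] := choice HX.
have FI k : F [set x | forall l, (l <= k)%N -> X l x].
  elim: k => [|k IH]; first by apply: filterS (FX 0%N) => x x0 l; rewrite leqn0 => /eqP ->.
  apply: filterS (filterI IH (FX k.+1)) => x [h1 h2] l; rewrite leq_eqVlt => /orP[/eqP -> //|].
  by rewrite ltnS; exact: h1.
have [x Hx] := choice (fun k => filter_ex (FI k)).
have [l Hl] : exists l, forall k, p k (l - x k) <= 2^-1 ^+ k.
  by apply: p_complete => k m km; apply/ltW/XE; exact: Hx.
exists l => U /p_nbhs[k [e e0 H]].
have [m' Hm'] := pow2_small (divr_gt0 e0 (ltr0n R 2)).
pose m := maxn k m'.
have hm : 2^-1 ^+ m + 2^-1 ^+ m < e.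
  have : (2^-1 : R) ^+ m <= 2^-1 ^+ m' by rewrite ler_wiXn2l ?invr_ge0 ?invf_le1 ?ler1n ?leq_maxr.
  by move: Hm'; lra.
apply: filterS (FX m) => y Xy; apply: H.
apply: le_lt_trans (p_mono _ (leq_maxl k m')) _; rewrite -/m.
have := pD m (y - x m) (x m - l); rewrite addrA subrK [p m (x m - l)]semi_dist.
have := XE m y (x m) Xy (Hx m m (leqnn _)); have := Hl m; move: hm.
set A1 := 2^-1 ^+ m; lra.
Qed.

Lemma semi_frechet : frechet_space E.
Proof.
split; [exact: semi_cont_add|exact: semi_cont_scale|exact: semi_locally_convex
       |exact: semi_metrizable|exact: semi_filter_complete].
Qed.

Lemma semi_bilinear_continuous (mul : E -> E -> E) :
  (forall f, linear (mul f)) -> (forall g, linear (mul^~ g)) ->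
  (forall k, exists m, exists2 K, 0 <= K & forall f g, p k (mul f g) <= K * p m f * p m g) ->
  continuous (fun q : E * E => mul q.1 q.2).
Proof.
move=> lr ll bd.
have mulDr f g h : mul f (g + h) = mul f g + mul f h by have := lr f 1 g h; rewrite !scale1r.
have mulDl f g h : mul (f + g) h = mul f h + mul g h by have := ll h 1 f g; rewrite !scale1r.
move=> [f g] U /p_nbhs[k [e e0 H]]; have [m [K K0 HK]] := bd k.
have [f0 g0] := (semi_ge0 m f, semi_ge0 m g).
(* The three parts of the difference of products sum to at most K d (1 + p m f + p m g) = d (L - 1),
   which is strictly below d L <= e. *)
pose L := K * (1 + p m f + p m g) + 1.
have L0 : 0 < L by rewrite ltr_wpDl// mulr_ge0// !addr_ge0.
pose d := Num.min 1 (e / L); have d0 : 0 < d by rewrite lt_min ltr01 divr_gt0.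
exists ([set z | p m (z - f) < d], [set z | p m (z - g) < d]).
  by split; exact: semi_nbhs.
move=> [f' g'] /= [h1 h2]; apply: H.
have -> : mul f' g' - mul f g = mul (f' - f) (g' - g) + (mul (f' - f) g + mul f (g' - g)).
  have key u v : mul (u + f) (v + g) - mul f g = mul u v + (mul u g + mul f v).
    by rewrite mulDl !mulDr !addrA addrK.
  by rewrite -key !subrK.
apply: le_lt_trans (pD _ _ _) _; apply: le_lt_trans (lerD (HK _ _) (pD _ _ _)) _.
apply: le_lt_trans (lerD (lexx _) (lerD (HK _ _) (HK _ _))) _.
have [u0 v0] := (semi_ge0 m (f' - f), semi_ge0 m (g' - g)).
have dd : d * d <= d by rewrite ler_piMr ?(ltW d0)// ge_min lexx.
have uv : p m (f' - f) * p m (g' - g) <= d by apply: le_trans dd; apply: ler_pM => //; exact: ltW.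
have ug : p m (f' - f) * p m g <= d * p m g by rewrite ler_wpM2r// ltW.
have vf : p m f * p m (g' - g) <= d * p m f by rewrite mulrC ler_wpM2r// ltW.
have dL : d * L <= e.
  by rewrite -ler_pdivlMr// ge_min lexx orbT.
apply: lt_le_trans dL; rewrite -!mulrA.
apply: (@le_lt_trans _ _ (K * d + (K * (d * p m g) + K * (d * p m f)))).
  by rewrite !lerD// ler_wpM2l.
rewrite -subr_gt0 (_ : _ - _ = d)// /L; ring.
Qed.

Lemma semi_additive_continuous (inv : E -> E) : (forall f g, inv (f - g) = inv f - inv g) ->
  (forall k f, p k (inv f) <= p k f) -> continuous inv.
Proof.
move=> invB bd f U /p_nbhs[k [e e0 H]]; apply/p_nbhs; exists k, e => // y ye.
by apply: H; rewrite -invB; exact: le_lt_trans ye.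
Qed.

End Seminorms.

(** * Coefficients of analytic functions and weighted norms *)

Section Coefficients.
Variables (R : realType) (n s : nat).
Hypothesis s_gt0 : (0 < s)%N.
Local Notation C := (Cplx R).
Local Notation Mh := (Mhat R n s).
Local Notation AA := (A R n s).
Local Notation I := ('I_n + 'I_n)%type.
Implicit Types (a : I -> nat) (c d : (I -> nat) -> C) (f g : AA).

Lemma extension_holo f : holomorphic (extension f).
Proof. by rewrite /extension; case: cid => g []. Qed.

Lemma extensionE f x : f x = (extension f : Mh -> C) (Delta_red x).
Proof. by rewrite /extension; case: cid => g /= [_ {1}->]. Qed.

Definition coef f : (I -> nat) -> C := acoef (extension f : Mh -> C).

Lemma coef_fast f : fast (coef f).
Proof. apply: acoef_fast => //; exact: extension_holo. Qed.

Lemma extension_sumf f : (extension f : Mh -> C) = sumf (coef f).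
Proof. apply: expansion => //; exact: extension_holo. Qed.

Lemma coef_val f x : lim_to (fun D => series (coef f) D (Delta_red x)) (f x).
Proof. rewrite extensionE extension_sumf; apply: sumf_lim; exact: coef_fast. Qed.

(** The difference of the two families sums to 0 on the diagonal, so [sumf_eq0] applies. The rules
    for [coef] below are thereby read off from values at points of the reduced space. *)
Lemma coef_unique f c : fast c ->
  (forall x, lim_to (fun D => series c D (Delta_red x)) (f x)) -> coef f = c.
Proof.
move=> fc H; apply/funext => a; apply/eqP; rewrite -subr_eq0; apply/eqP.
have fe := fastB (coef_fast f) fc.
apply: (sumf_eq0 s_gt0 fe) => x; apply: (lim_to_unique (sumf_lim _ fe)).
rewrite -(subrr (f x)) -mulN1r.
apply: eq_lim_to (lim_toD (coef_val f x) (lim_toZ (-1) (H x))) => D.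
by rewrite /series -bsumZ -bsumD; apply: eq_bsum => b; ring.
Qed.

Lemma fastD c d : fast c -> fast d -> fast (fun a => c a + d a).
Proof.
move=> fc fd r r0; have [M M0 HM] := fc r r0; have [N N0 HN] := fd r r0.
exists (M + N); first exact: addr_ge0.
move=> a; apply: le_trans (_ : (cabs (c a) + cabs (d a)) * r ^+ msize a <= _).
  by rewrite ler_wpM2r ?exprn_ge0 ?(ltW r0) ?cabsD.
by rewrite mulrDl lerD.
Qed.

Lemma fast_scale k c : fast c -> fast (fun a => k * c a).
Proof.
move=> fc r r0; have [M M0 HM] := fc r r0.
exists (cabs k * M); first by rewrite mulr_ge0 ?cabs_ge0.
by move=> a; rewrite cabsM -mulrA ler_wpM2l ?cabs_ge0.
Qed.

Lemma coefD f g : coef (f + g) = fun a => coef f a + coef g a.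
Proof.
apply: coef_unique; first by apply: fastD; exact: coef_fast.
move=> x; apply: eq_lim_to (lim_toD (coef_val f x) (coef_val g x)) => D.
by rewrite /series -bsumD; apply: eq_bsum => b; ring.
Qed.

Lemma coefZ k f : coef (k *: f) = fun a => k * coef f a.
Proof.
apply: coef_unique; first by apply: fast_scale; exact: coef_fast.
move=> x; apply: eq_lim_to (lim_toZ k (coef_val f x)) => D.
by rewrite /series -bsumZ; apply: eq_bsum => b; ring.
Qed.

Lemma coefB f g : coef (f - g) = fun a => coef f a - coef g a.
Proof. by rewrite -scaleN1r coefD coefZ; apply/funext => a; rewrite mulN1r. Qed.

Lemma coef0 : coef 0 = fun=> 0.
Proof. by rewrite -(subrr 0) coefB; apply/funext => a; rewrite subrr. Qed.

Lemma coef_sum (J : Type) (r : seq J) (P : pred J) (F : J -> AA) a :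
  coef (\sum_(j <- r | P j) F j) a = \sum_(j <- r | P j) coef (F j) a.
Proof.
apply: (big_morph (fun f => coef f a)); last by rewrite coef0.
by move=> f g; rewrite coefD.
Qed.

Lemma coef_inj f g : coef f = coef g -> f = g.
Proof.
move=> fg; apply/val_inj/funext => x /=; apply: (lim_to_unique (coef_val f x)).
by rewrite fg; exact: coef_val.
Qed.

Fact sumf_analytic c : fast c -> (sumf c : Mh -> C) \o @Delta_red R n s \in @analytic_pred R n s.
Proof. by move=> fc; apply/asboolP; exists (sumf c) => //; exact: sumf_holo. Qed.

(** The inverse of [coef] on rapidly decreasing families, with junk value 0 elsewhere. *)
Definition elem c : AA := xget 0 [set f | coef f = c].

Lemma coef_elem c : fast c -> coef (elem c) = c.
Proof.
move=> fc; apply: (xgetPex 0 (P := [set f | coef f = c])).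
exists (AnalyticFun (sumf_analytic fc)); apply: coef_unique => // x.
exact: sumf_lim.
Qed.

Definition kronecker a : (I -> nat) -> C := fun b => ([forall i, a i == b i])%:R.

Lemma dltP a b : kronecker a b = if `[< a = b >] then 1 else 0.
Proof.
rewrite /kronecker; case: asboolP => [->|ab].
  by rewrite (_ : [forall i, _])//; apply/forallP.
rewrite (_ : [forall i, _] = false)//; apply/negP => /forallP h; apply: ab.
by apply/funext => i; exact/eqP.
Qed.

Lemma dlt_fast a : fast (kronecker a).
Proof.
move=> r r0; exists (r ^+ msize a); first by rewrite exprn_ge0 ?(ltW r0).
move=> b; rewrite dltP; case: asboolP => [->|_]; first by rewrite cabs1 mul1r.
by rewrite cabs0 mul0r exprn_ge0 ?(ltW r0).
Qed.

Lemma inbox_msize (J : finType) (b : J -> nat) D : (msize b <= D)%N -> inbox D b.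
Proof.
move=> bD; apply/forallP => i; apply: leq_trans bD.
by rewrite /msize (bigD1 i)//= leq_addr.
Qed.

Lemma bsum_single (J : finType) (b0 : J -> nat) (F : (J -> nat) -> C) D : (msize b0 <= D)%N ->
  (forall b, b <> b0 -> F b = 0) -> bsum D F = F b0.
Proof.
move=> bD H; pose b1 : box J D := [ffun i => inord (b0 i)].
have bE : boxi b1 = b0.
  by apply/funext => i; rewrite /boxi ffunE inordK// ltnS; have /forallP := inbox_msize bD.
rewrite /bsum (bigD1 b1)//= bE big1 ?addr0// => b /eqP bb; apply: H => bb0; apply: bb.
by apply/ffunP => i; apply/val_inj; have := congr1 (@^~ i) bb0; rewrite -bE.
Qed.

(* b_{P,Q}, with the junk value 0 when b_{P,Q} is not analytic. *)
Definition mono P Q : AA := insubd 0 (b_red P Q).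

Lemma monoE P Q : mdeg P = mdeg Q -> mono P Q = b_red P Q :> (Mred R n s -> C).
Proof. by move=> PQ; rewrite /mono insubdK// b_red_analytic. Qed.

Lemma monomialE P Q (PQ : mdeg P = mdeg Q) : monomial R s PQ = mono P Q.
Proof. by apply/val_inj; rewrite /= monoE. Qed.

Definition eb a : AA := mono (Pm a) (Qm a).

Lemma ebE a : eb a = mono (Pm a) (Qm a).
Proof. by []. Qed.

Lemma ba_Delta a x : ba a (Delta_red x) = eb a x.
Proof.
rewrite /eb monoE ?mdegPQ// /b_red /Delta_red /ba bhatE ?mdegPQ//.
Qed.

Lemma coef_eb a : coef (eb a) = kronecker a.
Proof.
apply: coef_unique; first exact: dlt_fast.
move=> x e e0; exists (msize a) => D aD.
rewrite /series (bsum_single aD) => [|b ba].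
  by rewrite dltP; case: asboolP => // _; rewrite mul1r ba_Delta subrr cabs0 ltW.
by rewrite dltP; case: asboolP => [ab|_]; [case: ba|rewrite mul0r].
Qed.

Definition wcoef k f := fun a => cabs (coef f a) * k.+1%:R ^+ msize a.
(** The integral bases k + 1 are cofinal among all geometric weights by [nat_bound], which gives a
    countable increasing family. *)
Definition snorm k f : R := sup (range (wcoef k f)).

Lemma snorm_ub k f a : cabs (coef f a) * k.+1%:R ^+ msize a <= snorm k f.
Proof.
rewrite -[leLHS]/(wcoef k f a); apply: ub_le_sup; last by exists a.
have [M _ HM] := coef_fast f (ltr0Sn _ k); exists M.
by move=> _ [b _ <-]; exact: HM.
Qed.

Lemma snorm_le k f e : (forall a, cabs (coef f a) * k.+1%:R ^+ msize a <= e) -> snorm k f <= e.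
Proof.
move=> H; apply: ge_sup; first by exists (wcoef k f (fun=> 0%N)), (fun=> 0%N).
by move=> _ [k' _ <-]; exact: H.
Qed.

Lemma snorm_ge0 k f : 0 <= snorm k f.
Proof. by apply: le_trans (snorm_ub k f (fun=> 0%N)); rewrite mulr_ge0 ?cabs_ge0. Qed.

Lemma snormD k f g : snorm k (f + g) <= snorm k f + snorm k g.
Proof.
apply: snorm_le => a; apply: le_trans (lerD (snorm_ub k f a) (snorm_ub k g a)).
by rewrite -mulrDl coefD ler_wpM2r ?cabsD.
Qed.

Lemma snormZ k x f : snorm k (x *: f) = cabs x * snorm k f.
Proof.
have H y g : snorm k (y *: g) <= cabs y * snorm k g.
  apply: snorm_le => a; rewrite coefZ cabsM -mulrA ler_wpM2l ?cabs_ge0//.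
  exact: snorm_ub.
apply/eqP; rewrite eq_le H /=; have [->|x0] := eqVneq x 0.
  by rewrite cabs0 mul0r; exact: snorm_ge0.
have := H x^-1 (x *: f); rewrite scalerA mulVf// scale1r cabsV ler_pdivlMl ?cabs_gt0 //.
Qed.

Lemma snorm_mono k l f : (k <= l)%N -> snorm k f <= snorm l f.
Proof.
move=> kl; apply: snorm_le => a; apply: le_trans (snorm_ub l f a).
by rewrite ler_wpM2l ?cabs_ge0// lerXn2r ?nnegrE// ler_nat.
Qed.

Lemma coef_le0 k f a : cabs (coef f a) <= snorm k f.
Proof.
apply: le_trans (snorm_ub k f a); rewrite ler_peMr ?cabs_ge0// exprn_ege1// ler1n //.
Qed.

Lemma snorm_eq0 f : (forall k, snorm k f = 0) -> f = 0.
Proof.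
move=> H; apply: coef_inj; rewrite coef0; apply/funext => a; apply/eqP.
by rewrite -cabs_eq0 eq_le cabs_ge0 -(H 0%N) coef_le0.
Qed.

Lemma nat_bound (r : R) : exists k : nat, r <= k.+1%:R.
Proof.
exists (Num.bound `|r|); apply: le_trans (ler_norm _) (ltW _).
by apply: lt_le_trans (archi_boundP (normr_ge0 r)) _; rewrite ler_nat.
Qed.
End Coefficients.

(** * Locally uniform convergence in terms of coefficients *)

Section Topology.
Variables (R : realType) (n s : nat).
Hypothesis s_gt0 : (0 < s)%N.
Local Notation C := (Cplx R).
Local Notation V := 'rV[C]_n.+1.
Local Notation Mh := (Mhat R n s).
Local Notation AA := (A R n s).
Local Notation I := ('I_n + 'I_n)%type.
Implicit Types (a : I -> nat) (c d : (I -> nat) -> C) (f g : AA).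

(** Limits are taken coefficientwise. The rate in the norm k survives the limit and, for every k,
    also shows that the limit family decreases rapidly. *)
Lemma snorm_complete (x : nat -> AA) :
  (forall k l, (k <= l)%N -> snorm k (x l - x k) <= 2^-1 ^+ k) ->
  exists l, forall k, snorm k (l - x k) <= 2^-1 ^+ k.
Proof.
move=> H.
have HL a : exists l, forall D, cabs (coef (x D) a - l) <= 2^-1 ^+ D.
  have [D D' DD|l _ Hl] := @lim_to_rate _ (fun k => coef (x k) a) 1; last first.
    by exists l => D; have := Hl D; rewrite mul1r.
  rewrite mul1r; apply: le_trans (H _ _ DD); have := coef_le0 s_gt0 D (x D' - x D) a.
  by rewrite coefB.
have [c Hc] := choice HL.
have rate k a : cabs (c a - coef (x k) a) * k.+1%:R ^+ msize a <= 2^-1 ^+ k.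
  have w0 : 0 < (k.+1%:R : R) ^+ msize a by rewrite exprn_gt0.
  rewrite -ler_pdivlMr//; apply/ler_addgt0Pr => e e0.
  have [N HN] := pow2_small e0; pose D := maxn k N.
  have h1 : cabs (coef (x D) a - c a) <= e.
    apply: le_trans (Hc a D) _; apply: le_trans (ltW HN).
    by rewrite ler_wiXn2l ?invr_ge0 ?invf_le1 ?ler1n ?leq_maxr.
  have h2 : cabs (coef (x D) a - coef (x k) a) <= 2^-1 ^+ k / k.+1%:R ^+ msize a.
    rewrite ler_pdivlMr//; apply: le_trans (H k D (leq_maxl _ _)).
    by have := snorm_ub s_gt0 k (x D - x k) a; rewrite coefB.
  have -> : c a - coef (x k) a = (coef (x D) a - coef (x k) a) - (coef (x D) a - c a) by ring.
  by apply: le_trans (cabs_triB _ _) _; exact: lerD.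
have fc : fast c.
  move=> r r0; have [k rk] := nat_bound r; exists (2^-1 ^+ k + snorm k (x k)).
    by rewrite addr_ge0 ?snorm_ge0// exprn_ge0// invr_ge0.
  move=> a; apply: le_trans (lerD (rate k a) (snorm_ub s_gt0 k (x k) a)).
  rewrite -mulrDl; apply: ler_pM; rewrite ?cabs_ge0 ?exprn_ge0 ?(ltW r0)//.
    by apply: le_trans (cabsD _ _); rewrite subrK.
  by rewrite lerXn2r ?nnegrE ?(ltW r0).
exists (@elem R n s c) => k; apply: snorm_le => a; rewrite coefB// coef_elem//.
Qed.

Lemma extension_bound (B : R) : exists k, forall f (y : Mh), hsize y <= B ->
  cabs ((extension f : Mh -> C) y) <= 2 ^+ #|{: I}| * snorm k f.
Proof.
(* The base absorbs the growth of the basis functions on [hsize y <= B] and leaves 2^-|a| for the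
   summation. *)
have [k Hk] := nat_bound (2 * (1 + `|B|)); exists k => f y yB.
have fc := coef_fast s_gt0 f; rewrite extension_sumf//.
apply: lim_to_le (sumf_lim y fc) _ => D.
apply: (@bsum_le R _ D _ _ 2^-1); first exact: snorm_ge0.
  by rewrite invr_ge0 ler0n lexx.
move=> a; rewrite cabsM.
have B0 : 0 < 1 + `|B| by rewrite ltr_wpDr.
have y1 : hsize y <= `|B| by apply: le_trans yB (ler_norm _).
apply: le_trans (ler_wpM2l (cabs_ge0 _) (ba_le a y1)) _.
rewrite exprVn ler_pdivlMr ?exprn_gt0// -mulrA -exprMn.
apply: le_trans (snorm_ub s_gt0 k f a); apply: ler_wpM2l; first exact: cabs_ge0.
by rewrite lerXn2r ?nnegrE ?mulr_ge0 ?(ltW B0)// mulrC.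
Qed.

Lemma hsize_continuous : continuous (fun x : Mh => rc (hsize x) : C).
Proof.
apply/quotient_continuous.
pose vv (q : V * V) : C := rc (vn q.1 * vn q.2).
rewrite (_ : _ \o _ = vv \o set_val); last first.
  apply/funext => q; have hq : Jhat s (val q) = 1 by exact: set_mem (valP q).
  rewrite /= /vv -[set_val q]/(val q) -(hsize_pim hq); congr (rc (hsize (\pi_Mh _))); exact: val_inj.
move=> q; apply: continuous_comp; first exact: initial_continuous.
move: (set_val q) => {q} p.
have -> : vv = fun q => (\sum_k `|q.1 0 k|) * (\sum_k `|q.2 0 k|).
  apply/funext => q; rewrite /vv rcM /vn !(big_morph _ (@rcD R) (@rc0 R)).
  by congr (_ * _); apply: eq_bigr => k _; rewrite normE.
have c1 (k : 'I_n.+1) : {for p, continuous (fun q : V * V => `|q.1 0 k|)}.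
  by apply: cvg_norm; apply: differentiable_continuous; exact: diff_entry1.
have c2 (k : 'I_n.+1) : {for p, continuous (fun q : V * V => `|q.2 0 k|)}.
  by apply: cvg_norm; apply: differentiable_continuous; exact: diff_entry2.
have cs (F : 'I_n.+1 -> V * V -> C) : (forall k, {for p, continuous (F k)}) ->
    {for p, continuous (fun q => \sum_k F k q)}.
  by move=> cF; apply: cvg_big => [|k _]; [exact: add_continuous|exact: cF].
have h1 := cs _ c1; have h2 := cs _ c2.
exact: (cvgM h1 h2).
Qed.

Lemma compact_hsize (K : set Mh) : compact K -> exists B : R, forall x, K x -> hsize x <= B.
Proof.
move=> cK; have [B HB] := compact_cabs_bounded cK hsize_continuous.
by exists B => x /HB; rewrite cabs_rc ger0_norm// hsize_ge0.
Qed.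

Lemma A_cvg (F : set_system AA) f : Filter F ->
  (F --> f <-> forall K : set Mh, compact K -> forall e : R, 0 < e ->
     \forall g \near F, forall x, K x -> cabs ((extension g : Mh -> C) x - (extension f : Mh -> C) x) < e).
Proof.
move=> FF; split.
  move=> Ff K cK e e0.
  have : @extension R n s @ F --> (extension f : {family compact, Mh -> C}).
    by move=> W wW; apply: Ff; exact: (@initial_continuous AA {family compact, Mh -> C} (@extension R n s) f W wW).
  move=> /(@fam_cvgP _ _ compact _ (extension f)) /(_ K cK) /(_ [set h | forall x, K x -> cabs (h x - (extension f : Mh -> C) x) < e]).
  apply; apply/uniform_nbhs; exists [set p : C * C | cabs (p.2 - p.1) < e]; split => //.
  rewrite -entourage_from_ballE; exists (rc e) => /=; first by rewrite rc_gt0.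
  by move=> [x y] /=; rewrite -ball_normE /ball_ /= distrC normE rc_ltr.
move=> H U.
have h : nbhs (f : initial_topology (@extension R n s : AA -> {family compact, Mh -> C})) U -> F U.
  rewrite nbhsE; case=> O [[W oW <-] fW] WU; apply: filterS WU _.
  suff : @extension R n s @ F --> (extension f : {family compact, Mh -> C}) by apply; exact: open_nbhs_nbhs.
  apply/fam_cvgP => K cK P /uniform_nbhs[E [/= eE EP]].
  move: eE; rewrite -entourage_from_ballE => -[_ /= /rc_gt0P[e e0 ->] eE].
  apply: filterS (H K cK e e0) => g Hg; apply: EP => y Ky; apply: eE => /=.
  by rewrite -ball_normE /ball_ /= distrC normE rc_ltr; exact: Hg.
exact: h.
Qed.

Lemma extensionB f g x :
  (extension (g - f) : Mh -> C) x = (extension g : Mh -> C) x - (extension f : Mh -> C) x.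
Proof.
rewrite !extension_sumf//.
have H := lim_toD (sumf_lim x (coef_fast s_gt0 g)) (lim_toZ (-1) (sumf_lim x (coef_fast s_gt0 f))).
rewrite mulN1r in H; apply: lim_to_unique (sumf_lim _ _) (eq_lim_to _ H); first exact: coef_fast.
by move=> D; rewrite /series -bsumZ -bsumD; apply: eq_bsum => b; rewrite coefB//; ring.
Qed.

(** Small norms give small values on a compact set, because [hsize] is bounded there and
    [extension_bound] applies. Conversely, smallness on the union of the compact sets of radius 2 (k
    + 1) of both charts gives a small norm of index k by [acoef_bound]. *)
Lemma A_nbhs f (U : set AA) : nbhs f U <->
  exists k, exists2 e, 0 < e & forall g, snorm k (g - f) < e -> U g.
Proof.
split.
  pose G := filter_from [set ke : nat * R | 0 < ke.2] (fun ke => [set g | snorm ke.1 (g - f) < ke.2]).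
  have FG : Filter G.
    apply: filter_from_filter; first by exists (0%N, 1); rewrite /= ltr01.
    move=> [k e] [l e'] /= e0 e'0; exists (maxn k l, Num.min e e').
      by rewrite /= lt_min e0 e'0.
    move=> g /=; rewrite lt_min => /andP[h1 h2]; split.
      by apply: le_lt_trans h1; apply: snorm_mono => //; exact: leq_maxl.
    by apply: le_lt_trans h2; apply: snorm_mono => //; exact: leq_maxr.
  suff Gf : G --> f by move=> /Gf[[k e] /= e0 H]; exists k, e.
  apply/A_cvg => K cK e e0; have [B HB] := compact_hsize cK.
  have [k Hk] := extension_bound B.
  have p0 : 0 < (2 : R) ^+ #|{: I}| by rewrite exprn_gt0.
  exists (k, e / 2 ^+ #|{: I}|); first by rewrite /= divr_gt0.
  move=> g /=; rewrite ltr_pdivlMr// mulrC => ge x Kx; apply: le_lt_trans ge.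
  by rewrite -extensionB; exact/Hk/HB.
move=> [k [e e0 H]].
pose r : R := k.+1%:R; have r0 : 0 < 2 * r by rewrite mulr_gt0// ltr0n.
have c0 : 0 < 4 ^+ #|{: I}| * 2 :> R by rewrite mulr_gt0// exprn_gt0.
have h := (@A_cvg (nbhs f) f (nbhs_filter f)).1 cvg_id _ (@K_compact R n s s_gt0 (2 * r)) _ (divr_gt0 e0 c0).
apply: filterS h => g Hg; apply: H.
apply: (@le_lt_trans _ _ (e / 2)); last by lra.
apply: snorm_le => a.
have := @acoef_bound R n s s_gt0 (extension (g - f)) (2 * r) (e / (4 ^+ #|{: I}| * 2)) a
  (extension_holo (g - f)) r0.
have -> : 2 * r / 2 = r by field.
rewrite ler_pdivlMr ?exprn_gt0 ?ltr0n//.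
have -> : 4 ^+ #|{: I}| * (e / (4 ^+ #|{: I}| * 2)) = e / 2.
  have : 4 ^+ #|{: I}| != 0 :> R by rewrite expf_neq0// pnatr_eq0.
  by move: (4 ^+ #|{: I}|) => q q0; field; rewrite q0.
by apply => x Kx; rewrite extensionB ltW// Hg.
Qed.

Lemma A_frechet : frechet_space AA.
Proof.
apply: (semi_frechet (p := @snorm R n s)).
- exact: snormD.
- exact: snormZ.
- exact: snorm_mono.
- exact: snorm_eq0.
- exact: A_nbhs.
- exact: snorm_complete.
Qed.

End Topology.

Lemma nbhs_preimage (T U : topologicalType) (f : T -> U) x (W : set U) :
  continuous f -> nbhs (f x) W -> nbhs x (f @^-1` W).
Proof. by move=> cf; exact: cf. Qed.

(** * The star product *)

Section BilinearExtension.
Variables (R : realType) (n s : nat).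
Hypothesis s_gt0 : (0 < s)%N.
Local Notation C := (Cplx R).
Local Notation AA := (A R n s).
Local Notation I := ('I_n + 'I_n)%type.
Local Notation II := (I + I)%type.
Implicit Types (a b : I -> nat) (m : II -> nat) (f g : AA).

Lemma msize_pair m : msize m = (msize (m \o inl) + msize (m \o inr))%N.
Proof. by rewrite /msize big_sumType. Qed.

Definition truncation D f : AA := \sum_(a : box I D) coef f (boxi a) *: eb R s (boxi a).

Lemma bsum_dlt D (F : (I -> nat) -> C) a :
  bsum D (fun b => F b * kronecker R b a) = if inbox D a then F a else 0.
Proof.
have [aD|aD] := boolP (inbox D a).
  pose b1 : box I D := [ffun i => inord (a i)].
  have bE : boxi b1 = a.
    by apply/funext => i; rewrite /boxi ffunE inordK// ltnS; have /forallP := aD.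
  rewrite /bsum (bigD1 b1)//= bE dltP; case: asboolP => // _; rewrite mulr1 big1 ?addr0//.
  move=> b /eqP bb; rewrite dltP; case: asboolP; rewrite ?mulr0// => ba; case: bb.
  by apply/ffunP => i; apply/val_inj; have := congr1 (@^~ i) ba; rewrite -bE.
rewrite /bsum big1// => b _; rewrite dltP; case: asboolP; rewrite ?mulr0// => ba.
case/negP: aD; rewrite -ba; apply/forallP => i; rewrite /boxi -ltnS; exact: ltn_ord.
Qed.

Lemma truncation_rate (k l : nat) f : 2 * k.+1%:R <= l.+1%:R :> R -> forall D,
  snorm k (truncation D f - f) <= snorm l f * 2^-1 ^+ D.
Proof.
move=> kl D; apply: snorm_le => a; rewrite coefB// /truncation coef_sum//.
under eq_bigr do rewrite coefZ// coef_eb//.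
rewrite -[X in cabs (X - _)]/(bsum D (fun b => coef f b * kronecker R b a)) bsum_dlt.
have f0 : 0 <= snorm l f * 2^-1 ^+ D by rewrite mulr_ge0 ?snorm_ge0// exprn_ge0// invr_ge0.
case: ifPn => [_|/notin_box/ltnW aD]; first by rewrite subrr cabs0 mul0r.
rewrite sub0r cabsN; apply: le_trans (_ : snorm l f * 2^-1 ^+ msize a <= _); last first.
  by rewrite ler_wpM2l ?snorm_ge0// ler_wiXn2l ?invr_ge0 ?invf_le1 ?ler1n.
rewrite exprVn ler_pdivlMr ?exprn_gt0//; apply: le_trans (snorm_ub s_gt0 l f a).
by rewrite -mulrA -exprMn ler_wpM2l ?cabs_ge0// lerXn2r ?nnegrE ?mulr_ge0// mulrC.
Qed.

(** The span of the basis is dense: by [truncation_rate] the truncations of f converge to f in every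
    norm. *)
Lemma continuous_zero (L : AA -> AA) : continuous L -> (forall f g, L (f - g) = L f - L g) ->
  (forall x a, L (x *: eb R s a) = 0) -> forall f, L f = 0.
Proof.
move=> cL LB L0 f.
have LN0 : L 0 = 0 by have := LB 0 0; rewrite !subrr.
have LD g h : L (g + h) = L g + L h by rewrite -[h in LHS]opprK LB -[- h]sub0r LB LN0 sub0r opprK.
apply: snorm_eq0 => // k; apply/eqP; rewrite eq_le snorm_ge0// andbT.
apply/ler_addgt0Pr => e e0; rewrite add0r.
have h0 : nbhs (L 0) [set g | snorm k (g - L 0) < e] by apply/A_nbhs => //; exists k, e.
have [W WE] : exists W : set AA, W = [set g | snorm k (g - L 0) < e] by eexists.
rewrite -WE in h0.
have h1 := nbhs_preimage cL h0.
have [l [d d0 H]] := (A_nbhs s_gt0 0 (L @^-1` W)).1 h1.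
have [m Hm] := nat_bound (2 * l.+1%:R : R).
have f0 := snorm_ge0 s_gt0 m f.
have f1 : 0 < snorm m f + 1 by rewrite ltr_wpDl.
have [D HD] := pow2_small (divr_gt0 d0 f1); rewrite ltr_pdivlMr// in HD.
have H' g : snorm l g < d -> snorm k (L g) < e.
  by move=> gd; have := H g; rewrite subr0 WE /preimage /= LN0 subr0; exact.
have := H' (truncation D f - f); rewrite LB.
have -> : L (truncation D f) = 0.
  rewrite /truncation (big_morph L (id1 := 0) (op1 := +%R) LD LN0) big1// => a _; exact: L0.
rewrite sub0r => h; apply/ltW; have : snorm k (- L f) < e.
  apply: h; apply: le_lt_trans (truncation_rate _ Hm D) _; apply: le_lt_trans HD.
  by rewrite mulrC ler_wpM2l ?lerDl// exprn_ge0// invr_ge0.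
by rewrite -scaleN1r snormZ// cabsN cabs1 mul1r.
Qed.

Variable st : (I -> nat) -> (I -> nat) -> AA.

(* A pair of indices (a, b) is encoded as a single index m on I + I. *)
Definition term f g c m : C :=
  coef f (m \o inl) * coef g (m \o inr) * coef (st (m \o inl) (m \o inr)) c.
Definition bil f g : AA :=
  elem s (fun c => xget 0 [set l | lim_to (fun D => bsum D (term f g c)) l]).
Definition partial D f g : AA := \sum_(m : box II D)
  (coef f (boxi m \o inl) * coef g (boxi m \o inr)) *: st (boxi m \o inl) (boxi m \o inr).

Lemma coef_partial D f g c : coef (partial D f g) c = bsum D (term f g c).
Proof. by rewrite /partial coef_sum//; apply: eq_bigr => m _; rewrite coefZ. Qed.

(** In the weight l + 1 of f and g, the factor B pays for the growth of the products of basis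
    elements and the factor 4 for the summation over pairs of indices. *)
Lemma term_bound k l (K B : R) f g c m : 0 <= K -> 0 < B ->
  (forall a b, snorm k (st a b) <= K * B ^+ (msize a + msize b)) -> 4 * B <= l.+1%:R ->
  cabs (term f g c m) <= snorm l f * snorm l g * K / k.+1%:R ^+ msize c * 4^-1 ^+ msize m.
Proof.
move=> K0 B0 H Bl; set a := m \o inl; set b := m \o inr.
have w0 : 0 < (k.+1%:R : R) ^+ msize c by rewrite exprn_gt0.
rewrite mulrAC ler_pdivlMr//.
have h1 := snorm_ub s_gt0 l f a; have h2 := snorm_ub s_gt0 l g b.
have h3 := le_trans (snorm_ub s_gt0 k (st a b) c) (H a b).
rewrite exprVn ler_pdivlMr ?exprn_gt0//.
have h4 : 4 ^+ msize m * B ^+ msize m <= l.+1%:R ^+ msize m.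
  by rewrite -exprMn lerXn2r ?nnegrE// mulr_ge0// ltW.
rewrite /term !cabsM -/a -/b.
have mE : msize m = (msize a + msize b)%N := msize_pair m.
apply: le_trans (_ : cabs (coef f a) * cabs (coef g b) * (K * B ^+ msize m) * 4 ^+ msize m <= _).
  by rewrite ler_wpM2r ?exprn_ge0// -[_ * _ * k.+1%:R ^+ _]mulrA ler_wpM2l ?mulr_ge0 ?cabs_ge0// mE.
apply: le_trans (_ : (cabs (coef f a) * cabs (coef g b)) * K * l.+1%:R ^+ msize m <= _).
  rewrite -!mulrA; do 3![apply: ler_wpM2l; rewrite ?cabs_ge0//]; by rewrite mulrC.
have -> : cabs (coef f a) * cabs (coef g b) * K * l.+1%:R ^+ msize m =
  (cabs (coef f a) * l.+1%:R ^+ msize a) * (cabs (coef g b) * l.+1%:R ^+ msize b) * K.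
  by rewrite mE exprD; ring.
by apply: ler_wpM2r => //; apply: ler_pM; rewrite ?mulr_ge0 ?cabs_ge0 ?exprn_ge0.
Qed.

Hypothesis st_bound : forall k, exists2 K : R, 0 <= K & exists2 B : R, 0 < B &
  forall a b, snorm k (st a b) <= K * B ^+ (msize a + msize b).

Lemma bil_lim_bound k l (K B : R) f g c : 0 <= K -> 0 < B ->
  (forall a b, snorm k (st a b) <= K * B ^+ (msize a + msize b)) -> 4 * B <= l.+1%:R ->
  exists x, [/\ lim_to (fun D => bsum D (term f g c)) x,
    forall D, cabs (bsum D (term f g c) - x) * k.+1%:R ^+ msize c <=
      2 ^+ #|{: II}| * (snorm l f * snorm l g * K) * 2^-1 ^+ D &
    cabs x * k.+1%:R ^+ msize c <= 2 ^+ #|{: II}| * (snorm l f * snorm l g * K)].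
Proof.
move=> K0 B0 H Bl; have tb m := term_bound f g c m K0 B0 H Bl.
have w0 : 0 < (k.+1%:R : R) ^+ msize c by rewrite exprn_gt0.
have M0 : 0 <= snorm l f * snorm l g * K / k.+1%:R ^+ msize c.
  by rewrite divr_ge0 ?exprn_ge0// !mulr_ge0 ?snorm_ge0.
have [x Hx rx] := lim_to_rate (fun D D' DD => bsum_diff M0 DD tb).
exists x; split => //.
  by move=> D; rewrite -ler_pdivlMr//; apply: le_trans (rx D) _; rewrite mulrA mulrAC.
rewrite -ler_pdivlMr//; apply: lim_to_le Hx _ => D; rewrite -[leRHS]mulrA.
apply: (@bsum_le R _ D _ _ 4^-1) => //.
by apply/andP; split; lra.
Qed.

Lemma coef_bil f g : coef (bil f g) = fun c => xget 0 [set l | lim_to (fun D => bsum D (term f g c)) l].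
Proof.
rewrite /bil coef_elem// => r r0; have [k rk] := nat_bound r.
have [K K0 [B B0 H]] := st_bound k; have [l Hl] := nat_bound (4 * B).
exists (2 ^+ #|{: II}| * (snorm l f * snorm l g * K)).
  by rewrite mulr_ge0 ?exprn_ge0// !mulr_ge0 ?snorm_ge0.
move=> c; have [x [Hx _ Hc]] := bil_lim_bound f g c K0 B0 H Hl.
rewrite (lim_to_unique (xgetPex 0 (P := [set l | lim_to _ l]) (ex_intro _ x Hx)) Hx).
by apply: le_trans Hc; rewrite ler_wpM2l ?cabs_ge0// lerXn2r ?nnegrE ?(ltW r0).
Qed.

Lemma bil_lim f g c : lim_to (fun D => bsum D (term f g c)) (coef (bil f g) c).
Proof.
have [K K0 [B B0 H]] := st_bound 0; have [l Hl] := nat_bound (4 * B).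
have [x [Hx _ _]] := bil_lim_bound f g c K0 B0 H Hl.
rewrite coef_bil; exact: (xgetPex 0 (P := [set l | lim_to _ l]) (ex_intro _ x Hx)).
Qed.

Lemma bil_bound k l (K B : R) f g : 0 <= K -> 0 < B ->
  (forall a b, snorm k (st a b) <= K * B ^+ (msize a + msize b)) -> 4 * B <= l.+1%:R ->
  snorm k (bil f g) <= 2 ^+ #|{: II}| * (snorm l f * snorm l g * K).
Proof.
move=> K0 B0 H Hl; apply: snorm_le => c; have [x [Hx _ Hc]] := bil_lim_bound f g c K0 B0 H Hl.
by rewrite (lim_to_unique (bil_lim f g c) Hx).
Qed.

Lemma bil_rate k l (K B : R) f g D : 0 <= K -> 0 < B ->
  (forall a b, snorm k (st a b) <= K * B ^+ (msize a + msize b)) -> 4 * B <= l.+1%:R ->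
  snorm k (partial D f g - bil f g) <= 2 ^+ #|{: II}| * (snorm l f * snorm l g * K) * 2^-1 ^+ D.
Proof.
move=> K0 B0 H Hl; apply: snorm_le => c; have [x [Hx Hr _]] := bil_lim_bound f g c K0 B0 H Hl.
rewrite coefB// coef_partial (lim_to_unique (bil_lim f g c) Hx); exact: Hr.
Qed.

Lemma bil_bilinear : bilinear_product bil.
Proof.
split.
  move=> f x g h; apply: coef_inj => //; apply/funext => c; rewrite coefD// coefZ//.
  apply: (lim_to_unique (bil_lim _ _ _)).
  apply: eq_lim_to (lim_toD (lim_toZ x (bil_lim f g c)) (bil_lim f h c)) => D.
  by rewrite -bsumZ -bsumD; apply: eq_bsum => m; rewrite /term coefD// coefZ//; ring.
move=> g x f h; apply: coef_inj => //; apply/funext => c; rewrite coefD// coefZ//.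
apply: (lim_to_unique (bil_lim _ _ _)).
apply: eq_lim_to (lim_toD (lim_toZ x (bil_lim f g c)) (bil_lim h g c)) => D.
by rewrite -bsumZ -bsumD; apply: eq_bsum => m; rewrite /term coefD// coefZ//; ring.
Qed.

Lemma bil_eb a b : bil (eb R s a) (eb R s b) = st a b.
Proof.
apply: coef_inj => //; apply/funext => c; apply: (lim_to_unique (bil_lim _ _ _)).
pose m0 : II -> nat := fun i => match i with inl i => a i | inr i => b i end.
move=> e e0; exists (msize m0) => D mD; rewrite (bsum_single mD).
  rewrite /term !coef_eb// !dltP; case: asboolP => // _; case: asboolP => // _.
  by rewrite !mul1r subrr cabs0 ltW.
move=> m mm; rewrite /term !coef_eb// !dltP; case: asboolP => [E1|_]; last by rewrite !mul0r.
case: asboolP => [E2|_]; last by rewrite mulr0 mul0r.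
by case: mm; apply/funext => -[i|i]; rewrite /m0 ?E1 ?E2.
Qed.

Lemma bil_continuous : continuous (fun q : AA * AA => bil q.1 q.2).
Proof.
apply: (semi_bilinear_continuous (p := @snorm R n s)).
- exact: snormD.
- exact: snormZ.
- exact: A_nbhs.
- exact: bil_bilinear.1.
- exact: bil_bilinear.2.
- move=> k; have [K K0 [B B0 H]] := st_bound k; have [l Hl] := nat_bound (4 * B).
  exists l, (2 ^+ #|{: II}| * K); first by rewrite mulr_ge0 ?exprn_ge0.
  move=> f g; apply: le_trans (bil_bound f g K0 B0 H Hl) _.
  rewrite le_eqVlt; apply/orP; left; apply/eqP.
  by move: (snorm l f) (snorm l g) (2 ^+ #|{: II}|) => x y z; ring.
Qed.

End BilinearExtension.

(** * Estimates for the star product of monomials *)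

Section StarBounds.
Variables (R : realType) (n s : nat).
Hypothesis s_gt0 : (0 < s)%N.
Local Notation C := (Cplx R).
Local Notation Mh := (Mhat R n s).
Local Notation AA := (A R n s).
Local Notation I := ('I_n + 'I_n)%type.
Local Notation mi := (multiindex n).
Implicit Types (a b : I -> nat) (f g : AA) (P Q T : mi).

Lemma leq_fact2 i j : (i`! * j`! <= (i + j)`!)%N.
Proof.
by rewrite -(bin_fact (leq_addr j i)) addKn leq_pmull// bin_gt0 leq_addr.
Qed.

Lemma leq_prod_fact T : (\prod_k (T k)`! <= (mdeg T)`!)%N.
Proof.
rewrite /mdeg; apply: (big_ind2 (fun x y => (x <= y`!)%N)) => // x1 x2 y1 y2 h1 h2.
by apply: leq_trans (leq_fact2 _ _); exact: leq_mul.
Qed.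

Lemma leq_bin_pow2 m k : ('C(m, k) <= 2 ^ m)%N.
Proof.
elim: m k => [|m IH] [|k]; rewrite ?bin0 ?expn_gt0// binS expnS mul2n -addnn.
exact: leq_add.
Qed.

Lemma fact_add_le q r : ((q + r)`! <= 2 ^ (q + r) * (q`! * r`!))%N.
Proof. by rewrite -(bin_fact (leq_addr r q)) addKn leq_mul2r leq_bin_pow2 orbT. Qed.

(** With N + |T| = q + r, the factorials of the T k are absorbed in N! |T|! <= (q + r)! <= 2^(q+r)
    q! r!, and the binomial coefficients contribute at most 2^q 2^r. *)
Lemma star_combinatorics Q Q' T : (forall k, (T k <= Q k)%N) -> (forall k, (T k <= Q' k)%N) ->
  ((mdeg [ffun k => Q k + Q' k - T k])`! * \prod_k ((T k)`! * 'C(Q k, T k) * 'C(Q' k, T k))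
    <= 4 ^ (mdeg Q + mdeg Q') * ((mdeg Q)`! * (mdeg Q')`!))%N.
Proof.
move=> TQ TQ'; set N := mdeg _; set q := mdeg Q; set r := mdeg Q'.
have NT : (N + mdeg T = q + r)%N.
  rewrite /N /mdeg -!big_split /=; apply: eq_bigr => k _; rewrite ffunE subnK//.
  by apply: leq_trans (TQ k) _; rewrite leq_addr.
have hC : (\prod_k 'C(Q k, T k) <= 2 ^ q)%N.
  by rewrite /q /mdeg expn_sum; apply: leq_prod => k _; exact: leq_bin_pow2.
have hC' : (\prod_k 'C(Q' k, T k) <= 2 ^ r)%N.
  by rewrite /r /mdeg expn_sum; apply: leq_prod => k _; exact: leq_bin_pow2.
rewrite !big_split /=.
apply: leq_trans (_ : N`! * ((mdeg T)`! * 2 ^ q * 2 ^ r) <= _)%N.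
  by rewrite leq_mul2l !leq_mul ?orbT// leq_prod_fact.
have -> : (N`! * ((mdeg T)`! * 2 ^ q * 2 ^ r) = 2 ^ (q + r) * (N`! * (mdeg T)`!))%N.
  by rewrite -mulnA -expnD mulnA mulnC.
rewrite (_ : 4 = 2 * 2)%N// expnMn -mulnA leq_mul2l; apply/orP; right.
by apply: leq_trans (leq_fact2 _ _) _; rewrite NT fact_add_le.
Qed.

Section Fixed.
Variables (h : C) (dl L : R).
Hypothesis dl0 : 0 < dl.
Hypothesis hL : forall j : nat, dl * j.+1%:R <= cabs (h^-1 - j%:R) <= L * j.+1%:R.

Lemma dl_le_L : dl <= L.
Proof. by have /andP[h1 h2] := hL 0; have := le_trans h1 h2; rewrite !mulr1. Qed.

Lemma falling_ub m : cabs (falling h^-1 m) <= L ^+ m * m`!%:R.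
Proof.
have L0 : 0 <= L by apply: le_trans dl_le_L; exact: ltW.
rewrite /falling cabs_prod; elim: m => [|m IH]; first by rewrite big_ord0 mul1r.
rewrite big_ord_recr /= factS natrM exprSr.
have -> : L ^+ m * L * (m.+1%:R * m`!%:R) = (L ^+ m * m`!%:R) * (L * m.+1%:R) by ring.
apply: ler_pM => //; rewrite ?prodr_ge0 ?cabs_ge0//; last by have /andP[] := hL m.
by move=> i _; exact: cabs_ge0.
Qed.

Lemma falling_lb m : dl ^+ m * m`!%:R <= cabs (falling h^-1 m).
Proof.
rewrite /falling cabs_prod; elim: m => [|m IH]; first by rewrite big_ord0 mul1r.
rewrite big_ord_recr /= factS natrM exprSr.
have -> : dl ^+ m * dl * (m.+1%:R * m`!%:R) = (dl ^+ m * m`!%:R) * (dl * m.+1%:R) by ring.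
apply: ler_pM => //; rewrite ?mulr_ge0 ?exprn_ge0 ?(ltW dl0)//.
by have /andP[] := hL m.
Qed.

Lemma falling_neq0 m : falling h^-1 m != 0.
Proof.
rewrite -cabs_gt0; apply: lt_le_trans (falling_lb m).
by rewrite mulr_gt0 ?exprn_gt0// ltr0n fact_gt0.
Qed.

Lemma cabs_nu (k : 'I_n.+1) : cabs (nu R s k) = 1.
Proof. by rewrite /nu; case: ifP; rewrite ?cabsN cabs1. Qed.

Lemma cabs_sgn T : cabs (sgn R s T) = 1.
Proof. by rewrite /sgn cabs_prod big1// => k _; rewrite cabsX cabs_nu expr1n. Qed.

Hypothesis L1 : 1 <= L.

Lemma star_coef_bound Q Q' T : (forall k, (T k <= Q k)%N) -> (forall k, (T k <= Q' k)%N) ->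
  cabs (star_coef s h Q Q' T) <= (4 * L / dl) ^+ (mdeg Q + mdeg Q').
Proof.
move=> TQ TQ'; have := star_combinatorics TQ TQ'.
set N := mdeg [ffun k => _]; set q := mdeg Q; set r := mdeg Q'; set c := (\prod_k _)%N => comb.
have NT : (N <= q + r)%N.
  rewrite /N /q /r /mdeg -big_split /=; apply: leq_sum => k _; rewrite ffunE leq_subr//.
have L0 : 0 <= L by exact: le_trans L1.
rewrite /star_coef -/N -/q -/r -/c !cabsM cabs_sgn mul1r cabsV cabsM cabs_nat.
have p0 m : 0 < dl ^+ m * m`!%:R :> R by rewrite mulr_gt0 ?exprn_gt0// ltr0n fact_gt0.
have f0 m : 0 < cabs (falling h^-1 m) by rewrite cabs_gt0 falling_neq0.
rewrite mulrAC ler_pdivrMr ?mulr_gt0//.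
apply: le_trans (_ : (4 * L / dl) ^+ (q + r) * (dl ^+ q * q`!%:R * (dl ^+ r * r`!%:R)) <= _); last first.
  apply: ler_wpM2l; first by rewrite exprn_ge0// divr_ge0 ?(ltW dl0)// mulr_ge0.
  by apply: ler_pM; rewrite ?falling_lb ?(ltW (p0 _)).
have -> : (4 * L / dl) ^+ (q + r) * (dl ^+ q * q`!%:R * (dl ^+ r * r`!%:R)) =
    L ^+ (q + r) * (4 ^+ (q + r) * (q`!%:R * r`!%:R)).
  rewrite !exprMn [dl ^+ q * _ * _]mulrACA -exprD.
  have d0 : dl ^+ (q + r) != 0 by rewrite expf_neq0// gt_eqF.
  rewrite exprVn; move: (dl ^+ (q + r)) d0 (4 ^+ (q + r)) => x x0 y; field; exact: x0.
apply: le_trans (_ : L ^+ N * N`!%:R * c%:R <= _).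
  by rewrite ler_wpM2r// falling_ub.
rewrite -mulrA; apply: ler_pM; rewrite ?exprn_ge0//.
- by rewrite ler_weXn2l.
- by rewrite -!natrM -natrX -natrM ler_nat.
Qed.

End Fixed.

(** Beyond J, where j >= 2 |l| + 1, the distance from l is at least (j + 1) / 2. The finitely many
    smaller j have a positive minimal distance. *)
Lemma lambda_bounds (l : C) : (forall j : nat, l != j%:R) ->
  exists2 d : R, 0 < d & forall j : nat, d * j.+1%:R <= cabs (l - j%:R).
Proof.
move=> lj.
have fin J : exists2 d : R, 0 < d & forall j, (j <= J)%N -> d <= cabs (l - j%:R).
  elim: J => [|J [d d0 Hd]].
    exists (cabs (l - 0)); first by rewrite cabs_gt0 subr_eq0; exact: lj 0%N.
    by move=> j; rewrite leqn0 => /eqP ->.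
  exists (Num.min d (cabs (l - J.+1%:R))).
    by rewrite lt_min d0 cabs_gt0 subr_eq0 lj.
  move=> j; rewrite leq_eqVlt => /orP[/eqP ->|]; first by rewrite ge_min lexx orbT.
  by rewrite ltnS => /Hd h; rewrite ge_min h.
have [J HJ] := nat_bound (2 * cabs l + 1); have [d d0 Hd] := fin J.
exists (Num.min (d / J.+1%:R) 2^-1); first by rewrite lt_min divr_gt0//= invr_gt0.
move=> j; have [jJ|Jj] := leqP j J.
  apply: le_trans (_ : d / J.+1%:R * j.+1%:R <= _); first by rewrite ler_wpM2r// ge_min lexx.
  apply: le_trans (Hd j jJ); rewrite -mulrA ler_piMr ?(ltW d0)//.
  by rewrite ler_pdivrMl// mulr1 ler_nat.
apply: le_trans (_ : 2^-1 * j.+1%:R <= _); first by rewrite ler_wpM2r// ge_min lexx orbT.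
have h1 := cabs_dist j%:R l; rewrite cabs_nat in h1; rewrite cabsB.
have h2 : J.+1%:R <= j%:R :> R by rewrite ler_nat.
rewrite -[j.+1%:R]natr1; move: HJ h1 h2; move: (cabs l) (cabs (j%:R - l)) (J.+1%:R : R) (j%:R : R) => x y z w *; lra.
Qed.

Lemma Omega_lambda (h : C) : Omega h -> forall j : nat, h^-1 != j%:R.
Proof.
move=> Oh [|j]; apply/eqP => hj; apply: Oh.
  by right; rewrite /= -[h]invrK hj invr0.
by left; exists j.+1 => //; rewrite -hj invrK.
Qed.

Lemma Omega_neq0 (h : C) : Omega h -> h != 0.
Proof. by move=> Oh; apply/eqP => h0; apply: Oh; right. Qed.

(** The constants must hold on a neighbourhood of [h0], for the sake of holomorphy in hbar. Near
    [h0] the inverse moves by less than d / 2, half of the distance granted by [lambda_bounds]. *)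
Lemma Omega_bounds (h0 : C) : Omega h0 -> exists r d L : R, [/\ 0 < r, 0 < d, 1 <= L &
  forall h, cabs (h - h0) < r -> h != 0 /\
    forall j : nat, d * j.+1%:R <= cabs (h^-1 - j%:R) <= L * j.+1%:R].
Proof.
move=> Oh; have h00 := Omega_neq0 Oh.
have [d d0 Hd] := lambda_bounds (Omega_lambda Oh).
have e0 : 0 < Num.min 1 (d / 2) by rewrite lt_min ltr01 divr_gt0.
have ci : {for h0, continuous (fun z : C => z^-1)} by exact: inv_continuous.
have dI : differentiable (fun z : C => z) h0 by have := is_diff_id h0; case.
have nz := near_neq0 dI h00.
have [r r0 Hr] : exists2 r : R, 0 < r & forall h, wn (h - h0) < r ->
   h != 0 /\ cabs (h^-1 - h0^-1) < Num.min 1 (d / 2).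
  apply/nbhs_wn; near=> q; split; near: q; [exact: nz|exact: (continuous_eps ci e0)].
exists r, (d / 2), (cabs h0^-1 + 1); split => //; rewrite ?divr_gt0// ?lerDr ?cabs_ge0//.
move=> h; rewrite -wnC => /Hr[hn0]; rewrite lt_min => /andP[c1 c2]; split => // j.
have j1 : 1 <= j.+1%:R :> R by rewrite ler1n.
apply/andP; split.
  have h1 := Hd j; have h2 := cabs_triB (h0^-1 - h^-1) (j%:R - h^-1).
  have E : h0^-1 - h^-1 - (j%:R - h^-1) = h0^-1 - j%:R by ring.
  rewrite E [cabs (j%:R - _)]cabsB [cabs (h0^-1 - h^-1)]cabsB in h2.
  have h3 : d <= d * j.+1%:R by rewrite ler_peMr// ltW.
  rewrite mulrAC ler_pdivrMr//.
  move: h1 h2 h3 c2; move: (d * j.+1%:R) (cabs (h0^-1 - j%:R)) (cabs (h^-1 - h0^-1)) (cabs (h^-1 - j%:R)) => x y z w *; lra.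
have h2 := cabs_triB h^-1 j%:R; rewrite cabs_nat in h2.
have h3 := cabs_dist h^-1 h0^-1.
have h4 : (cabs h0^-1 + 1) * j.+1%:R = cabs h0^-1 * j.+1%:R + (j%:R + 1) by rewrite mulrDl mul1r natr1.
have h5 : cabs h0^-1 <= cabs h0^-1 * j.+1%:R by rewrite ler_peMr// cabs_ge0.
rewrite h4; move: h2 h3 h5 c1; move: (cabs h0^-1 * j.+1%:R) (cabs h0^-1) (cabs (h^-1 - h0^-1)) (cabs (h^-1 - j%:R)) (cabs h^-1) (j%:R : R) => x y z w u v *; lra.
Unshelve. all: by end_near. Qed.

Lemma coef_mono P Q : mdeg P = mdeg Q -> coef (mono R s P Q) = acoef (bhat P Q : Mh -> C).
Proof.
move=> PQ; have hb : holomorphic (bhat P Q : Mh -> C) by exact: bhat_holo.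
have fb := acoef_fast s_gt0 hb.
apply: coef_unique => // x.
have -> : mono R s P Q x = (bhat P Q : Mh -> C) (Delta_red x).
  by rewrite monoE// /b_red /Delta_red bhatE.
have := sumf_lim (Delta_red x) fb; rewrite -(expansion s_gt0 hb) //.
Qed.

(** b_{P,Q} need not be in normal form. Instead of rewriting it by J = 1, its coefficients are
    bounded by Cauchy's estimate on a fixed compact set, where [hsize] is bounded. *)
Lemma mono_bound k : exists2 B : R, 1 <= B & forall P Q, mdeg P = mdeg Q ->
  snorm k (mono R s P Q) <= 4 ^+ #|{: I}| * B ^+ mdeg P.
Proof.
pose p : R := 2 * k.+1%:R; have p0 : 0 < p by rewrite mulr_gt0.
have [B HB] := compact_hsize (@K_compact R n s s_gt0 p).
exists (1 + `|B|); first by rewrite lerDl.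
move=> P Q PQ; apply: snorm_le => a; rewrite coef_mono//.
have p2 : p / 2 = k.+1%:R by rewrite /p; field.
rewrite -ler_pdivlMr ?exprn_gt0// -p2; apply: acoef_bound => //; first exact: bhat_holo.
move=> x /HB xB; apply: le_trans (bhat_le x PQ) _.
rewrite lerXn2r ?nnegrE ?hsize_ge0 ?addr_ge0//; apply: le_trans xB _.
by have := ler_norm B; lra.
Qed.

Definition Tset Q Q' := {dffun forall k : 'I_n.+1, 'I_(minn (Q k) (Q' k)).+1}.
Definition Tval Q Q' (T : Tset Q Q') : mi := [ffun k => T k : nat].

Lemma Tval_le Q Q' (T : Tset Q Q') k : (Tval T k <= Q k)%N /\ (Tval T k <= Q' k)%N.
Proof. by have := ltn_ord (T k); rewrite ltnS leq_min ffunE => /andP. Qed.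

Definition addsub P Q T : mi := [ffun k => P k + Q k - T k]%N.

Lemma mdeg_addsub P Q T : (forall k, (T k <= P k + Q k)%N) ->
  (mdeg (addsub P Q T) + mdeg T = mdeg P + mdeg Q)%N.
Proof.
by move=> h; rewrite /mdeg -!big_split /=; apply: eq_bigr => k _; rewrite ffunE subnK.
Qed.

Lemma mdeg_addsub_le P Q T : (mdeg (addsub P Q T) <= mdeg P + mdeg Q)%N.
Proof. by rewrite /mdeg -big_split /=; apply: leq_sum => k _; rewrite ffunE leq_subr. Qed.

Lemma mdeg_addsub_eq P Q P' Q' T : mdeg P = mdeg Q -> mdeg P' = mdeg Q' ->
  (forall k, (T k <= Q k)%N) -> (forall k, (T k <= P' k)%N) ->
  mdeg (addsub P P' T) = mdeg (addsub Q Q' T).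
Proof.
move=> PQ PQ' TQ TP; apply/eqP; rewrite -(eqn_add2r (mdeg T)) !mdeg_addsub ?PQ ?PQ'//.
  by move=> k; apply: leq_trans (TQ k) (leq_addr _ _).
by move=> k; apply: leq_trans (TP k) (leq_addl _ _).
Qed.

Definition star_mono (h : C) P Q P' Q' : AA :=
  \sum_(T : Tset Q P') star_coef s h Q P' (Tval T) *:
    mono R s (addsub P P' (Tval T)) (addsub Q Q' (Tval T)).

Lemma star_monoE h P Q P' Q' : mdeg P = mdeg Q -> mdeg P' = mdeg Q' ->
  star_mono h P Q P' Q' = star_monomial h P Q P' Q' :> (Mred R n s -> C).
Proof.
move=> PQ PQ'; rewrite /star_mono /star_monomial.
rewrite (big_morph (fun f : AA => f : Mred R n s -> C) (id1 := 0) (op1 := +%R))//.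
apply: eq_bigr => T _; rewrite -[LHS]/(star_coef s h Q P' (Tval T) *: (mono R s _ _ : Mred R n s -> C)).
rewrite monoE; last by apply: mdeg_addsub_eq => // k; have [] := Tval_le T k.
congr (_ *: b_red _ _); apply/ffunP => k; by rewrite !ffunE.
Qed.

Lemma card_Tset Q Q' : (#|{: Tset Q Q'}| <= 2 ^ mdeg Q)%N.
Proof.
rewrite card_dep_ffun foldrE big_map -[X in (X <= _)%N]/(\prod_(k <- _) _)%N.
rewrite /mdeg expn_sum enumT; apply: leq_prod => k _; rewrite card_ord.
by rewrite (leq_trans (ltn_expl _ (isT : 1 < 2)%N))// leq_exp2l// geq_minl.
Qed.

(** The base 8 L B / d collects 2 from the number of terms ([card_Tset]), 4 L / d from
    [star_coef_bound] and B from the monomials. As B depends on k only, the estimate is uniform in h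
    where d and L are. *)
Lemma star_mono_bound k : exists2 B : R, 1 <= B & forall (h : C) (d L : R), 0 < d -> 1 <= L ->
  (forall j : nat, d * j.+1%:R <= cabs (h^-1 - j%:R) <= L * j.+1%:R) ->
  forall P Q P' Q', mdeg P = mdeg Q -> mdeg P' = mdeg Q' ->
  snorm k (star_mono h P Q P' Q') <= 4 ^+ #|{: I}| * (8 * L * B / d) ^+ (mdeg P + mdeg P').
Proof.
have [B B1 HB] := mono_bound k; exists B => // h d L d0 L1 hL P Q P' Q' PQ PQ'.
set N := (mdeg P + mdeg P')%N.
have B0 : 0 <= B by exact: le_trans B1.
have L0 : 0 <= L by exact: le_trans L1.
apply: le_trans (_ : \sum_(T : Tset Q P') (4 * L / d) ^+ N * (4 ^+ #|{: I}| * B ^+ N) <= _).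
  rewrite /star_mono; apply: (big_ind2 (fun f x => snorm k f <= x)).
  - by apply: snorm_le => a; rewrite coef0// cabs0 mul0r.
  - by move=> f1 x1 f2 x2 h1 h2; apply: le_trans (snormD _ _ _ _) _ => //; exact: lerD.
  move=> T _; rewrite snormZ//; apply: ler_pM; rewrite ?cabs_ge0 ?snorm_ge0//.
    have := star_coef_bound d0 hL L1 (fun k => (Tval_le T k).1) (fun k => (Tval_le T k).2).
    by rewrite -PQ.
  apply: le_trans (HB _ _ _) _.
    by apply: mdeg_addsub_eq => // l; have [] := Tval_le T l.
  rewrite ler_wpM2l ?exprn_ge0// ler_weXn2l// mdeg_addsub_le //.
rewrite sumr_const -[X in X <= _]mulr_natl.
apply: le_trans (_ : 2 ^+ N * ((4 * L / d) ^+ N * (4 ^+ #|{: I}| * B ^+ N)) <= _).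
  apply: ler_wpM2r.
    by rewrite !mulr_ge0 ?exprn_ge0// divr_ge0 ?(ltW d0)// mulr_ge0.
  rewrite -natrX ler_nat; apply: leq_trans (card_Tset _ _) _.
  by rewrite leq_exp2l// /N PQ leq_addr.
rewrite le_eqVlt; apply/orP; left; apply/eqP.
have -> : 8 * L * B / d = 2 * (4 * L / d) * B by field; rewrite gt_eqF.
by rewrite !exprMn; move: (2 ^+ N) (4 ^+ N) (L ^+ N) (d^-1 ^+ N) (B ^+ N) (4 ^+ #|{: I}|) => x y z w u v; ring.
Qed.

(** Products are prescribed for normal forms here; that the extension takes the prescribed value on
    all pairs of monomials is [star_mono_prod]. *)
Definition st (h : C) a b : AA := star_mono h (Pm a) (Qm a) (Pm b) (Qm b).
Definition star h f g : AA := bil (st h) f g.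

Lemma starE h f g : star h f g = bil (st h) f g.
Proof. by []. Qed.

Lemma mdegPm_le a : (mdeg (Pm a) <= msize a)%N.
Proof. by rewrite mdegPm msizeE geq_max leq_addr leq_addl. Qed.

Lemma st_bound k : exists2 B : R, 1 <= B & forall (h : C) (d L : R), 0 < d -> 1 <= L ->
  (forall j : nat, d * j.+1%:R <= cabs (h^-1 - j%:R) <= L * j.+1%:R) ->
  forall a b, snorm k (st h a b) <= 4 ^+ #|{: I}| * (8 * L * B / d) ^+ (msize a + msize b).
Proof.
have [B B1 HB] := star_mono_bound k; exists B => // h d L d0 L1 hL a b.
apply: le_trans (HB h d L d0 L1 hL _ _ _ _ (mdegPQ a) (mdegPQ b)) _.
rewrite ler_wpM2l ?exprn_ge0// ler_weXn2l//; last by rewrite leq_add ?mdegPm_le.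
rewrite ler_pdivlMr// mul1r; apply: le_trans (dl_le_L hL) _.
have L0 : 0 <= L by exact: le_trans L1.
have : L <= L * B by rewrite ler_peMr.
rewrite -mulrA; move: (L * B) => x; lra.
Qed.

End StarBounds.

(** The multiindices T below min (Q, R) are dependent functions, so distributivity is stated for
    factors with different index types. *)
Lemma prod_sum_dffun (K : comNzRingType) (J : finType) (T_ : J -> finType) (F : forall j, T_ j -> K) :
  \prod_j \sum_(t : T_ j) F j t = \sum_(T : {dffun forall j, T_ j}) \prod_j F j (T j).
Proof.
rewrite [RHS](reindex (@dffun_of_fprod J T_)); last exact/onW_bij/dffun_of_fprod_bij.
under [RHS]eq_bigr do under eq_bigr do rewrite ffunE.
have <- : \sum_(T : fprod T_) \prod_j [ffun t => F j t] (T j) = \sum_(T : fprod T_) \prod_j F j (T j).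
  by apply: eq_bigr => T _; apply: eq_bigr => j _; rewrite ffunE.
rewrite (@big_fprod K 0 1 *%R +%R J T_ (fun j => [ffun t => F j t])) -(bigA_distr_big_dep (fun i => tagged_with T_ i)
  (fun i g => untag 0 [ffun t : T_ i => F i t] g)) /=.
apply: eq_bigr => j _; rewrite (big_tag (fun i t => F i t)).
apply: eq_bigr => g _; congr untag; apply/funext => t; by rewrite ffunE.
Qed.

(** * Associativity *)

Section Falling.
Variable R : realType.
Local Notation C := (Cplx R).
Implicit Types (x y : C).

Lemma falling0 x : falling x 0 = 1. Proof. by rewrite /falling big_ord0. Qed.

Lemma fallingS x m : falling x m.+1 = falling x m * (x - m%:R).
Proof. by rewrite /falling big_ord_recr. Qed.

Lemma fallingSl x m : falling x m.+1 = x * falling (x - 1) m.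
Proof.
rewrite /falling big_ord_recl subr0; congr (_ * _); apply: eq_bigr => i _.
by rewrite lift0 -natr1 opprD addrA addrAC.
Qed.

Lemma falling_add x q r : falling x (q + r) = falling x q * falling (x - q%:R) r.
Proof.
elim: r => [|r IH]; first by rewrite addn0 falling0 mulr1.
by rewrite addnS !fallingS IH -mulrA natrD opprD addrA.
Qed.

Lemma falling_addr1 x m : falling (x + 1) m = falling x m + m%:R * falling x m.-1.
Proof.
case: m => [|m]; first by rewrite !falling0 mul0r addr0.
by rewrite fallingSl addrK fallingS /= -natr1; ring.
Qed.

Lemma falling_nat q : falling q%:R q = q`!%:R :> C.
Proof.
elim: q => [|q IH]; first by rewrite falling0.
by rewrite fallingSl -natr1 addrK IH natr1 factS natrM.
Qed.

Lemma falling_eq0 (m q : nat) : (m < q)%N -> falling m%:R q = 0 :> C.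
Proof.
by move=> mq; rewrite /falling (bigD1 (Ordinal mq))//= subrr mul0r.
Qed.

(** Since t! C(r, t) is the falling factorial of r of length t, this is Vandermonde's identity, by
    induction on r. It yields the factors T! C(Q, T) C(R, T) of the star product. *)
Lemma vandermonde_falling q r y : falling (y + r%:R) q =
  \sum_(t < q.+1) (t`! * 'C(q, t) * 'C(r, t))%:R * falling y (q - t).
Proof.
elim: r y => [|r IH] y.
  rewrite addr0 big_ord_recl subn0 !bin0 fact0 !mul1n mul1r big1 ?addr0// => i _.
  by rewrite bin0n muln0 mul0r.
have -> : y + r.+1%:R = (y + 1) + r%:R by rewrite -natr1 [_ + 1]addrC addrA.
rewrite IH; under eq_bigr do rewrite falling_addr1 mulrDr.
rewrite big_split /= [X in _ + X]big_ord_recr /= subnn /= mul0r mulr0 addr0.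
rewrite [LHS]addrC big_ord_recl [RHS]big_ord_recl /= !subn0 !bin0.
rewrite addrC -addrA; congr (_ + _); rewrite -big_split /=; apply: eq_bigr => t _.
rewrite /bump leq0n add1n binS subnS mulrA -mulrDl; congr (_ * _).
rewrite -natrM -natrD; congr (_%:R).
have tq : (t <= q)%N by exact: ltnW.
rewrite mulnDr; congr (_ + _)%N.
have E := mul_bin_left q t.
have -> : (t`! * 'C(q, t) * 'C(r, t) * (q - t) = t`! * 'C(r, t) * ((q - t) * 'C(q, t)))%N by ring.
by rewrite -E factS; ring.
Qed.

End Falling.

(** * The representation on functions of the exponent *)

Section Representation.
Variables (R : realType) (n s : nat).
Hypothesis s_gt0 : (0 < s)%N.
Local Notation C := (Cplx R).
Local Notation AA := (A R n s).
Local Notation I := ('I_n + 'I_n)%type.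
Local Notation mi := (multiindex n).
Local Notation mono := (@mono R n s).
Implicit Types (a b : I -> nat) (f g : AA) (P Q T : mi).

Definition incr P k : mi := [ffun j => P j + (j == k)]%N.

Lemma mdeg_incr P k : mdeg (incr P k) = (mdeg P).+1.
Proof.
rewrite /mdeg /incr; under eq_bigr do rewrite ffunE.
rewrite big_split /= -[RHS]addn1; congr (_ + _)%N.
by rewrite (bigD1 k)//= eqxx big1 // => j /negPf ->.
Qed.

Lemma prod_incr (F : 'I_n.+1 -> nat -> C) (G : 'I_n.+1 -> C) P k :
  F k (P k).+1 = F k (P k) * G k -> \prod_j F j (incr P k j) = (\prod_j F j (P j)) * G k.
Proof.
move=> E; rewrite (bigD1 k)//= ffunE eqxx addn1 E.
rewrite (eq_bigr (fun j => F j (P j))); last first.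
  by move=> j /negPf jk; rewrite ffunE jk addn0.
by rewrite [in RHS](bigD1 k)//= mulrAC.
Qed.

Lemma mpow_incr (z : 'rV[C]_n.+1) P k : mpow z (incr P k) = mpow z P * z 0 k.
Proof. by apply: (prod_incr (F := fun j e => z 0 j ^+ e) (G := fun j => z 0 j)); rewrite exprSr. Qed.

Lemma nuK (k : 'I_n.+1) : nu R s k * nu R s k = 1.
Proof. by rewrite /nu; case: ifP; rewrite ?mulr1// mulrNN mulr1. Qed.

Lemma sgn_incr P k : sgn R s (incr P k) = sgn R s P * nu R s k.
Proof. by apply: (prod_incr (F := fun j e => nu R s j ^+ e) (G := fun j => nu R s j)); rewrite exprSr. Qed.

Lemma sgn_neq0 P : sgn R s P != 0.
Proof. by rewrite -cabs_gt0 cabs_sgn. Qed.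

(* The relation J = 1. *)
Lemma mono_relation P Q : mdeg P = mdeg Q ->
  mono P Q = \sum_k nu R s k *: mono (incr P k) (incr Q k).
Proof.
move=> PQ; apply/val_inj/funext => x /=.
rewrite (big_morph (fun f : AA => (f : Mred R n s -> C) x) (id1 := 0) (op1 := +%R))//.
rewrite monoE// (eq_bigr (fun k => b_red P Q x * (nu R s k * (val (repr x : Z s)) 0 k * ((val (repr x : Z s)) 0 k)^*))); last first.
  move=> k _; rewrite -[LHS]/(nu R s k * mono (incr P k) (incr Q k) x) monoE ?mdeg_incr ?PQ//.
  by rewrite /b_red !mpow_incr mxE; ring.
rewrite -mulr_sumr; have /set_mem := valP (repr x : Z s).
by rewrite /Z /= /J => ->; rewrite mulr1.
Qed.

Variable h : C.
Hypothesis lam : forall j : nat, h^-1 != j%:R.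
Local Notation fun_n := (('I_n -> C) -> C).
Local Notation l := h^-1.

Lemma falling_lam m j : falling (l - m%:R) j != 0.
Proof.
apply/prodf_neq0 => i _.
by rewrite -addrA -opprD -natrD subr_eq0 lam.
Qed.

Lemma falling_lam0 j : falling l j != 0.
Proof. by have := falling_lam 0 j; rewrite subr0. Qed.

(* The points M with sum_k M_k = 1/hbar are parametrized by their coordinates m
   other than M_0. *)
Definition full (m : 'I_n -> C) (k : 'I_n.+1) : C := oapp m (l - \sum_i m i) (unlift ord0 k).
Definition falling_prod (M : 'I_n.+1 -> C) Q : C := \prod_k falling (M k) (Q k).
Definition shift P Q (m : 'I_n -> C) (i : 'I_n) : C :=
  m i - (Q (lift ord0 i))%:R + (P (lift ord0 i))%:R.
Definition normal_op P Q (phi : fun_n) : fun_n := fun m =>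
  sgn R s Q / falling l (mdeg Q) * falling_prod (full m) Q * phi (shift P Q m).

Lemma full0 m : full m ord0 = l - \sum_i m i.
Proof. by rewrite /full unlift_none. Qed.
Lemma full_lift m i : full m (lift ord0 i) = m i.
Proof. by rewrite /full liftK. Qed.

Lemma sum_full m : \sum_k full m k = l.
Proof.
rewrite big_ord_recl; under eq_bigr do rewrite full_lift.
by rewrite full0 subrK.
Qed.

Lemma mdegE P : (mdeg P)%:R = (P ord0)%:R + \sum_i (P (lift ord0 i))%:R :> C.
Proof. by rewrite /mdeg big_ord_recl natrD natr_sum. Qed.

Lemma full_shift P Q m k : mdeg P = mdeg Q ->
  full (shift P Q m) k = full m k - (Q k)%:R + (P k)%:R.
Proof.
move=> PQ; have [i ->|->] := unliftP ord0 k; first by rewrite !full_lift.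
rewrite !full0 /shift big_split /= sumrB.
have := congr1 (fun x : nat => x%:R : C) PQ; rewrite !mdegE => E.
have -> : \sum_i (P (lift ord0 i))%:R = (Q ord0)%:R + \sum_i (Q (lift ord0 i))%:R - (P ord0)%:R :> C.
  by rewrite -E addrAC subrr add0r.
by ring.
Qed.

Lemma opm_relation P Q phi m : mdeg P = mdeg Q ->
  normal_op P Q phi m = \sum_k nu R s k * normal_op (incr P k) (incr Q k) phi m.
Proof.
move=> PQ; rewrite /normal_op.
have Es k : shift (incr P k) (incr Q k) m = shift P Q m.
  apply/funext => i; rewrite /shift !ffunE !natrD; ring.
under eq_bigr do rewrite Es mdeg_incr fallingS sgn_incr.
have Ef k : falling_prod (full m) (incr Q k) = falling_prod (full m) Q * (full m k - (Q k)%:R).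
  apply: (prod_incr (F := fun j e => falling (full m j) e) (G := fun j => full m j - (Q j)%:R)).
  by rewrite fallingS.
have f0 := falling_lam0 (mdeg Q); have f1 : l - (mdeg Q)%:R != 0 by rewrite subr_eq0 lam.
rewrite (eq_bigr (fun k => sgn R s Q / falling l (mdeg Q) * falling_prod (full m) Q * phi (shift P Q m) /
   (l - (mdeg Q)%:R) * (full m k - (Q k)%:R))); last first.
  move=> k _; rewrite Ef; have := nuK k.
  move: (sgn R s Q) (falling l _) f0 (falling_prod _ _) (phi _) (l - _) f1 (full m k - _) (nu R s k).
  move=> S F F0 X Y L L0 Z w ww.
  have -> : w * (S * w / (F * L) * (X * Z) * Y) = (w * w) * (S / F * X * Y / L * Z).
    by field; rewrite F0 L0.
  by rewrite ww mul1r.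
rewrite -mulr_sumr sumrB sum_full -natr_sum -/(mdeg Q) divfK //.
Qed.

(* The operators compose in the opposite order: they act on the dual. *)
Lemma star_opm P Q P' Q' phi m : mdeg P = mdeg Q -> mdeg P' = mdeg Q' ->
  normal_op P' Q' (normal_op P Q phi) m =
  \sum_(T : Tset Q P') star_coef s h Q P' (Tval T) *
    normal_op (addsub P P' (Tval T)) (addsub Q Q' (Tval T)) phi m.
Proof.
move=> PQ PQ'.
(* After the shift the argument of the second factor is (M_k - Q'_k) + P'_k, as in
   [vandermonde_falling]. Terms with t > P'_k vanish with their binomial coefficient. *)
have key k : falling (full m k) (Q' k) * falling (full (shift P' Q' m) k) (Q k) =
   \sum_(t < (minn (Q k) (P' k)).+1) (t`! * 'C(Q k, t) * 'C(P' k, t))%:R * falling (full m k) (Q k + Q' k - t).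
  rewrite full_shift// vandermonde_falling mulr_sumr.
  have le1 : ((minn (Q k) (P' k)).+1 <= (Q k).+1)%N by rewrite ltnS geq_minl.
  rewrite [RHS](big_ord_widen _ (fun t => (t`! * 'C(Q k, t) * 'C(P' k, t))%:R * falling (full m k) (Q k + Q' k - t)) le1).
  rewrite [LHS](bigID (fun t : 'I_(Q k).+1 => (t < (minn (Q k) (P' k)).+1)%N)) /= [X in _ + X]big1 ?addr0; last first.
    move=> t; rewrite ltnS leq_min -ltnS ltn_ord /= -ltnNge => h'.
    by rewrite (bin_small h') muln0 mul0r mulr0.
  apply: eq_bigr => t _; have tQ : (t <= Q k)%N by rewrite -ltnS ltn_ord.
  by rewrite addnC -addnBA// falling_add; ring.
have Eff : falling_prod (full m) Q' * falling_prod (full (shift P' Q' m)) Q =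
    \sum_(T : Tset Q P') (\prod_k ((Tval T k)`! * 'C(Q k, Tval T k) * 'C(P' k, Tval T k)))%N%:R *
      falling_prod (full m) (addsub Q Q' (Tval T)).
  rewrite /falling_prod -big_split /= (eq_bigr _ (fun k _ => key k)) prod_sum_dffun.
  apply: eq_bigr => T _; rewrite big_split /= natr_prod; congr (_ * _).
    by apply: eq_bigr => k _; rewrite ffunE.
  by apply: eq_bigr => k _; rewrite !ffunE.
rewrite {1}/normal_op {1}/normal_op.
have -> : sgn R s Q' / falling l (mdeg Q') * falling_prod (full m) Q' *
    (sgn R s Q / falling l (mdeg Q) * falling_prod (full (shift P' Q' m)) Q * phi (shift P Q (shift P' Q' m))) =
    sgn R s Q * sgn R s Q' / (falling l (mdeg Q) * falling l (mdeg Q')) * phi (shift P Q (shift P' Q' m)) *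
    (falling_prod (full m) Q' * falling_prod (full (shift P' Q' m)) Q).
  by rewrite invfM; ring.
rewrite Eff mulr_sumr; apply: eq_bigr => T _; rewrite /normal_op.
have [TQ TP] : (forall k, Tval T k <= Q k)%N /\ (forall k, Tval T k <= P' k)%N.
  by split=> k; have [] := Tval_le T k.
have -> : shift (addsub P P' (Tval T)) (addsub Q Q' (Tval T)) m = shift P Q (shift P' Q' m).
  apply/funext => i; rewrite /shift [addsub Q Q' _ _]ffunE [addsub P P' _ _]ffunE.
  have h1 := TQ (lift ord0 i); have h2 := TP (lift ord0 i).
  rewrite (natrB _ (leq_trans h1 (leq_addr _ _))) (natrB _ (leq_trans h2 (leq_addl _ _))).
  by rewrite !natrD; ring.
have -> : mdeg (addsub Q Q' (Tval T)) = mdeg (addsub Q P' (Tval T)).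
  apply/eqP; rewrite -(eqn_add2r (mdeg (Tval T))) !mdeg_addsub ?PQ'//.
    by move=> k; apply: leq_trans (TP k) (leq_addl _ _).
  by move=> k; apply: leq_trans (TQ k) (leq_addr _ _).
have -> : sgn R s Q * sgn R s Q' = sgn R s (Tval T) * sgn R s (addsub Q Q' (Tval T)).
  rewrite /sgn -!big_split /=; apply: eq_bigr => k _.
  by rewrite -!exprD [addsub _ _ _ _]ffunE subnKC// (leq_trans (TQ k))// leq_addr.
rewrite /star_coef -/(addsub Q P' (Tval T)) -PQ'.
have := falling_lam0 (mdeg (addsub Q P' (Tval T))).
move: (falling l (mdeg (addsub Q P' (Tval T)))) (falling l (mdeg Q)) (falling l (mdeg P')) => x y z x0.
rewrite !invfM; move: (y^-1) (z^-1) (phi _) (falling_prod _ _) (_%:R) (sgn R s (Tval T)) (sgn R s _) => u v w p q r t.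
by field.
Qed.

End Representation.

(** * Faithfulness and products of operators *)

Section Operators.
Variables (R : realType) (n s : nat).
Hypothesis s_gt0 : (0 < s)%N.
Local Notation C := (Cplx R).
Local Notation AA := (A R n s).
Local Notation I := ('I_n + 'I_n)%type.
Local Notation mi := (multiindex n).
Local Notation mono := (@mono R n s).
Local Notation fun_n := (('I_n -> C) -> C).
Implicit Types (a b : I -> nat) (f g : AA) (P Q T : mi) (O : fun_n -> fun_n).

Lemma normal_form P Q : mdeg P = mdeg Q -> minn (P ord0) (Q ord0) = 0%N ->
  exists a, P = Pm a /\ Q = Qm a.
Proof.
move=> PQ m0; exists (fun i => match i with inl l => P (lift ord0 l) | inr l => Q (lift ord0 l) end).
move: PQ; rewrite /mdeg !big_ord_recl /psum /qsum => PQ.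
split; apply/ffunP => k; rewrite ffunE; case: unliftP => [l ->|->] //=; rewrite /psum /qsum /=; move: (\sum_(i < n) P _)%N (\sum_(i < n) Q _)%N PQ => x y PQ; lia.
Qed.

Variable h : C.
Hypothesis lam : forall j : nat, h^-1 != j%:R.
Local Notation normal_op := (normal_op s h).

(** A relation between finite combinations of basis elements and operators involves no choice of a
    decomposition; [rep_inj] shows that the operator determines the element. *)
Inductive rep : AA -> (fun_n -> fun_n) -> Prop :=
| rep_nil : rep 0 (fun _ _ => 0)
| rep_cons c a f O : rep f O ->
    rep (c *: eb R s a + f) (fun phi m => c * normal_op (Pm a) (Qm a) phi m + O phi m).

Lemma rep_eq f O f' O' : rep f O -> f = f' -> (forall phi m, O phi m = O' phi m) -> rep f' O'.
Proof. by move=> r <- e; rewrite (_ : O' = O)//; apply/funext => p; apply/funext => m. Qed.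

Lemma rep_add f O g O' : rep f O -> rep g O' -> rep (f + g) (fun phi m => O phi m + O' phi m).
Proof.
elim=> [|c a f1 O1 _ IH] rg.
  by apply: rep_eq rg _ _ => [|phi m]; rewrite add0r.
by apply: rep_eq (rep_cons c a (IH rg)) _ _ => [|phi m]; rewrite addrA.
Qed.

Lemma rep_scale c f O : rep f O -> rep (c *: f) (fun phi m => c * O phi m).
Proof.
elim=> [|d a f1 O1 _ IH].
  by apply: rep_eq rep_nil _ _ => [|phi m]; rewrite ?scaler0 ?mulr0.
by apply: rep_eq (rep_cons (c * d) a IH) _ _ => [|phi m]; rewrite ?scalerDr ?scalerA ?mulrDr ?mulrA.
Qed.

Lemma rep_sum (J : Type) (r : seq J) (F : J -> AA) (G : J -> fun_n -> fun_n) :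
  (forall j, rep (F j) (G j)) -> rep (\sum_(j <- r) F j) (fun phi m => \sum_(j <- r) G j phi m).
Proof.
move=> H; elim: r => [|j r IH].
  by apply: rep_eq rep_nil _ _ => [|phi m]; rewrite big_nil.
by apply: rep_eq (rep_add (H j) IH) _ _ => [|phi m]; rewrite big_cons.
Qed.

Lemma rep_eb a : rep (eb R s a) (normal_op (Pm a) (Qm a)).
Proof.
by apply: rep_eq (rep_cons 1 a rep_nil) _ _ => [|phi m]; rewrite ?scale1r ?mul1r addr0.
Qed.

(** Induction on the common power of xi^0 and eta^0. If it is positive, J = 1 expresses b_{P,Q} by
    monomials with a smaller common power, and the operators obey the same relation by
    [opm_relation]. *)
Lemma rep_mono P Q : mdeg P = mdeg Q -> rep (mono P Q) (normal_op P Q).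
Proof.
have [d] := ubnP (minn (P ord0) (Q ord0)); elim: d P Q => // d IH P Q; rewrite ltnS => Pd PQ.
have [m0|m0] := posnP (minn (P ord0) (Q ord0)).
  by have [a [-> ->]] := normal_form PQ m0; exact: rep_eb.
have [P0 Q0] : (0 < P ord0)%N /\ (0 < Q ord0)%N by move: m0; rewrite leq_min => /andP.
pose dec (P : mi) : mi := [ffun j => P j - (j == ord0)]%N.
have decK (P1 : mi) : (0 < P1 ord0)%N -> incr (dec P1) ord0 = P1.
  by move=> p; apply/ffunP => j; rewrite !ffunE; case: eqP => [->|_]; rewrite ?subnK ?subn0 ?addn0.
have PQ' : mdeg (dec P) = mdeg (dec Q).
  by apply: succn_inj; rewrite -!(mdeg_incr _ ord0) !decK.
have hd : (minn (dec P ord0) (dec Q ord0) < d)%N by rewrite !ffunE eqxx; lia.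
have := IH _ _ hd PQ' => r0.
have rl (i : 'I_n) : rep (mono (incr (dec P) (lift ord0 i)) (incr (dec Q) (lift ord0 i)))
   (normal_op (incr (dec P) (lift ord0 i)) (incr (dec Q) (lift ord0 i))).
  have e (X : mi) : incr X (lift ord0 i) ord0 = X ord0 by rewrite ffunE (negPf (neq_lift _ _)) addn0.
  by apply: IH; [rewrite !e|rewrite !mdeg_incr PQ'].
have rs := rep_sum (index_enum 'I_n) (fun i => rep_scale (nu R s (lift ord0 i)) (rl i)).
have nu00 := nu0 R n s_gt0.
apply: rep_eq (rep_add r0 (rep_scale (-1) rs)) _ _.
  rewrite scaleN1r (mono_relation R s PQ') big_ord_recl nu00 scale1r !decK//.
  by rewrite addrK.
move=> phi m; rewrite mulN1r (opm_relation s lam _ _ PQ') big_ord_recl nu00 mul1r !decK//.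
by rewrite addrK.
Qed.

Lemma rep_coef f O : rep f O -> exists N, forall D, (N <= D)%N ->
  (forall a, ~~ inbox D a -> coef f a = 0) /\
  forall phi m, O phi m = bsum D (fun a => coef f a * normal_op (Pm a) (Qm a) phi m).
Proof.
elim=> [|c a f1 O1 _ [N HN]].
  exists 0%N => D _; split=> [a _|phi m]; first by rewrite coef0.
  by rewrite /bsum big1// => a _; rewrite coef0// mul0r.
exists (maxn N (msize a)) => D; rewrite geq_max => /andP[ND aD]; have [H1 H2] := HN D ND.
split=> [b bD|phi m].
  rewrite coefD// coefZ// coef_eb// H1// addr0 dltP; case: asboolP => [ab|_]; last by rewrite mulr0.
  by case/negP: bD; rewrite -ab; exact: inbox_msize.
rewrite H2; under [RHS]eq_bsum do rewrite coefD// coefZ// coef_eb// mulrDl -mulrA.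
rewrite bsumD bsumZ; congr (_ * _ + _); rewrite (bsum_single aD).
  by rewrite dltP; case: asboolP => // _; rewrite mul1r.
by move=> b ba; rewrite dltP; case: asboolP => [/esym//|_]; rewrite mul0r.
Qed.

(** Triangularity in the eta-degree [qsum]. The operator is evaluated at the eta-exponents of a, on
    the point mass at its xi-exponents. A term b of at least the same degree survives only if its
    eta-exponents are at most those of a, hence equal, and then the point mass forces b = a. The
    term of a survives because the zeroth coordinate is 1/hbar minus a natural number, whose falling
    factorials do not vanish. *)
Lemma rep_zero f O : rep f O -> (forall phi m, O phi m = 0) -> f = 0.
Proof.
move=> rf O0; apply: coef_inj => //; rewrite coef0//; apply/funext.
suff H d a : qsum a = d -> coef f a = 0 by move=> a; exact: (H (qsum a)).
elim/ltn_ind: d a => d IH a ad.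
have [N HN] := rep_coef rf; have [H1 H2] := HN (maxn N (msize a)) (leq_maxl _ _).
pose m : 'I_n -> C := fun l => (a (inr l))%:R.
pose phi : fun_n := fun v => if `[< v = fun l => (a (inl l))%:R >] then 1 else 0.
have := H2 phi m; rewrite O0 (bsum_single (leq_maxr _ _)).
  move=> /esym/eqP; rewrite mulf_eq0 => /orP[/eqP //|].
  rewrite /normal_op /phi; case: asboolP => [_|]; last first.
    by case; apply/funext => l; rewrite /shift Pml Qml subrr add0r.
  rewrite mulr1 mulf_eq0 mulf_eq0 (negPf (sgn_neq0 _ _ _)) /= invr_eq0.
  rewrite (negPf (falling_lam0 lam _)) /= => /negPn/negP; case.
  apply/prodf_neq0 => k _; have [l ->|->] := unliftP ord0 k.
    by rewrite full_lift Qml falling_nat pnatr_eq0 -lt0n fact_gt0.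
  rewrite full0 -natr_sum; exact: falling_lam.
move=> b ba; have [bd|db] := ltnP (qsum b) d; first by rewrite (IH _ bd b erefl) mul0r.
have [/forallP bl|] := boolP [forall l, (b (inr l) <= a (inr l))%N].
  have E l : b (inr l) = a (inr l).
    apply/eqP; rewrite eqn_leq bl /= leqNgt; apply/negP => lt.
    move: db; rewrite -ad leqNgt => /negP; apply; rewrite /qsum (bigD1 l)//= [X in (_ < X)%N](bigD1 l)//=.
    by rewrite -addSn leq_add// leq_sum.
  rewrite /normal_op /phi; case: asboolP => [e|_]; last by rewrite !mulr0.
  case: ba; apply/funext => -[l|l] //; have := congr1 (@^~ l) e.
  rewrite /shift Pml Qml E subrr add0r => /eqP; rewrite eqr_nat => /eqP //.
rewrite negb_forall; case/fintype.existsP => l; rewrite -ltnNge => lt.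
rewrite /normal_op /falling_prod (bigD1 (lift ord0 l))//= full_lift Qml falling_eq0// mul0r mulr0 mul0r mulr0 //.
Qed.

Lemma rep_inj f g O O' : rep f O -> rep g O' -> (forall phi m, O phi m = O' phi m) -> f = g.
Proof.
move=> rf rg e; apply/eqP; rewrite -subr_eq0; apply/eqP; rewrite -scaleN1r.
by apply: rep_zero (rep_add rf (rep_scale (-1) rg)) _ => phi m; rewrite e mulN1r subrr.
Qed.

Lemma rep_linear f O : rep f O -> forall c phi psi m,
  O (fun v => c * phi v + psi v) m = c * O phi m + O psi m.
Proof.
elim=> [|d a f1 O1 _ IH] c phi psi m; first by rewrite mulr0 addr0.
by rewrite IH /normal_op; ring.
Qed.

Lemma rep_at0 f O : rep f O -> forall m, O (fun=> 0) m = 0.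
Proof.
elim=> [|d a f1 O1 _ IH] m //; by rewrite IH /normal_op !mulr0 addr0.
Qed.

Lemma rep_star_mono P Q P' Q' : mdeg P = mdeg Q -> mdeg P' = mdeg Q' ->
  rep (star_mono s h P Q P' Q') (fun phi => normal_op P' Q' (normal_op P Q phi)).
Proof.
move=> PQ PQ'; rewrite /star_mono.
have H (T : Tset Q P') : rep (star_coef s h Q P' (Tval T) *: mono (addsub P P' (Tval T)) (addsub Q Q' (Tval T)))
  (fun phi m => star_coef s h Q P' (Tval T) * normal_op (addsub P P' (Tval T)) (addsub Q Q' (Tval T)) phi m).
  by apply/rep_scale/rep_mono; apply: mdeg_addsub_eq => // k; have [] := Tval_le T k.
apply: rep_eq (rep_sum (index_enum (Tset Q P')) H) _ _ => // phi m.
by rewrite star_opm.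
Qed.

Hypothesis st_bd : forall k, exists2 K : R, 0 <= K & exists2 B : R, 0 < B &
  forall a b, snorm k (st s h a b) <= K * B ^+ (msize a + msize b).

Lemma star_bilinear : bilinear_product (star h : AA -> AA -> AA).
Proof. exact: bil_bilinear. Qed.

Lemma starDl f g k : star h (f + g) k = star h f k + star h g k.
Proof. by have := star_bilinear.2 k 1 f g; rewrite !scale1r. Qed.
Lemma starDr f g k : star h f (g + k) = star h f g + star h f k.
Proof. by have := star_bilinear.1 f 1 g k; rewrite !scale1r. Qed.
Lemma star0l f : star h (0 : AA) f = 0.
Proof. by apply: (addrI (star h 0 f)); rewrite -starDl !addr0. Qed.
Lemma star0r f : star h f (0 : AA) = 0.
Proof. by apply: (addrI (star h f 0)); rewrite -starDr !addr0. Qed.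
Lemma starZl c f g : star h (c *: f) g = c *: star h f g.
Proof. by have := star_bilinear.2 g c f 0; rewrite !addr0 star0l addr0. Qed.
Lemma starZr c f g : star h f (c *: g) = c *: star h f g.
Proof. by have := star_bilinear.1 f c g 0; rewrite !addr0 star0r addr0. Qed.

Lemma rep_star f g O O' : rep f O -> rep g O' -> rep (star h f g) (fun phi => O' (O phi)).
Proof.
move=> rf rg; have r0 := rep_linear rg; have rz := rep_at0 rg.
elim: rf => [|c a f1 O1 _ IH].
  by apply: rep_eq rep_nil _ _ => [|phi m]; rewrite ?star0l ?rz.
have ra : rep (star h (eb R s a) g) (fun phi => O' (normal_op (Pm a) (Qm a) phi)).
  elim: rg {r0 rz IH} => [|d b g1 O2 _ IH].
    by apply: rep_eq rep_nil _ _ => [|phi m]; rewrite ?star0r.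
  apply: rep_eq (rep_add (rep_scale d (rep_star_mono (mdegPQ a) (mdegPQ b))) IH) _ _ => // .
  by rewrite starDr starZr /star bil_eb.
apply: rep_eq (rep_add (rep_scale c ra) IH) _ _ => [|phi m]; first by rewrite starDl starZl.
by rewrite -r0.
Qed.

(** Both sides are represented by the same operator. By faithfulness, the definition on normal forms
    is consistent with the relation J = 1. *)
Lemma star_mono_prod P Q P' Q' : mdeg P = mdeg Q -> mdeg P' = mdeg Q' ->
  star h (mono P Q) (mono P' Q') = star_mono s h P Q P' Q'.
Proof.
move=> PQ PQ'; apply: rep_inj (rep_star_mono PQ PQ') _; last first => //.
exact: rep_star (rep_mono PQ) (rep_mono PQ').
Qed.

(** Both sides are represented by the same threefold composition. *)
Lemma star_eb_assoc a b c :
  star h (star h (eb R s a) (eb R s b)) (eb R s c) = star h (eb R s a) (star h (eb R s b) (eb R s c)).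
Proof.
have ra := rep_eb a; have rb := rep_eb b; have rc := rep_eb c.
have h1 := rep_star (rep_star ra rb) rc; have h2 := rep_star ra (rep_star rb rc).
exact: (rep_inj h1 h2 (fun phi m => erefl _)).
Qed.

Lemma star_continuous : continuous (fun q : AA * AA => star h q.1 q.2).
Proof. exact: bil_continuous. Qed.

Lemma bilinear_contl (mul : AA -> AA -> AA) g :
  continuous (fun q : AA * AA => mul q.1 q.2) -> continuous (fun f => mul f g).
Proof. by move=> c f; move=> U /(c (f, g)) [[W1 W2] /= [w1 w2] H]; apply: filterS w1 => x w; apply: (H (x, g)); split => //; exact: nbhs_singleton. Qed.

Lemma bilinear_contr (mul : AA -> AA -> AA) f :
  continuous (fun q : AA * AA => mul q.1 q.2) -> continuous (fun g => mul f g).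
Proof. by move=> c g; move=> U /(c (f, g)) [[W1 W2] /= [w1 w2] H]; apply: filterS w2 => x w; apply: (H (f, x)); split => //; exact: nbhs_singleton. Qed.

End Operators.

Lemma continuous_pair_comp (T U T' U' W : topologicalType) (m : T -> U -> W) (L : T' -> T) (L' : U' -> U) :
  continuous (fun q : T * U => m q.1 q.2) -> continuous L -> continuous L' ->
  continuous (fun q : T' * U' => m (L q.1) (L' q.2)).
Proof.
move=> cm cL cL' q; have h1 : (fun q : T' * U' => L q.1) @ q --> L q.1.
  by apply: (@continuous_comp _ _ _ fst L); [exact: cvg_fst|exact: cL].
have h2 : (fun q : T' * U' => L' q.2) @ q --> L' q.2.
  by apply: (@continuous_comp _ _ _ snd L'); [exact: cvg_snd|exact: cL'].
exact: continuous2_cvg (cm (L q.1, L' q.2)) h1 h2.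
Qed.

(** * Continuous extension, uniqueness, associativity and unit *)

Section StarAlgebra.
Variables (R : realType) (n s : nat).
Hypothesis s_gt0 : (0 < s)%N.
Local Notation C := (Cplx R).
Local Notation AA := (A R n s).
Local Notation I := ('I_n + 'I_n)%type.
Local Notation mi := (multiindex n).
Local Notation eb := (@eb R n s).
Implicit Types (a b : I -> nat) (f g : AA) (P Q T : mi).

Lemma A_cont_sub (L L' : AA -> AA) : continuous L -> continuous L' -> continuous (fun f => L f - L' f).
Proof.
move=> cL cL' f U /(A_nbhs s_gt0)[k [e e0 H]]; have e2 : 0 < e / 2 by rewrite divr_gt0.
have h1 : nbhs (L f) [set g | snorm k (g - L f) < e / 2] by apply/A_nbhs => //; exists k, (e / 2).
have h2 : nbhs (L' f) [set g | snorm k (g - L' f) < e / 2] by apply/A_nbhs => //; exists k, (e / 2).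
apply: filterS (filterI (nbhs_preimage cL h1) (nbhs_preimage cL' h2)) => g [/= c1 c2]; apply: H.
have -> : L g - L' g - (L f - L' f) = (L g - L f) + (-1) *: (L' g - L' f).
  by rewrite scaleN1r !opprD !opprK addrACA.
apply: le_lt_trans (snormD s_gt0 _ _ _) _; rewrite snormZ// cabsN cabs1 mul1r; lra.
Qed.

Lemma linB (L : AA -> AA) : linear L -> forall f g, L (f - g) = L f - L g.
Proof. by move=> lL f g; rewrite addrC -scaleN1r lL scaleN1r addrC. Qed.

Lemma linZ (L : AA -> AA) : linear L -> forall x f, L (x *: f) = x *: L f.
Proof.
move=> lL x f; have := lL x f 0; rewrite addr0 => ->.
by have := linB lL 0 0; rewrite !subrr => ->; rewrite addr0.
Qed.

Lemma bilinear_ext (m1 m2 : AA -> AA -> AA) : bilinear_product m1 -> bilinear_product m2 ->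
  continuous (fun q : AA * AA => m1 q.1 q.2) -> continuous (fun q : AA * AA => m2 q.1 q.2) ->
  (forall a b, m1 (eb a) (eb b) = m2 (eb a) (eb b)) -> forall f g, m1 f g = m2 f g.
Proof.
move=> [r1 l1] [r2 l2] c1 c2 E.
have half b f : m1 f (eb b) = m2 f (eb b).
  apply/eqP; rewrite -subr_eq0; apply/eqP.
  apply: (continuous_zero s_gt0 (L := fun f => m1 f (eb b) - m2 f (eb b))).
  - by apply: A_cont_sub; exact: bilinear_contl.
  - by move=> f1 g1; rewrite (linB (l1 _)) (linB (l2 _)) !opprD !opprK addrACA.
  - by move=> x a; rewrite (linZ (l1 _)) (linZ (l2 _)) E subrr.
move=> f g; apply/eqP; rewrite -subr_eq0; apply/eqP.
apply: (continuous_zero s_gt0 (L := fun g => m1 f g - m2 f g)).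
- by apply: A_cont_sub; exact: bilinear_contr.
- by move=> f1 g1; rewrite (linB (r1 _)) (linB (r2 _)) !opprD !opprK addrACA.
- by move=> x a; rewrite (linZ (r1 _)) (linZ (r2 _)) half subrr.
Qed.

Lemma value_bound (x : Mred R n s) : exists k, forall f, cabs (f x) <= 2 ^+ #|{: I}| * snorm k f.
Proof.
have [k Hk] := extension_bound n s_gt0 (hsize (Delta_red x)); exists k => f.
by rewrite extensionE; exact: Hk.
Qed.

Section Fixed.
Variable h : C.
Hypothesis Oh : Omega h.

Lemma Omega_st k : exists2 K : R, 0 <= K & exists2 B : R, 0 < B &
  forall a b, snorm k (st s h a b) <= K * B ^+ (msize a + msize b).
Proof.
have [r [d [L [r0 d0 L1 H]]]] := Omega_bounds Oh.
have [_ hL] : h != 0 /\ forall j : nat, d * j.+1%:R <= cabs (h^-1 - j%:R) <= L * j.+1%:R.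
  by apply: H; rewrite subrr cabs0.
have [B B1 HB] := st_bound R n s_gt0 k.
exists (4 ^+ #|{: I}|); first by rewrite exprn_ge0.
exists (8 * L * B / d); last by move=> a b; exact: HB.
by rewrite divr_gt0// !mulr_gt0// ?(lt_le_trans ltr01).
Qed.

Let lam := Omega_lambda Oh.
Let bl : bilinear_product (star h : AA -> AA -> AA) := star_bilinear s_gt0 Omega_st.
Let ct : continuous (fun q : AA * AA => star h q.1 q.2) := star_continuous s_gt0 Omega_st.

Lemma star_extension : continuous_extension h (star h : AA -> AA -> AA).
Proof.
split; last exact: ct.
split; first exact: bl.
move=> P Q P' Q' PQ PQ'; rewrite !monomialE star_mono_prod//; last exact: Omega_st.
by rewrite star_monoE.
Qed.

Lemma star_unique (mul : AA -> AA -> AA) : continuous_extension h mul -> mul = star h.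
Proof.
move=> [[bm mm] cm]; apply/funext => f; apply/funext => g.
apply: bilinear_ext => // a b; apply/val_inj => /=.
have := mm _ _ _ _ (mdegPQ a) (mdegPQ b).
have := star_extension.1.2 _ _ _ _ (mdegPQ a) (mdegPQ b).
by rewrite !monomialE => -> ->.
Qed.

(** [bilinear_ext] treats two arguments at a time, so it is used twice: with a basis element as
    third factor ([half]), and then with an arbitrary middle factor. *)
Lemma star_assoc : associative (star h : AA -> AA -> AA).
Proof.
have cl (g : AA) : continuous (fun f => star h f g) by exact: bilinear_contl.
have cr (f : AA) : continuous (fun g => star h f g) by exact: bilinear_contr.
have [lr ll] := bl.
have c1 (k : AA) : continuous (fun q : AA * AA => star h (star h q.1 q.2) k).
  by move=> q; apply: (@continuous_comp _ _ _ (fun q : AA * AA => star h q.1 q.2) (fun f => star h f k)); [exact: ct|exact: cl].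
have c2 (k : AA) : continuous (fun q : AA * AA => star h k (star h q.1 q.2)).
  by move=> q; apply: (@continuous_comp _ _ _ (fun q : AA * AA => star h q.1 q.2) (fun f => star h k f)); [exact: ct|exact: cr].
have c3 (L : AA -> AA) : continuous L -> continuous (fun q : AA * AA => star h q.1 (L q.2)).
  by move=> cL; exact: (continuous_pair_comp ct (fun x => cvg_id) cL).
have c4 (L : AA -> AA) : continuous L -> continuous (fun q : AA * AA => star h (L q.1) q.2).
  by move=> cL; exact: (continuous_pair_comp ct cL (fun x => cvg_id)).
have half c f g : star h f (star h g (eb c)) = star h (star h f g) (eb c).
  apply: (bilinear_ext (m1 := fun f g => star h f (star h g (eb c))) (m2 := fun f g => star h (star h f g) (eb c))).
  - split=> [f1 x g1 g2|g1 x f1 f2]; first by rewrite ll lr.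
    by rewrite ll.
  - split=> [f1 x g1 g2|g1 x f1 f2]; first by rewrite lr ll.
    by rewrite ll ll.
  - exact: (c3 _ (cl (eb c))).
  - exact: c1.
  - by move=> a b; rewrite star_eb_assoc//; exact: Omega_st.
move=> f g k.
apply: (bilinear_ext (m1 := fun f k => star h f (star h g k)) (m2 := fun f k => star h (star h f g) k)).
- split=> [f1 x g1 g2|g1 x f1 f2]; first by rewrite lr lr.
  by rewrite ll.
- split=> [f1 x g1 g2|g1 x f1 f2]; first by rewrite lr.
  by rewrite ll ll.
- exact: (c3 _ (cr g)).
- exact: (c4 _ (cl g)).
- by move=> a c; exact: half.
Qed.

(** The monomial with exponents 0 is represented by the identity operator, so it is a unit for basis
    elements, and density extends this. *)
Lemma star_unit : exists e : AA, left_id e (star h) /\ right_id e (star h).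
Proof.
pose e0 : I -> nat := fun=> 0%N; exists (eb e0).
have O1 phi m : normal_op s h (Pm e0) (Qm e0) phi m = phi m.
  have P0 k : Pm e0 k = 0%N.
    by rewrite ffunE; case: unliftP => //= _; rewrite /psum /qsum !big1.
  have Q0 k : Qm e0 k = 0%N.
    by rewrite ffunE; case: unliftP => //= _; rewrite /psum /qsum !big1.
  rewrite /normal_op /sgn /falling_prod /mdeg !big1 => [|k _|k _|k _]; rewrite ?Q0 ?falling0 ?expr0//.
  rewrite divr1 !mul1r; congr phi; apply/funext => i.
  by rewrite /shift ?P0 ?Q0 ?P0 subr0 addr0.
have [lr ll] := bl; have re := rep_eb s h e0.
have sub0 f g : f - g = 0 -> f = g by move=> /eqP; rewrite subr_eq0 => /eqP.
split=> f; apply: sub0.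
  apply: (continuous_zero s_gt0 (L := fun f => star h (eb e0) f - f)).
  - by apply: A_cont_sub; [exact: bilinear_contr|move=> x; exact: cvg_id].
  - by move=> f1 g1; rewrite (linB (lr _)) !opprD !opprK addrACA.
  move=> x a; rewrite (starZr s_gt0 Omega_st); apply/eqP; rewrite subr_eq0; apply/eqP; congr (_ *: _).
  by apply: (rep_inj s_gt0 lam (rep_star s_gt0 lam Omega_st re (rep_eb s h a)) (rep_eb s h a)) => phi m; rewrite (funext (O1 phi)).
apply: (continuous_zero s_gt0 (L := fun f => star h f (eb e0) - f)).
- by apply: A_cont_sub; [exact: bilinear_contl|move=> x; exact: cvg_id].
- by move=> f1 g1; rewrite (linB (ll _)) !opprD !opprK addrACA.
move=> x a; rewrite (starZl s_gt0 Omega_st); apply/eqP; rewrite subr_eq0; apply/eqP; congr (_ *: _).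
by apply: (rep_inj s_gt0 lam (rep_star s_gt0 lam Omega_st (rep_eb s h a) re) (rep_eb s h a)) => phi m; rewrite O1.
Qed.

End Fixed.
End StarAlgebra.

Lemma continuous_swap (T U W : topologicalType) (m : T -> U -> W) :
  continuous (fun q : T * U => m q.1 q.2) -> continuous (fun q : U * T => m q.2 q.1).
Proof. by move=> cm q; exact: continuous2_cvg (cm (q.2, q.1)) cvg_snd cvg_fst. Qed.

(** * Involution and holomorphy in hbar *)

Section Involution.
Variables (R : realType) (n s : nat).
Hypothesis s_gt0 : (0 < s)%N.
Local Notation C := (Cplx R).
Local Notation AA := (A R n s).
Local Notation I := ('I_n + 'I_n)%type.
Local Notation mi := (multiindex n).
Local Notation eb := (@eb R n s).
Local Notation star := (@star R n s).
Implicit Types (a b : I -> nat) (f g : AA) (P Q T : mi).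

Definition swap_index (i : I) : I := match i with inl l => inr l | inr l => inl l end.

Lemma swK : involutive swap_index. Proof. by case. Qed.

Lemma psum_sw a : psum (a \o swap_index) = qsum a. Proof. by []. Qed.
Lemma qsum_sw a : qsum (a \o swap_index) = psum a. Proof. by []. Qed.
Lemma msize_sw a : msize (a \o swap_index) = msize a.
Proof. by rewrite !msizeE psum_sw qsum_sw addnC. Qed.

Lemma Pm_sw a : Pm (a \o swap_index) = Qm a.
Proof. by apply/ffunP => k; rewrite !ffunE. Qed.
Lemma Qm_sw a : Qm (a \o swap_index) = Pm a.
Proof. by apply/ffunP => k; rewrite !ffunE. Qed.
Lemma comp_swK a : (a \o swap_index) \o swap_index = a.
Proof. by apply/funext => i /=; rewrite swK. Qed.

Lemma bsum_sw D (F : (I -> nat) -> C) : bsum D (fun a => F (a \o swap_index)) = bsum D F.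
Proof.
pose t (a : box I D) : box I D := [ffun i => a (swap_index i)].
have tK : involutive t by move=> a; apply/ffunP => i; rewrite !ffunE swK.
rewrite /bsum [RHS](reindex_inj (inv_inj tK)) /=; apply: eq_bigr => a _.
by congr F; apply/funext => i; rewrite /boxi /= ffunE.
Qed.

Lemma b_red_conj P Q (x : Mred R n s) : (b_red P Q x)^* = b_red Q P x.
Proof.
have E (z : 'rV[C]_n.+1) T : (mpow z T)^* = mpow (map_mx Num.conj z) T.
  by rewrite /mpow rmorph_prod; apply: eq_bigr => k _; rewrite rmorphXn /= mxE.
rewrite /b_red rmorphM /= !E mulrC; congr (mpow _ _ * _).
by apply/rowP => k; rewrite !mxE conjCK.
Qed.

Lemma eb_sw a x : eb (a \o swap_index) x = (eb a x)^*.
Proof. by rewrite !ebE Pm_sw Qm_sw !monoE ?mdegPQ// b_red_conj. Qed.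

Lemma fast_sw (c : (I -> nat) -> C) : fast c -> fast (fun a => (c (a \o swap_index))^*).
Proof.
move=> fc r r0; have [M M0 HM] := fc r r0; exists M => // a.
by rewrite cabs_conj -msize_sw.
Qed.

(** Defined on coefficients, so that membership in A and the norm bound are immediate; [conjAE]
    identifies the values. *)
Definition conjA f : AA := elem s (fun a => (coef f (a \o swap_index))^*).

Lemma coef_conjA f a : coef (conjA f) a = (coef f (a \o swap_index))^*.
Proof. by rewrite /conjA coef_elem//; apply: fast_sw; exact: coef_fast. Qed.

Lemma lim_to_conj (u : nat -> C) l : lim_to u l -> lim_to (fun D => (u D)^*) l^*.
Proof.
move=> H e e0; have [N HN] := H e e0; exists N => D /HN.
by rewrite -rmorphB cabs_conj.
Qed.

Lemma conjAE f x : conjA f x = (f x)^*.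
Proof.
apply: (lim_to_unique (coef_val s_gt0 (conjA f) x)).
apply: eq_lim_to (lim_to_conj (coef_val s_gt0 f x)) => D.
rewrite /series -[RHS]bsum_sw /bsum rmorph_sum; apply: eq_bigr => a _.
by rewrite rmorphM /= coef_conjA comp_swK !ba_Delta eb_sw.
Qed.

Lemma conjA_antilinear (c : C) f g : conjA (c *: f + g) = c^* *: conjA f + conjA g.
Proof.
apply/val_inj/funext => x; rewrite /= !conjAE.
rewrite -[LHS]/((c * f x + g x)^*) rmorphD rmorphM /=.
by rewrite -[RHS]/(c^* * conjA f x + conjA g x) !conjAE.
Qed.

Lemma conjAK : involutive conjA.
Proof. by move=> f; apply/val_inj/funext => x; rewrite /= !conjAE conjCK. Qed.

Lemma conjAB f g : conjA (f - g) = conjA f - conjA g.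
Proof.
have := conjA_antilinear (-1) g f.
by rewrite rmorphN rmorph1 !scaleN1r addrC [RHS]addrC.
Qed.

Lemma conjA_continuous : continuous conjA.
Proof.
apply: (semi_additive_continuous (p := @snorm R n s)).
- exact: A_nbhs.
- exact: conjAB.
- move=> k f; apply: snorm_le => a; rewrite coef_conjA cabs_conj -msize_sw.
  exact: snorm_ub.
Qed.

Lemma conjA_eb a : conjA (eb a) = eb (a \o swap_index).
Proof. by apply/val_inj/funext => x; rewrite /= conjAE eb_sw. Qed.

(** The involution reverses the factors and thus exchanges the two bounds of T. The index types
    differ in the order of the arguments of [minn], so the reindexing is a cast. *)
Definition Tswap Q Q' (T : Tset Q Q') : Tset Q' Q :=
  [ffun k => cast_ord (congr1 S (minnC (Q k) (Q' k))) (T k)].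

Lemma TswapK Q Q' : cancel (@Tswap Q Q') (@Tswap Q' Q).
Proof. by move=> T; apply/ffunP => k; apply/val_inj; rewrite !ffunE. Qed.

Lemma Tval_swap Q Q' (T : Tset Q Q') : Tval (Tswap T) = Tval T.
Proof. by apply/ffunP => k; rewrite !ffunE. Qed.

Section Real.
Variable h : C.
Hypothesis hR : h \is Num.real.

Lemma star_coef_conj Q Q' T : (star_coef s h Q Q' T)^* = star_coef s h Q' Q T.
Proof.
have hV : h^-1 \is Num.real by rewrite realV.
have fr m : falling h^-1 m \is Num.real.
  by rewrite /falling rpred_prod// => i _; rewrite rpredB// realn.
have sr : sgn R s T \is Num.real.
  by rewrite /sgn rpred_prod// => k _; rewrite rpredX// /nu; case: ifP; rewrite ?rpredN rpred1.
rewrite conj_Creal; last by rewrite /star_coef !rpredM ?rpredV ?rpredM ?realn.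
rewrite /star_coef; congr (_ * (_ / _) * _%:R).
- by congr falling; apply: eq_bigr => k _; rewrite !ffunE addnC.
- by rewrite mulrC.
- by apply: eq_bigr => k _; rewrite mulnAC.
Qed.

Lemma conjA_star_mono P Q P' Q' : mdeg P = mdeg Q -> mdeg P' = mdeg Q' ->
  conjA (star_mono s h P Q P' Q') = star_mono s h Q' P' Q P.
Proof.
move=> PQ PQ'; apply/val_inj/funext => x; rewrite /= conjAE !star_monoE//.
rewrite /star_monomial !fct_sumE rmorph_sum [RHS](reindex (@Tswap Q P')); last first.
  by apply: onW_bij; exists (@Tswap P' Q); exact: TswapK.
apply: eq_bigr => T _.
rewrite -[LHS]/((_ * _)^*) rmorphM /= star_coef_conj b_red_conj.
rewrite -[X in star_coef _ _ _ _ X]/(Tval T) -[[ffun k => nat_of_ord (Tswap T k)]]/(Tval (Tswap T)) Tval_swap.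
congr (_ * b_red _ _ x); apply/ffunP => k; rewrite !ffunE /= addnC //.
Qed.

Hypothesis Oh : Omega h.

Lemma conjA_star f g : conjA (star h f g) = star h (conjA g) (conjA f).
Proof.
have st_bd := Omega_st n s_gt0 Oh.
have [lr ll] := star_bilinear s_gt0 st_bd.
have ct := star_continuous s_gt0 st_bd.
(* In this form both sides are linear in each argument, since the inner and outer conjugations
   cancel each other's antilinearity, and the comparison reduces to basis elements. *)
suff H : forall f g, star h f g = conjA (star h (conjA g) (conjA f)) by rewrite H conjAK.
apply: bilinear_ext => //.
- split=> [f1 x g1 g2|g1 x f1 f2]; first by rewrite conjA_antilinear ll conjA_antilinear conjCK.
  by rewrite conjA_antilinear lr conjA_antilinear conjCK.
- have c1 : continuous (fun q : AA * AA => star h (conjA q.2) (conjA q.1)).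
    exact: (@continuous_pair_comp _ _ _ _ _ (fun u v => star h v u) _ _ (continuous_swap ct) conjA_continuous conjA_continuous).
  by move=> q; exact: (@continuous_comp _ _ _ (fun q : AA * AA => star h (conjA q.2) (conjA q.1)) conjA q (c1 q) (@conjA_continuous _)).
move=> a b; rewrite !conjA_eb !starE !bil_eb//.
by rewrite /st !Pm_sw !Qm_sw conjA_star_mono ?mdegPQ.
Qed.

End Real.
End Involution.

(** * Holomorphic dependence on hbar *)

Section Holomorphy.
Variables (R : realType) (n s : nat).
Hypothesis s_gt0 : (0 < s)%N.
Local Notation C := (Cplx R).
Local Notation AA := (A R n s).
Local Notation I := ('I_n + 'I_n)%type.
Local Notation II := (I + I)%type.
Local Notation star := (@star R n s).
Implicit Types (f g : AA).

Lemma diff_falling (h : C) m : h != 0 -> differentiable (fun h : C => falling h^-1 m : C) h.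
Proof.
move=> h0; have dI : differentiable (fun z : C => z) h by have := is_diff_id h; case.
elim: m => [|m IH].
  rewrite (_ : (fun _ => _) = cst 1); first exact: differentiable_cst.
  by apply/funext => z; rewrite falling0.
rewrite (_ : (fun _ => _) = fun z => falling z^-1 m * (z^-1 + - m%:R)).
  apply: diff_mul; first exact: IH.
  apply: diff_add; last exact: differentiable_cst.
  exact: differentiableV.
by apply/funext => z; rewrite fallingS.
Qed.

Lemma diff_star_coef Q Q' T (h : C) : h != 0 -> (forall m, falling h^-1 m != 0) ->
  differentiable (fun h : C => @star_coef R n s h Q Q' T) h.
Proof.
move=> h0 f0.
rewrite (_ : (fun _ => _) = fun z => sgn R s T * ((falling z^-1 (mdeg [ffun k => Q k + Q' k - T k]%N) *
   (falling z^-1 (mdeg Q) * falling z^-1 (mdeg Q'))^-1) *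
   (\prod_k ((T k)`! * 'C(Q k, T k) * 'C(Q' k, T k)))%N%:R)); last first.
  by apply/funext => z; rewrite /star_coef [RHS]mulrA.
apply: diff_scale; apply: diff_mul; last exact: differentiable_cst.
apply: diff_mul; first exact: diff_falling.
by apply: differentiableV; [apply: diff_mul; exact: diff_falling|rewrite mulf_neq0].
Qed.

Lemma value_sum (J : Type) (r : seq J) (F : J -> AA) (x : Mred R n s) :
  (\sum_(j <- r) F j : AA) x = \sum_(j <- r) F j x.
Proof. exact: (big_morph (fun f : AA => (f : Mred R n s -> C) x)). Qed.

Lemma valueZ (c : C) f (x : Mred R n s) : (c *: f) x = c * f x.
Proof. by []. Qed.

Lemma star_holomorphic f g (x : Mred R n s) (h0 : C) : Omega h0 ->
  derivable (fun h : C => star h f g x : C) h0 1.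
Proof.
move=> Oh; apply: diff_derivable.
have [r [d [L [r0 d0 L1 H]]]] := Omega_bounds Oh.
have [k Hk] := value_bound s_gt0 x.
have [B B1 HB] := st_bound R n s_gt0 k.
pose K : R := 4 ^+ #|{: I}|; have K0 : 0 <= K by rewrite exprn_ge0.
pose B' : R := 8 * L * B / d.
have B'0 : 0 < B' by rewrite divr_gt0// !mulr_gt0// ?(lt_le_trans ltr01).
have [l Hl] := nat_bound (4 * B').
(* The constants of evaluation at x and of [bil_rate], both the same for all h near [h0]. *)
pose M : R := 2 ^+ #|{: I}| * (2 ^+ #|{: II}| * (snorm l f * snorm l g * K)).
have M0 : 0 <= M by rewrite !mulr_ge0 ?exprn_ge0 ?snorm_ge0.
(* The bounds themselves place h in Omega: for h = 1 / j the lower bound at j would fail. *)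
have lam (h : C) : (forall j : nat, d * j.+1%:R <= cabs (h^-1 - j%:R) <= L * j.+1%:R) -> h != 0 -> Omega h.
  move=> hL hn0; rewrite /Omega /= => -[[j /= j0 hj]|//]; last by move=> e; rewrite e eqxx in hn0.
  have /andP[+ _] := hL j; rewrite -hj invrK subrr cabs0 leNgt.
  by rewrite mulr_gt0.
apply: (@weierstrass R C (fun D h => partial (st s h) D f g x) _ h0 r r0).
  move=> D h; rewrite wnC => /H[hn0 hL].
  have f0 := falling_neq0 d0 hL.
  rewrite (_ : (fun _ => _) = fun z : C => \sum_(m : box II D)
     coef f (boxi m \o inl) * coef g (boxi m \o inr) * (\sum_(T : Tset (Qm (boxi m \o inl)) (Pm (boxi m \o inr)))
       star_coef s z (Qm (boxi m \o inl)) (Pm (boxi m \o inr)) (Tval T) *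
       mono R s (addsub (Pm (boxi m \o inl)) (Pm (boxi m \o inr)) (Tval T))
                (addsub (Qm (boxi m \o inl)) (Qm (boxi m \o inr)) (Tval T)) x)).
    apply: diff_bigsum => m; apply: diff_scale; apply: diff_bigsum => T.
    by apply: diff_mul; [exact: diff_star_coef|exact: differentiable_cst].
  apply/funext => z; rewrite /partial value_sum; apply: eq_bigr => m _.
  rewrite valueZ /st /star_mono value_sum; congr (_ * _).
move=> e e0; have [N HN] := pow2_small (divr_gt0 e0 (ltr_wpDl M0 ltr01)).
rewrite ltr_pdivlMr ?ltr_wpDl// in HN.
exists N => D ND h; rewrite wnC => /H[hn0 hL].
have Ohh := lam _ hL hn0.
have := Hk (partial (st s h) D f g - star h f g).
rewrite -[X in cabs X]/(partial (st s h) D f g x - star h f g x) => H1.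
apply: le_trans H1 _; apply: le_trans (ltW HN).
have H2 := bil_rate s_gt0 (Omega_st n s_gt0 Ohh) f g D K0 B'0 (HB h d L d0 L1 hL) Hl.
apply: le_trans (ler_wpM2l (exprn_ge0 _ (ler0n _ _)) H2) _.
rewrite [leLHS]mulrA -/M mulrC; apply: ler_pM; rewrite ?exprn_ge0 ?invr_ge0//.
  by rewrite ler_wiXn2l ?invr_ge0 ?invf_le1 ?ler1n.
by rewrite lerDl.
Qed.

End Holomorphy.

Theorem theorem5p26 (R : realType) (n s : nat)
    (n_ge1 : (1 <= n)%N) (s_ge1 : (1 <= s)%N) (s_le : (s <= 1 + n)%N) :
  exists star : Cplx R -> A R n s -> A R n s -> A R n s,
    [/\ (forall hbar : Cplx R, Omega hbar ->
           [/\ continuous_extension hbar (star hbar),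
               associative (star hbar) &
               forall mul : A R n s -> A R n s -> A R n s,
                 continuous_extension hbar mul -> mul = star hbar]),
        (forall hbar : Cplx R, Omega hbar -> hbar \is Num.real ->
           exists2 inv : A R n s -> A R n s,
             (forall (f : A R n s) (x : Mred R n s), inv f x = (f x)^*) &
             unital_frechet_star_algebra (star hbar) inv) &
        (forall (f g : A R n s) (x : Mred R n s) (hbar : Cplx R),
           Omega hbar ->
           derivable (fun h : Cplx R => star h f g x : Cplx R) hbar 1)].
Proof.
exists (@star R n s); split=> [h Oh|h Oh hR|f g x h Oh].
- by split; [exact: star_extension|exact: star_assoc|move=> mul; exact: star_unique].
- exists (@conjA R n s); first exact: conjAE.
  have [[[lr ll] _] ct] := star_extension n s_ge1 Oh.
  split.
  + exact: A_frechet.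
  + exact: ll.
  + exact: lr.
  + exact: star_assoc.
  + exact: star_unit.
  + exact: ct.
  + exact: conjA_antilinear.
  + exact: conjAK.
  + exact: conjA_star.
  + exact: conjA_continuous.
- exact: star_holomorphic.
Qed.
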